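(* Let $n=2$ and assume $p_\varepsilon\to p\in(0,\infty)$ and $q_\varepsilon\to q\in(0,\infty]$ as $\varepsilon\to0$. Then, as $\varepsilon\to0$, $$\mathscr C_{0,\varepsilon}=\frac{\pi p}{2+\pi pq^{-1}}\,\rho_\varepsilon\Big(1+\mathcal O\big(\rho_\varepsilon|\ln\rho_\varepsilon|+|q_\varepsilon^{-1}-q^{-1}|+|p_\varepsilon-p|\big)\Big),$$ where $q^{-1}:=0$ for $q=\infty$.
   Context: Let $\varepsilon>0$ be a small parameter and let $\rho_\varepsilon>0$, $d_\varepsilon>0$ satisfy $d_\varepsilon<\rho_\varepsilon/2$ and $\rho_\varepsilon\to0$ as $\varepsilon\to0$. Put $p_\varepsilon=|\ln d_\varepsilon|^{-1}\rho_\varepsilon^{-1}$ and $q_\varepsilon=d_\varepsilon\varepsilon^{-1}\rho_\varepsilon^{-1}$. In $\mathbb R^2$ let $T_{0,\varepsilon}=\{x=(x_1,x_2):\ |x_1|<d_\varepsilon,\ |x_2|<\varepsilon\}$; let $B_{0,\varepsilon}^+$ (resp. $B_{0,\varepsilon}^-$) be the intersection of the open disc of radius $\rho_\varepsilon/2$ centered at $(0,\varepsilon)$ (resp. $(0,-\varepsilon)$) with $\{x_2>\varepsilon\}$ (resp. $\{x_2<-\varepsilon\}$); let $S_{0,\varepsilon}^\pm=\partial B_{0,\varepsilon}^\pm\setminus\{x_2=\pm\varepsilon\}$ and $G_{0,\varepsilon}=\mathrm{int}(\overline{T_{0,\varepsilon}\cup B_{0,\varepsilon}^+\cup B_{0,\varepsilon}^-})$.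 Define $$\mathscr C_{0,\varepsilon}=\inf\{\|\nabla U\|^2_{L^2(G_{0,\varepsilon})}:\ U\in H^1(G_{0,\varepsilon}),\ U=1\text{ on }S_{0,\varepsilon}^+,\ U=0\text{ on }S_{0,\varepsilon}^-\}.$$ *)

(* Defs.v *)
From HB Require Import structures.
From mathcomp Require Import all_boot all_order all_algebra.
From mathcomp Require Import all_classical all_reals all_analysis.

Set Implicit Arguments.
Unset Strict Implicit.
Unset Printing Implicit Defensive.

Import Order.TTheory GRing.Theory Num.Theory.
Import numFieldNormedType.Exports.
Local Open Scope classical_set_scope.
Local Open Scope ring_scope.

Notation plane R := (R * R)%type.

Definition dx1 (R : realType) (f : plane R -> R) : plane R -> R :=
  fun x => 'D_(1, 0) f x.
Definition dx2 (R : realType) (f : plane R -> R) : plane R -> R :=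
  fun x => 'D_(0, 1) f x.

Fixpoint Ck (R : realType) (k : nat) (f : plane R -> R) : Prop :=
  match k with
  | 0 => continuous f
  | k'.+1 =>
    [/\ continuous f,
        forall x, derivable f x (1, 0) /\ derivable f x (0, 1),
        Ck k' (dx1 f) & Ck k' (dx2 f)]
  end.

Definition test_function (R : realType) (G : set (plane R))
    (phi : plane R -> R) : Prop :=
  let supp := closure [set x | phi x != 0] in
  [/\ forall k, Ck k phi, compact supp & supp `<=` G].

Notation area R := (@lebesgue_measure R \x @lebesgue_measure R)%E.

Definition normL2_sq (R : realType) (G : set (plane R)) (f : plane R -> R)
    : \bar R :=
  (\int[area R]_(x in G) ((f x) ^+ 2)%:E)%E.

Definition in_L2 (R : realType) (G : set (plane R)) (f : plane R -> R) : Prop :=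
  measurable_fun G f /\ (normL2_sq G f < +oo)%E.

(* [U] is in the Sobolev space H^1(G) and [(g1, g2)] is its weak gradient. *)
Definition H1_grad (R : realType) (G : set (plane R))
    (U g1 g2 : plane R -> R) : Prop :=
  [/\ in_L2 G U, in_L2 G g1, in_L2 G g2 &
   forall phi, test_function G phi ->
    (\int[area R]_(x in G) (U x * dx1 phi x)%:E
       = - \int[area R]_(x in G) (g1 x * phi x)%:E)%E /\
    (\int[area R]_(x in G) (U x * dx2 phi x)%:E
       = - \int[area R]_(x in G) (g2 x * phi x)%:E)%E].

Definition circle_pt (R : realType) (c : plane R) (r t : R) : plane R :=
  (c.1 + r * cos t, c.2 + r * sin t).

Definition angles (R : realType) (c : plane R) (r : R) (S : set (plane R))
    : set R :=
  [set t | 0 <= t < 2 * pi /\ S (circle_pt c r t)].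

(* Squared norm in L^2(S) for the arc-length measure, where [S] is a subset of
   the circle of centre [c] and radius [r]. *)
Definition normL2_arc_sq (R : realType) (c : plane R) (r : R)
    (S : set (plane R)) (f : plane R -> R) : \bar R :=
  (\int[@lebesgue_measure R]_(t in angles c r S)
     (r * (f (circle_pt c r t)) ^+ 2)%:E)%E.

(* The function [U] of H^1(G), with weak gradient [(g1, g2)], has trace [b] on
   the subset [S] of the circle of centre [c] and radius [r].  The trace
   operator is the continuous extension to H^1(G), with values in L^2, of the
   restriction to the boundary of functions that are C^1 up to the boundary. *)
Definition trace_on_arc (R : realType) (G : set (plane R))
    (U g1 g2 : plane R -> R) (c : plane R) (r : R) (S : set (plane R))
    (b : plane R -> R) : Prop :=
  exists u : nat -> plane R -> R,
    [/\ forall k, Ck 1 (u k),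
        normL2_sq G (u k \- U) @[k --> \oo] --> 0%E,
        normL2_sq G (dx1 (u k) \- g1) @[k --> \oo] --> 0%E,
        normL2_sq G (dx2 (u k) \- g2) @[k --> \oo] --> 0%E &
        normL2_arc_sq c r S (u k \- b) @[k --> \oo] --> 0%E].

Section geometry.
Context (R : realType) (rho d e : R).

Definition T0 : set (plane R) := [set x | `|x.1| < d /\ `|x.2| < e].

Definition ctr_plus : plane R := (0, e).
Definition ctr_minus : plane R := (0, - e).

Definition open_disc (c : plane R) (r : R) : set (plane R) :=
  [set x | Num.sqrt ((x.1 - c.1) ^+ 2 + (x.2 - c.2) ^+ 2) < r].

Definition B_plus : set (plane R) :=
  open_disc ctr_plus (rho / 2) `&` [set x | x.2 > e].
Definition B_minus : set (plane R) :=
  open_disc ctr_minus (rho / 2) `&` [set x | x.2 < - e].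

Definition frontier (A : set (plane R)) : set (plane R) :=
  closure A `\` interior A.

Definition S_plus : set (plane R) := frontier B_plus `\` [set x | x.2 = e].
Definition S_minus : set (plane R) := frontier B_minus `\` [set x | x.2 = - e].

Definition G0 : set (plane R) := interior (closure (T0 `|` B_plus `|` B_minus)).

Definition capacity : \bar R :=
  ereal_inf [set E : \bar R | exists U g1 g2 : plane R -> R,
    [/\ H1_grad G0 U g1 g2,
        trace_on_arc G0 U g1 g2 ctr_plus (rho / 2) S_plus (cst 1),
        trace_on_arc G0 U g1 g2 ctr_minus (rho / 2) S_minus (cst 0) &
        E = (\int[area R]_(x in G0) ((g1 x) ^+ 2 + (g2 x) ^+ 2)%:E)%E]].

Definition p_eps : R := `|ln d|^-1 * rho^-1.
Definition q_eps : R := d * e^-1 * rho^-1.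

End geometry.

(* Main.v *)
Require Import Defs.
From HB Require Import structures.
From mathcomp Require Import all_boot all_order all_algebra.
From mathcomp Require Import all_classical all_reals all_analysis.
From mathcomp Require Import measurable_realfun ring lra.

(**
The capacity is squeezed between the reciprocals of two resistances, with r = rho / 2.

Lower bound.  The symmetric curves that descend vertically through the channel and
continue outside it as rays of slope m, |m| < M, sweep disjoint parts of the channel and
of the two half discs.  Cauchy-Schwarz along each of them, integrated with
the weight 1 / (1 + m^2), shows that a C^1 function equal to 1 and 0 on the two arcs has
energy at least the reciprocal of e / d + (1 + ln (al r / d)) / al, where al = atan M;
the choice M = 1 / rho is large enough.  The two traces are approximated by two different
sequences of C^1 functions, which are glued inside the channel.

Upper bound.  The trial function is affine in x2 in the channel, up to a C^1 smoothing, and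
a radial C^1 truncation of the logarithm in each half disc, constant at distance at most
d + 2 e from the centre.  Optimising the share of the potential drop taken by the channel
gives the reciprocal of about e / d + (2 / pi) ln (r / (d + 2 e)).

Both resistances, multiplied by rho, are 1 / q + 2 / (pi p) up to the claimed error, since
|ln d| rho = 1 / p_eps and rho e / d = 1 / q_eps.
*)

Import Order.TTheory GRing.Theory Num.Theory.
Import numFieldNormedType.Exports.
Local Open Scope classical_set_scope.
Local Open Scope ring_scope.

Set Implicit Arguments.
Unset Strict Implicit.
Unset Printing Implicit Defensive.

(** * Integration and derivatives on the plane *)

(** Traces are defined only through [L^2] limits of C^1 functions, so the lower bound has to
    tolerate small [L^2] errors on the arcs and in the domain. Cauchy-Schwarz is therefore used in
    the linear form a^2 >= 2 k a - k^2, against a comparison field of prescribed flux [lam], uniform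
    in the channel and radial in the two cones; [lam] is optimised only at the end. The weight 1 /
    (1 + m^2) is the angular measure in the slope variable. It spreads the radial flux evenly over
    angles, and putting the vertical part of the curve at (d / al) atan m spreads the same flux
    evenly over the channel width, so that the values at the corners of each curve cancel. The angle
    lost by bounding slopes costs 1 / al - 2 / pi = O(rho) when M = 1 / rho. This M is admissible
    because d is exponentially small in 1 / rho, as ln d = - 1 / (p_eps rho). Replacing d by d + 2
    e, where e / d = 1 / (q_eps rho), changes the logarithm by O(|ln rho|) only; multiplied by rho
    this is the error rho |ln rho|. *)

Section affine.
Context {R : realType}.
Local Notation mu := (@lebesgue_measure R).
Variables (k b : R).
Hypothesis k0 : k != 0.

Let aff (x : R) : R := k * x + b.

Let maff : measurable_fun setT aff.
Proof.
apply: measurable_funD => //; exact: measurable_funM.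
Qed.

Let nu : {measure set (measurableTypeR R) -> \bar R}.
Proof.
refine (mscale (NngNum (normr_ge0 k)) (pushforward mu (aff : _ -> measurableTypeR R))).
exact: maff.
Defined.

(** Uniqueness of Lebesgue measure: [|k|] times the pushforward along the affine map has the right
    value on half-open intervals. A negative [k] turns []x, y]] into an interval closed on the left,
    hence the two cases. *)
Lemma lebesgue_measure_affine (A : set R) : measurable A ->
  mu A = (`|k|%:E * mu (aff @^-1` A))%E.
Proof.
move=> mA.
rewrite (@lebesgue_measure_unique R nu) //.
move=> _ [[x y]] _ <-.
change (mu `]x, y]%classic = (`|k|%:E * mu (aff @^-1` `]x, y]%classic)))%E.
have [k1|k1] := ltP 0 k.
  have -> : aff @^-1` `]x, y]%classic = `](x - b) / k, (y - b) / k]%classic.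
    apply/seteqP; split => t /=; rewrite !in_itv/= /aff ltr_pdivrMr// ler_pdivlMr// mulrC ltrBlDr lerBrDr//.
  rewrite !lebesgue_measure_itv/= !lte_fin ltr_pM2r ?invr_gt0// ltrD2r.
  case: ifPn => _; last by rewrite mule0.
  rewrite gtr0_norm// -!EFinB -EFinM; congr EFin.
  by field.
have {}k1 : k < 0 by rewrite lt_neqAle k0.
have -> : aff @^-1` `]x, y]%classic = `[(y - b) / k, (x - b) / k[%classic.
  apply/seteqP; split => t /=; rewrite !in_itv/= /aff ltr_ndivlMr// ler_ndivrMr// mulrC ltrBlDr lerBrDr andbC//.
rewrite !lebesgue_measure_itv/= !lte_fin ltr_nM2r ?invr_lt0// ltrD2r.
case: ifPn => _; last by rewrite mule0.
rewrite ltr0_norm// -!EFinB -EFinM; congr EFin.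
by field.
Qed.

Lemma ge0_integral_affine (f : R -> \bar R) : measurable_fun setT f ->
  (forall x, (0 <= f x)%E) ->
  (\int[mu]_x f x = `|k|%:E * \int[mu]_x f (k * x + b)%R)%E.
Proof.
move=> mf f0.
rewrite (eq_measure_integral nu); last first.
  by move=> A mA _; exact: lebesgue_measure_affine.
rewrite /nu ge0_integral_mscale//; congr (_ * _)%E.
by rewrite ge0_integral_pushforward// preimage_setT.
Qed.
End affine.

Section plane_measurability.
Context {R : realType}.

(** The measurable sets of the plane are those of the product structure, so an open set is exhibited
    as a countable union of squares with rational centre and half-side 1 / (n + 1). *)
Lemma open_measurable_plane (A : set (plane R)) : open A -> measurable A.
Proof.
move=> oA.
pose box (q : rat * rat * nat) : set (plane R) :=
  ball (ratr q.1.1 : R) (q.2.+1%:R^-1) `*` ball (ratr q.1.2 : R) (q.2.+1%:R^-1).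
have -> : A = \bigcup_q (if `[< box q `<=` A >] then box q else set0).
  apply/seteqP; split => [[x y] Axy|z [q _]]; last by case: asboolP => // qA /qA.
  have /nbhs_ballP[e /= e0 eA] : nbhs (x, y) A by exact: open_nbhs_nbhs.
  pose n := Num.truncn (2 / e).
  have n1 : n.+1%:R^-1 < e / 2.
    by rewrite -[e / 2]invrK ltf_pV2 ?posrE ?invr_gt0 ?divr_gt0// invf_div truncnS_gt.
  have n0 : 0 < n.+1%:R^-1 :> R by rewrite invr_gt0.
  rewrite /box; clearbody n.
  have [q1 q1P] : exists q : rat, ratr q \in `]x - n.+1%:R^-1, x + n.+1%:R^-1[.
    apply: rat_in_itvoo; move: n0; set t := _^-1 => ?; lra.

  have [q2 q2P] : exists q : rat, ratr q \in `]y - n.+1%:R^-1, y + n.+1%:R^-1[.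
    apply: rat_in_itvoo; move: n0; set t := _^-1 => ?; lra.
  move: q1P q2P; rewrite !in_itv/= => /andP[q1a q1b] /andP[q2a q2b].
  exists (q1, q2, n) => //=.
  move: n1 n0 q1a q1b q2a q2b; set t := n.+1%:R^-1 => n1 n0 q1a q1b q2a q2b.
  case: asboolP => [_|].
    by split; rewrite /ball/= ltr_norml; apply/andP; split; lra.
  case => -[u v] [/=]; rewrite /ball /= !ltr_norml => h1 h2.
  by apply: eA; split; rewrite /ball /= ltr_norml; apply/andP; split; lra.
apply: countable_bigcupT_measurable => [|q]; first exact: countableP.
case: asboolP => // _.
by apply: measurableX; apply: measurable_ball.
Qed.

Lemma closed_measurable_plane (A : set (plane R)) : closed A -> measurable A.
Proof.
by move=> cA; rewrite -(setCK A); apply: measurableC; apply: open_measurable_plane; rewrite openC.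
Qed.

Lemma continuous_measurable_plane (f : plane R -> R) :
  continuous f -> measurable_fun setT f.
Proof.
move=> /continuousP cf.
apply: (measurability _ (RGenOpens.measurableE R)).
move=> _ [_ [a [b ->] <-]].
rewrite setTI; apply: open_measurable_plane; apply: cf; exact: interval_open.
Qed.

End plane_measurability.

Section plane_tonelli.
Context {R : realType}.
Local Notation mu := (@lebesgue_measure R).
Variable f : plane R -> \bar R.
Hypothesis mf : measurable_fun setT f.
Hypothesis f0 : forall x, (0 <= f x)%E.

Lemma measurable_fun_integral1 :
  measurable_fun setT (fun y : R => \int[mu]_x f (x, y))%E.
Proof. exact: (@measurable_fun_fubini_tonelli_G _ _ _ _ _ mu f mf f0). Qed.

Lemma measurable_fun_integral2 :
  measurable_fun setT (fun x : R => \int[mu]_y f (x, y))%E.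
Proof. exact: (@measurable_fun_fubini_tonelli_F _ _ _ _ _ mu f mf f0). Qed.

Lemma ge0_integral_plane12 :
  (\int[area R]_z f z = \int[mu]_x \int[mu]_y f (x, y))%E.
Proof. exact: (@fubini_tonelli1 _ _ _ _ _ mu mu f mf f0). Qed.

Lemma ge0_integral_plane21 :
  (\int[area R]_z f z = \int[mu]_y \int[mu]_x f (x, y))%E.
Proof. exact: (@fubini_tonelli2 _ _ _ _ _ mu mu f mf f0). Qed.

Lemma ge0_integral_plane_setU (A B : set (plane R)) :
  measurable A -> measurable B -> A `&` B `<=` set0 ->
  (\int[area R]_(z in A `|` B) f z =
   \int[area R]_(z in A) f z + \int[area R]_(z in B) f z)%E.
Proof.
move=> mA mB AB; apply: ge0_integral_setU => //.
- exact: measurable_funTS.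
- by apply/disj_set2P; apply/seteqP; split.
Qed.

Lemma ge0_subset_integral_plane (A B : set (plane R)) :
  measurable A -> measurable B -> A `<=` B ->
  (\int[area R]_(z in A) f z <= \int[area R]_(z in B) f z)%E.
Proof.
move=> mA mB AB; apply: ge0_subset_integral => //.
exact: measurable_funTS.
Qed.

End plane_tonelli.

(** * Slope and height as coordinates *)

Section slope_coordinates.
Context {R : realType}.
Local Notation mu := (@lebesgue_measure R).

Let measurable_affine (s c : R) : measurable_fun setT (fun y : R => s * y + c).
Proof. by apply: measurable_funD => //; apply: measurable_funM. Qed.

Lemma measurable_affine_plane (c s : R) :
  measurable_fun setT (fun x : plane R => (x.1 * x.2, c + s * x.2) : plane R).
Proof.
apply/measurable_fun_pairP; split => /=.
  exact: measurable_funM.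
by apply: measurable_funD => //; apply: measurable_funM.
Qed.

(* The rays from [(0, c)] are parametrised by their slope [m] and their height
   [y]; only affine substitutions are then needed to reach these coordinates. *)
Lemma ge0_integral_slope (c s : R) (f : plane R -> \bar R) : `|s| = 1 ->
  measurable_fun setT f -> (forall x, (0 <= f x)%E) ->
  (\int[area R]_x f x =
   \int[mu]_m \int[mu]_y (`|y|%:E * f (m * y, c + s * y)%R))%E.
Proof.
move=> s1 mf f0.
have s0 : s != 0 by rewrite -normr_eq0 s1 oner_eq0.
pose g (z : plane R) := (`|z.2|%:E * f (z.1 * z.2, c + s * z.2)%R)%E.
have mg : measurable_fun setT g.
  apply: emeasurable_funM; first by apply/measurable_EFinP; exact: measurableT_comp.
  apply: (measurableT_comp mf); exact: measurable_affine_plane.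
have g0 z : (0 <= g z)%E by rewrite mule_ge0.
rewrite (ge0_integral_plane21 mf f0).
rewrite -[RHS](ge0_integral_plane12 mg g0) (ge0_integral_plane21 mg g0).
have mF := measurable_fun_integral1 mf f0.
rewrite (ge0_integral_affine c s0 mF); last by move=> y; exact: integral_ge0.
rewrite s1 mul1e.
(* The substitution x1 = m * y degenerates at y = 0; this null set of heights is removed on both
   sides. *)
have m0 : measurable ([set: R] `\ 0) by apply: measurableD.
rewrite -[LHS](@integral_setD1 _ _ 0 setT m0); last first.
  apply: measurable_funTS.
  exact: (measurableT_comp mF (measurable_affine s c)).
rewrite -[RHS](@integral_setD1 _ _ 0 setT m0); last first.
  apply: measurable_funTS; exact: measurable_fun_integral1.
apply: eq_integral => y; rewrite inE/= => -[_ /eqP y0].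
have mfy : measurable_fun setT (fun x : R => f (x, s * y + c)).
  exact: (measurableT_comp mf (measurable_pair2 _)).
rewrite (ge0_integral_affine 0 y0 mfy)//.
rewrite -ge0_integralZl//.
  by apply: eq_integral => m _; rewrite /g/= addr0 [c + _]addrC [y * m]mulrC.
exact: (measurableT_comp mfy (measurable_affine y 0)).
Qed.

End slope_coordinates.

(** * Lower bounds on one fibre *)

Section fibre_bound.
Context {R : realType}.
Local Notation mu := (@lebesgue_measure R).

(** The minorant [c] may change sign and [f] may have infinite integral, so neither monotonicity for
    nonnegative functions nor that for integrable functions applies directly; the positive part of
    [c] is the intermediate term. *)
Lemma le_integral_minorant d (T : measurableType d) (nu : {measure set T -> \bar R})
    (D : set T) (c f : T -> \bar R) : measurable D ->
  nu.-integrable D c -> measurable_fun D f -> (forall x, D x -> (0 <= f x)%E) ->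
  (forall x, D x -> (c x <= f x)%E) ->
  (\int[nu]_(x in D) c x <= \int[nu]_(x in D) f x)%E.
Proof.
move=> mD ic mf f0 cf.
have mc := measurable_int nu ic.
rewrite integralE.
apply: (@le_trans _ _ (\int[nu]_(x in D) (c^\+ x))%E).
  rewrite leeBlDr; last first.
    exact: integrable_neg_fin_num.
  by rewrite leeDl// integral_ge0.
apply: ge0_le_integral => //.
  exact: measurable_funepos.
by move=> x Dx; rewrite funeposE ge_max cf// f0.
Qed.

Lemma ge0_integral_ge_FTC (F G : R -> R) (a b : R) (f : R -> \bar R) : a <= b ->
  (forall y, a <= y <= b -> is_derive y 1 F (G y)) ->
  {within `[a, b], continuous G} ->
  measurable_fun `]a, b[ f -> (forall y, a < y < b -> (0 <= f y)%E) ->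
  (forall y, a < y < b -> ((G y)%:E <= f y)%E) ->
  ((F b - F a)%:E <= \int[mu]_(y in `]a, b[) f y)%E.
Proof.
rewrite le_eqVlt => /predU1P[<- _ _ _ f0 _|ab dF cG mf f0 Gf].
  rewrite subrr; apply: integral_ge0 => y /=; rewrite in_itv/=; exact: f0.
have iG : mu.-integrable `[a, b] (EFin \o G).
  by apply: continuous_compact_integrable => //; exact: segment_compact.
rewrite EFinB -(continuous_FTC2 ab cG); first last.
- move=> y; rewrite in_itv/= => /andP[/ltW ay /ltW yb].
  by rewrite derive1E; apply: derive_val; apply: dF; rewrite ay.
- split => [y||].
  + rewrite in_itv/= => /andP[/ltW ay /ltW yb].
    by have [] : is_derive y 1 F (G y) by apply: dF; rewrite ay.
  + apply: cvg_at_right_filter; apply: differentiable_continuous; apply/derivable1_diffP.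
    by have [] : is_derive a 1 F (G a) by apply: dF; rewrite lexx ltW.
  + apply: cvg_at_left_filter; apply: differentiable_continuous; apply/derivable1_diffP.
    by have [] : is_derive b 1 F (G b) by apply: dF; rewrite lexx ltW.
rewrite (@integral_itv_bndoo _ _ _ _ true false)//; last first.
  apply: (measurable_funS _ _ (measurable_int _ iG)) => //.
  exact: subset_itv_oo_cc.
apply: le_integral_minorant => //.
- apply: (integrableS _ _ _ iG) => //; exact: subset_itv_oo_cc.
Qed.

End fibre_bound.

(** * Partial and directional derivatives *)

Section derivatives.
Context {R : realType}.
Implicit Types (f : plane R -> R).

(** Both difference quotients are the same function of h, which makes the one-variable rules of
    derivation available for directional derivatives. *)
Lemma is_derive_lineP f (a v : plane R) (l : R) :
  is_derive (0 : R) 1 (fun t : R => f (a.1 + t * v.1, a.2 + t * v.2)) l <->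
  is_derive a v f l.
Proof.
have E : (fun h : R => h^-1 *: ((f \o shift a) (h *: v) - f a)) =
    (fun h => h^-1 *: (((fun t : R => f (a.1 + t * v.1, a.2 + t * v.2)) \o shift 0) (h *: 1) -
       f (a.1 + 0 * v.1, a.2 + 0 * v.2))).
  apply/funext => h /=; congr (_ *: (f _ - f _)).
  - by rewrite addr0 [in RHS]/GRing.scale/= mulr1; apply/pair_equal_spec; split => /=; rewrite addrC.
  - by rewrite !mul0r !addr0; case: a.
split => -[d1 d2]; split.
- by move: d1; rewrite /derivable -E.
- by move: d2; rewrite /derive -E.
- by move: d1; rewrite /derivable -E.
- by move: d2; rewrite /derive -E.
Qed.

Lemma is_derive1_shift (g : R -> R) (x c l : R) :
  is_derive (x + c) 1 g l -> is_derive x 1 (fun t => g (t + c)) l.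
Proof.
move=> h.
have k : is_derive x 1 (fun t : R => t + c) 1.
  by apply: is_derive_eq; rewrite addr0.
have := @is_derive1_comp R g (fun t => t + c) x l 1 h k.
by rewrite mulr1.
Qed.

Lemma is_derive_dx1P f (x y l : R) :
  is_derive x 1 (fun t : R => f (t, y)) l <-> is_derive ((x, y) : plane R) (1, 0) f l.
Proof.
rewrite -is_derive_lineP /=; split => h.
  have -> : (fun t => f (x + t * 1, y + t * 0)) = (fun t => f (t + x, y)).
    by apply/funext => t; rewrite mulr1 mulr0 addr0 addrC.
  by apply: (@is_derive1_shift (fun t => f (t, y))); rewrite add0r.
have -> : (fun t => f (t, y)) = (fun t => (fun t => f (x + t * 1, y + t * 0)) (t - x)).
  by apply/funext => t /=; rewrite mulr1 mulr0 addr0 subrKC.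
by apply: (@is_derive1_shift (fun t => f (x + t * 1, y + t * 0))); rewrite subrr.
Qed.

Lemma is_derive_dx2P f (x y l : R) :
  is_derive y 1 (fun t : R => f (x, t)) l <-> is_derive ((x, y) : plane R) (0, 1) f l.
Proof.
rewrite -is_derive_lineP /=; split => h.
  have -> : (fun t => f (x + t * 0, y + t * 1)) = (fun t => f (x, t + y)).
    by apply/funext => t; rewrite mulr1 mulr0 addr0 addrC.
  by apply: (@is_derive1_shift (fun t => f (x, t))); rewrite add0r.
have -> : (fun t => f (x, t)) = (fun t => (fun t => f (x + t * 0, y + t * 1)) (t - y)).
  by apply/funext => t /=; rewrite mulr1 mulr0 addr0 subrKC.
by apply: (@is_derive1_shift (fun t => f (x + t * 0, y + t * 1))); rewrite subrr.
Qed.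

Lemma Ck1_dx1 f : Ck 1 f -> forall x y : R, is_derive x 1 (fun t : R => f (t, y)) (dx1 f (x, y)).
Proof.
by move=> [_ d _ _] x y; apply/is_derive_dx1P; split => //; have [] := d (x, y).
Qed.

Lemma Ck1_dx2 f : Ck 1 f -> forall x y : R, is_derive y 1 (fun t : R => f (x, t)) (dx2 f (x, y)).
Proof.
by move=> [_ d _ _] x y; apply/is_derive_dx2P; split => //; have [] := d (x, y).
Qed.

Lemma cvg_is_derive (g : R -> R) (x l : R) :
  (fun h => h^-1 *: (g (h + x) - g x)) @ 0^' --> l -> is_derive x 1 g l.
Proof.
have -> : (fun h => h^-1 *: (g (h + x) - g x)) =
   (fun h => h^-1 *: ((g \o shift x) (h *: 1) - g x)).
  by apply/funext => h /=; rewrite [h *: 1]mulr1.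
move=> h; split; first exact: cvgP h.
by apply: cvg_lim h; exact: Rhausdorff.
Qed.

Lemma MVT_unordered (g dg : R -> R) (x y : R) :
  (forall t : R, is_derive t 1 g (dg t)) ->
  exists2 z, `|z - x| <= `|y - x| & g y - g x = dg z * (y - x).
Proof.
move=> dgP.
have cg a b : {within `[a, b], continuous g}.
  apply: continuous_subspaceT => t; apply: differentiable_continuous; apply/derivable1_diffP.
  by have [] := dgP t.
have [xy|/ltW yx] := leP x y.
  have [z /[!in_itv]/= /andP[z1 z2] E] := MVT_segment xy (fun t _ => dgP t) (cg x y).
  by exists z => //; rewrite !ger0_norm ?subr_ge0// lerD2r.
have [z /[!in_itv]/= /andP[z1 z2] E] := MVT_segment yx (fun t _ => dgP t) (cg y x).
exists z; first by rewrite !ler0_norm ?subr_le0// lerN2 lerD2r.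
by rewrite -opprB E -mulrN opprB.
Qed.

(** [Ck] supplies continuous partial derivatives, not differentiability. The increment is split into
    a horizontal and a vertical one, the mean value theorem is applied to each, and continuity of
    the partial derivatives at [(a, b)] concludes. *)
Lemma Ck1_is_derive_line f (a b v1 v2 : R) : Ck 1 f ->
  is_derive (0 : R) 1 (fun t : R => f (a + t * v1, b + t * v2))
    (v1 * dx1 f (a, b) + v2 * dx2 f (a, b)).
Proof.
move=> C1f.
have [_ _ c1 c2] := C1f; rewrite /= in c1 c2.
apply: cvg_is_derive; apply/cvgrPdist_le => /= eps eps0.
pose K := 1 + `|v1| + `|v2|.
have K0 : 0 < K by rewrite /K; have := normr_ge0 v1; have := normr_ge0 v2; lra.
have e0 : 0 < eps / K by rewrite divr_gt0.
have /cvgrPdist_le/(_ _ e0)/nbhs_ballP[r1 /= r10 h1] := c1 (a, b).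
have /cvgrPdist_le/(_ _ e0)/nbhs_ballP[r2 /= r20 h2] := c2 (a, b).
near=> t.
have t0 : t != 0 by near: t; exact: nbhs_dnbhs_neq.
have tr : `|t| * K < Num.min r1 r2.
  rewrite -ltr_pdivlMr//; near: t; apply: dnbhs0_lt; rewrite divr_gt0// lt_min r10//.
move: tr; rewrite lt_min => /andP[tr1 tr2].
have tv v : `|v| <= K -> `|t * v| <= `|t| * K by move=> vK; rewrite normrM ler_wpM2l.
have {}tv1 : `|t * v1| <= `|t| * K.
  by apply: tv; rewrite /K; have := normr_ge0 v2; lra.
have {tv}tv2 : `|t * v2| <= `|t| * K.
  by apply: tv; rewrite /K; have := normr_ge0 v1; lra.
rewrite addr0 !mul0r !addr0.
have [z1 z1P E1] := MVT_unordered a (a + t * v1) (fun s => Ck1_dx1 C1f s (b + t * v2)).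
have [z2 z2P E2] := MVT_unordered b (b + t * v2) (fun s => Ck1_dx2 C1f a s).
have -> : f (a + t * v1, b + t * v2) - f (a, b) =
  dx1 f (z1, b + t * v2) * (t * v1) + dx2 f (a, z2) * (t * v2).
  have D (x y : R) : x + y - x = y by ring.
  by move: E1 E2; rewrite (D a) (D b) => <- <-; ring.
have -> : t^-1 *: (dx1 f (z1, b + t * v2) * (t * v1) + dx2 f (a, z2) * (t * v2)) =
  v1 * dx1 f (z1, b + t * v2) + v2 * dx2 f (a, z2).
  by rewrite /GRing.scale/=; field.
have {h1}h1 : `|dx1 f (a, b) - dx1 f (z1, b + t * v2)| <= eps / K.
  apply: h1; split; rewrite /ball/=.
    rewrite distrC (le_lt_trans z1P)// (le_lt_trans _ tr1)//.
    by rewrite addrC addKr.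
  by rewrite opprD addNKr normrN (le_lt_trans tv2).
have {h2}h2 : `|dx2 f (a, b) - dx2 f (a, z2)| <= eps / K.
  apply: h2; split; rewrite /ball/=.
    by rewrite subrr normr0.
  rewrite distrC (le_lt_trans z2P)// (le_lt_trans _ tr2)//.
  by rewrite addrC addKr.
have -> : v1 * dx1 f (a, b) + v2 * dx2 f (a, b) -
  (v1 * dx1 f (z1, b + t * v2) + v2 * dx2 f (a, z2)) =
  v1 * (dx1 f (a, b) - dx1 f (z1, b + t * v2)) + v2 * (dx2 f (a, b) - dx2 f (a, z2)) by ring.
apply: (le_trans (ler_normD _ _)); rewrite !normrM.
apply: (@le_trans _ _ (`|v1| * (eps / K) + `|v2| * (eps / K))).
  by apply: lerD; apply: ler_wpM2l.
rewrite -mulrDl mulrCA -[leRHS]mulr1 ler_pM2l// ler_pdivrMr// mul1r /K; lra.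
Unshelve. all: by end_near.
Qed.

Lemma Ck1_is_derive_affine f (m a s c y : R) : Ck 1 f ->
  is_derive y 1 (fun t : R => f (m * t + a, s * t + c))
    (m * dx1 f (m * y + a, s * y + c) + s * dx2 f (m * y + a, s * y + c)).
Proof.
move=> C1f.
have := Ck1_is_derive_line (m * y + a) (s * y + c) m s C1f.
rewrite -[X in is_derive X](subrr y) => /is_derive1_shift.
set g := (X in is_derive _ _ X); suff -> : g = fun t => f (m * t + a, s * t + c) by [].
by apply/funext => t; rewrite /g; congr (f (_, _)); ring.
Qed.

End derivatives.

(** * Continuity and the domain *)

Section continuity.
Context {R : realType} {T : topologicalType}.
Implicit Types f g : T -> R.

Lemma continuous_add f g : continuous f -> continuous g -> continuous (fun x => f x + g x).
Proof. by move=> cf cg x; apply: cvgD; [exact: cf|exact: cg]. Qed.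

Lemma continuous_opp f : continuous f -> continuous (fun x => - f x).
Proof. by move=> cf x; apply: cvgN; exact: cf. Qed.

Lemma continuous_mul f g : continuous f -> continuous g -> continuous (fun x => f x * g x).
Proof. by move=> cf cg x; apply: cvgM; [exact: cf|exact: cg]. Qed.

Lemma continuous_exprn f n : continuous f -> continuous (fun x => f x ^+ n).
Proof. by move=> cf x; apply: continuous_comp (cf x) (@exprn_continuous R n (f x)). Qed.

Lemma continuous_normr f : continuous f -> continuous (fun x => `|f x|).
Proof. by move=> cf x; apply: cvg_norm; exact: cf. Qed.

Lemma continuous_inv f : (forall x, f x != 0) -> continuous f -> continuous (fun x => (f x)^-1).
Proof. by move=> f0 cf x; apply: cvgV => //; exact: cf. Qed.

Lemma continuous_compose (h : R -> R) f : continuous h -> continuous f -> continuous (fun x => h (f x)).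
Proof. by move=> ch cf x; apply: continuous_comp; [exact: cf|exact: ch]. Qed.

Lemma continuous_compose_pair (h : plane R -> R) f g : continuous h ->
  continuous f -> continuous g -> continuous (fun x => h (f x, g x)).
Proof.
move=> ch cf cg x; apply: (@continuous_comp _ _ _ (fun x => (f x, g x)) h); last exact: ch.
exact: (cvg_pair (cf x) (cg x)).
Qed.

Lemma open_lt_fun f a : continuous f -> open [set x | f x < a].
Proof.
move=> /continuousP cf; rewrite (_ : [set _ | _] = f @^-1` `]-oo, a[%classic).
  by apply: cf; exact: interval_open.
by apply/seteqP; split => x; rewrite /= in_itv.
Qed.

Lemma open_gt_fun f a : continuous f -> open [set x | a < f x].
Proof.
move=> /continuousP cf; rewrite (_ : [set _ | _] = f @^-1` `]a, +oo[%classic).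
  by apply: cf; exact: interval_open.
by apply/seteqP; split => x; rewrite /= in_itv/= andbT.
Qed.

Lemma closed_le f a : continuous f -> closed [set x | f x <= a].
Proof.
by move=> cf; rewrite (_ : [set _ | _] = f @^-1` [set y | y <= a])//; apply: closed_comp => // x _; exact: cf.
Qed.

Lemma closed_ge f a : continuous f -> closed [set x | a <= f x].
Proof.
by move=> cf; rewrite (_ : [set _ | _] = f @^-1` [set y | a <= y])//; apply: closed_comp => // x _; exact: cf.
Qed.

End continuity.

Lemma continuous_fst {R : realType} : continuous (fun x : plane R => x.1).
Proof. by move=> x; exact: cvg_fst. Qed.

Lemma continuous_snd {R : realType} : continuous (fun x : plane R => x.2).
Proof. by move=> x; exact: cvg_snd. Qed.

Ltac cont :=
  match goal with
  | |- forall z, continuous_at z (fun x => fst x) => exact: continuous_fst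
  | |- forall z, continuous_at z (fun x => snd x) => exact: continuous_snd
  | |- forall z, continuous_at z fst => exact: continuous_fst
  | |- forall z, continuous_at z snd => exact: continuous_snd
  | |- forall z, continuous_at z id => by move=> ?; exact: cvg_id
  | |- forall z, continuous_at z (fun x => x) => by move=> ?; exact: cvg_id
  | |- forall z, continuous_at z (fun _ => ?c) => exact: cst_continuous
  | |- forall z, continuous_at z (fun x => (@?f x + @?g x)%R) => refine (@continuous_add _ _ f g _ _); cont
  | |- forall z, continuous_at z (fun x => (- @?f x)%R) => refine (@continuous_opp _ _ f _); cont
  | |- forall z, continuous_at z (fun x => (@?f x * @?g x)%R) => refine (@continuous_mul _ _ f g _ _); cont
  | |- forall z, continuous_at z (fun x => ((@?f x) ^+ ?n)%R) => refine (@continuous_exprn _ _ f n _); cont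
  | |- forall z, continuous_at z (fun x => `|@?f x|%R) => refine (@continuous_normr _ _ f _); cont
  | |- _ => try assumption
  end.

(** * Geometry of the domain and of the arcs *)

Section geometry_facts.
Context {R : realType} (rho d e : R).
Hypotheses (rho0 : 0 < rho) (d0 : 0 < d) (drho : d < rho / 2) (e0 : 0 < e).

Let r_gt0 : 0 < rho / 2. Proof. exact: divr_gt0. Qed.

Lemma open_discE (c : plane R) (r : R) : 0 < r ->
  open_disc c r = [set x | (x.1 - c.1) ^+ 2 + (x.2 - c.2) ^+ 2 < r ^+ 2].
Proof.
move=> r0; apply/seteqP; split => x /=.
  by rewrite /open_disc/= -[in X in X -> _](gtr0_norm r0) -sqrtr_sqr ltr_sqrt// exprn_gt0.
by rewrite /open_disc/= -[in X in _ -> X](gtr0_norm r0) -sqrtr_sqr ltr_sqrt// exprn_gt0.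
Qed.

Lemma open_open_disc (c : plane R) (r : R) : 0 < r -> open (open_disc c r).
Proof. by move=> r0; rewrite open_discE//; apply: open_lt_fun; cont. Qed.

Lemma open_T0 : open (T0 d e).
Proof. by apply: openI; apply: open_lt_fun; cont. Qed.

Lemma open_B_plus : open (B_plus rho e).
Proof. by apply: openI; [exact: open_open_disc|apply: open_gt_fun; cont]. Qed.

Lemma open_B_minus : open (B_minus rho e).
Proof. by apply: openI; [exact: open_open_disc|apply: open_lt_fun; cont]. Qed.

Lemma open_G0 : open (G0 rho d e).
Proof. exact: open_interior. Qed.

Lemma measurable_G0 : measurable (G0 rho d e).
Proof. apply: open_measurable_plane; exact: open_G0. Qed.

Lemma subset_G0 : T0 d e `|` B_plus rho e `|` B_minus rho e `<=` G0 rho d e.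
Proof.
rewrite /G0 -open_subsetE; first exact: subset_closure.
by apply: openU; [apply: openU; [exact: open_T0|exact: open_B_plus]|exact: open_B_minus].
Qed.

Definition closed_channel : set (plane R) := [set x | `|x.1| <= d] `&` [set x | `|x.2| <= e].

Definition closed_half_disc (s : R) : set (plane R) :=
  [set x | 0 <= s * x.2 - e] `&` [set x | x.1 ^+ 2 + (s * x.2 - e) ^+ 2 <= (rho / 2) ^+ 2].

Lemma closed_closed_channel : closed closed_channel.
Proof. by apply: closedI; apply: closed_le; cont. Qed.

Lemma closed_closed_half_disc s : closed (closed_half_disc s).
Proof. by apply: closedI; [apply: closed_ge|apply: closed_le]; cont. Qed.

Lemma B_plusE : B_plus rho e = [set x | 0 < x.2 - e /\ x.1 ^+ 2 + (x.2 - e) ^+ 2 < (rho / 2) ^+ 2].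
Proof.
rewrite /B_plus open_discE//.
by apply/seteqP; split => x /=; rewrite subr0 subr_gt0 => -[].
Qed.

Lemma B_minusE : B_minus rho e = [set x | 0 < - x.2 - e /\ x.1 ^+ 2 + (- x.2 - e) ^+ 2 < (rho / 2) ^+ 2].
Proof.
rewrite /B_minus open_discE//.
apply/seteqP; split => x /=; rewrite subr0 opprK -[(- x.2 - e) ^+ 2]sqrrN opprB opprK [e + _]addrC => -[? ?]; split => //; lra.
Qed.

(** [G0] is the interior of a closure and is never computed exactly: this outer inclusion serves the
    upper bound, [subset_G0] and [core_subset] serve the lower one. *)
Lemma G0_subset : G0 rho d e `<=` closed_channel `|` closed_half_disc 1 `|` closed_half_disc (-1).
Proof.
apply: (subset_trans (@interior_subset _ _)).
have /closure_id -> : closed (closed_channel `|` closed_half_disc 1 `|` closed_half_disc (-1)).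
  by do 2?apply: closedU; [exact: closed_closed_channel|exact: closed_closed_half_disc..].
apply: closure_subset; apply: setUSS; first apply: setUSS.
- by move=> x [/= /ltW ? /ltW ?].
- by rewrite B_plusE => x [/= /ltW ? /ltW ?]; split; rewrite /= mul1r.
- by rewrite B_minusE => x [/= /ltW ? /ltW ?]; split; rewrite /= mulN1r.
Qed.

Definition open_half_disc (s : R) : set (plane R) :=
  [set x | 0 < s * x.2 - e /\ x.1 ^+ 2 + (s * x.2 - e) ^+ 2 < (rho / 2) ^+ 2].

Lemma B_plus_half_disc : B_plus rho e = open_half_disc 1.
Proof. by rewrite B_plusE; apply/seteqP; split => x /=; rewrite /open_half_disc /= mul1r. Qed.

Lemma B_minus_half_disc : B_minus rho e = open_half_disc (-1).
Proof. by rewrite B_minusE; apply/seteqP; split => x /=; rewrite /open_half_disc /= mulN1r. Qed.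

(** The point is the limit of its contractions by 1 - k towards the centre. Only the square of [x]
    is prescribed, because on the lower arc the angle is [t + pi] and the cosine changes sign. *)
Lemma closure_open_half_disc (s t x y : R) : s ^+ 2 = 1 -> 0 < t < pi ->
  x ^+ 2 = (rho / 2 * cos t) ^+ 2 -> s * y = e + rho / 2 * sin t ->
  closure (open_half_disc s) (x, y).
Proof.
move=> s1 tpi xE yE V /nbhs_ballP[eps /= eps0 epsV].
have st := sin_gt0_pi tpi.
pose k : R := Num.min (1 / 2) (eps / rho).
have k0 : 0 < k by rewrite lt_min divr_gt0//= divr_gt0.
have k1 : k <= 1 / 2 by rewrite ge_min lexx.
have k2 : k * (rho / 2) < eps.
  have : k <= eps / rho by rewrite ge_min lexx orbT.
  by rewrite ler_pdivlMr// => ?; lra.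
have yE' : y = s * (e + rho / 2 * sin t) by rewrite -yE mulrA -expr2 s1 mul1r.
have ns : `|s| = 1 by apply/eqP; rewrite -(eqrXn2 (n := 2))// expr1n -normrX s1 normr1.
exists ((1 - k) * x, s * (e + (1 - k) * (rho / 2 * sin t))); split => /=.
  rewrite /open_half_disc /= mulrA -expr2 s1 mul1r addrC addKr; split.
    by rewrite !mulr_gt0//; lra.
  rewrite exprMn xE.
  have -> : (1 - k) ^+ 2 * (rho / 2 * cos t) ^+ 2 + ((1 - k) * (rho / 2 * sin t)) ^+ 2 =
     (1 - k) ^+ 2 * (rho / 2) ^+ 2 * (cos t ^+ 2 + sin t ^+ 2) by ring.
  rewrite cos2Dsin2 mulr1 gtr_pMl ?exprn_gt0 ?divr_gt0// expr_lt1//; lra.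
apply: epsV; split; rewrite /ball/=.
  have -> : x - (1 - k) * x = k * x by ring.
  rewrite normrM gtr0_norm//.
  have -> : `|x| = `|rho / 2 * cos t|.
    by apply/eqP; rewrite -(eqrXn2 (n := 2))// -!normrX xE.
  apply: le_lt_trans k2; rewrite ler_pM2l// normrM gtr0_norm//.
  by apply: ler_piMr; [exact: ltW|rewrite ler_norml cos_geN1 cos_le1].
have -> : y - s * (e + (1 - k) * (rho / 2 * sin t)) = s * (k * (rho / 2 * sin t)).
  by rewrite yE'; ring.
rewrite normrM ns mul1r normrM gtr0_norm//.
apply: le_lt_trans k2; rewrite ler_pM2l// normrM gtr0_norm//.
by apply: ler_piMr; [exact: ltW|rewrite ler_norml sin_geN1 sin_le1].
Qed.

(** [S_plus] is given by a topological frontier, whereas the trace norm integrates over polar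
    angles; this identification connects them. The endpoints drop out because the line x2 = e is
    removed. *)
Lemma angles_S_plus : angles (ctr_plus e) (rho / 2) (S_plus rho e) = `]0, pi[%classic.
Proof.
apply/seteqP; split => t /=; rewrite in_itv/=.
- move=> [/andP[t0 tpi] [[clt _] /eqP ne]].
  have : closed [set x : plane R | e <= x.2] by apply: closed_ge; cont.
  move/closure_id; set K := [set x | _ ] => KE.
  have : K (circle_pt (ctr_plus e) (rho / 2) t).
    rewrite KE; move: clt; apply: closure_subset; rewrite B_plusE => x /= [? _].
    by rewrite /K/=; lra.
  rewrite /K /= in ne *; rewrite le_eqVlt eq_sym (negbTE ne)/= ltrDl pmulr_rgt0 ?divr_gt0// => st.
  rewrite lt_neqAle t0 andbT; apply/andP; split.
    by apply: contraTneq st => <-; rewrite sin0 ltxx.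
  rewrite ltNge; apply/negP => pit.
  have : 0 <= sin (t - pi) by apply: sin_ge0_pi; rewrite subr_ge0 pit/=; lra.
  by move: st; rewrite -{1}(subrK pi t) sinDpi; lra.
- move=> /[dup] tpi /andP[t0 tpi'].
  have st := sin_gt0_pi tpi.
  have rst : 0 < rho / 2 * sin t by rewrite mulr_gt0// divr_gt0.
  split; first by rewrite ltW//=; lra.
  split; last by rewrite /=; lra.
  split.
    rewrite B_plus_half_disc; apply: (closure_open_half_disc _ tpi); rewrite ?expr1n//=.
      by rewrite add0r.
    by rewrite mul1r.
  move/interior_subset; rewrite B_plusE /= => -[_].
  have -> : (0 + rho / 2 * cos t) ^+ 2 + (e + rho / 2 * sin t - e) ^+ 2 = (rho / 2) ^+ 2 * (cos t ^+ 2 + sin t ^+ 2) by ring.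
  by rewrite cos2Dsin2 mulr1 ltxx.
Qed.

Lemma angles_S_minus : angles (ctr_minus e) (rho / 2) (S_minus rho e) = `]pi, 2 * pi[%classic.
Proof.
apply/seteqP; split => t /=; rewrite in_itv/=.
- move=> [/andP[t0 tpi] [[clt _] /eqP ne]].
  have : closed [set x : plane R | x.2 <= - e] by apply: closed_le; cont.
  move/closure_id; set K := [set x | _ ] => KE.
  have : K (circle_pt (ctr_minus e) (rho / 2) t).
    rewrite KE; move: clt; apply: closure_subset; rewrite B_minusE => x /= [? _].
    by rewrite /K/=; lra.
  rewrite /K /= in ne *; rewrite le_eqVlt (negbTE ne)/= gtrDl pmulr_rlt0 ?divr_gt0// => st.
  rewrite tpi andbT ltNge; apply/negP => pit.
  have : 0 <= sin t by apply: sin_ge0_pi; rewrite t0.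
  by rewrite leNgt st.
- move=> /andP[t0 tpi'].
  have tpi : 0 < t - pi < pi by apply/andP; split; lra.
  have st := sin_gt0_pi tpi.
  have sE : sin t = - sin (t - pi) by rewrite -{1}(subrK pi t) sinDpi.
  have cE : cos t = - cos (t - pi) by rewrite -{1}(subrK pi t) cosDpi.
  have rst : 0 < rho / 2 * sin (t - pi) by rewrite mulr_gt0// divr_gt0.
  split; first by rewrite tpi' andbT; have := pi_gt0 R; lra.
  split; last by rewrite /= sE mulrN; lra.
  split.
    rewrite B_minus_half_disc; apply: (closure_open_half_disc _ tpi); rewrite ?sqrrN ?expr1n//=.
      by rewrite add0r cE mulrN sqrrN.
    by rewrite sE; ring.
  move/interior_subset; rewrite B_minusE /= => -[_].
  rewrite sE cE.
  have -> : (0 + rho / 2 * - cos (t - pi)) ^+ 2 + (- (- e + rho / 2 * - sin (t - pi)) - e) ^+ 2 =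
     (rho / 2) ^+ 2 * (cos (t - pi) ^+ 2 + sin (t - pi) ^+ 2) by ring.
  by rewrite cos2Dsin2 mulr1 ltxx.
Qed.

End geometry_facts.

(** * Lower bound *)

Section iterated_bound.
Context {R : realType}.
Local Notation mu := (@lebesgue_measure R).

(** The form in which a family of curves bounds an energy: on fibre [m] only the interval [[p, q]]
    swept by a curve is kept, and nonnegativity of [H] discards the rest. *)
Lemma iterated_integral_ge (H : plane R -> \bar R) (a b : R) (l : R -> R) :
  measurable_fun setT H -> (forall x, (0 <= H x)%E) ->
  mu.-integrable `[a, b] (EFin \o l) ->
  (forall m, a < m < b -> exists (p q : R) (F G : R -> R),
    [/\ p <= q, forall y : R, p <= y <= q -> is_derive y 1 F (G y),
        {within `[p, q], continuous G},
        forall y, p < y < q -> ((G y)%:E <= H (m, y))%E &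
        l m = F q - F p]) ->
  (\int[mu]_(m in `[a, b]) (l m)%:E <= \int[mu]_m \int[mu]_y H (m, y))%E.
Proof.
move=> mH H0 il lP.
have mI := measurable_fun_integral2 mH H0.
have I0 m : (0 <= \int[mu]_y H (m, y))%E by exact: integral_ge0.
apply: (@le_trans _ _ (\int[mu]_(m in `]a, b[) \int[mu]_y H (m, y))%E); last first.
  by apply: ge0_subset_integral => //.
rewrite [leLHS](@integral_itv_bndoo _ _ _ _ true false); last first.
  apply: measurable_funS (measurable_int _ il) => //; exact: subset_itv_oo_cc.
apply: le_integral_minorant => //.
- apply: integrableS il => //; exact: subset_itv_oo_cc.
- exact: measurable_funS mI.
- move=> m /=; rewrite in_itv/= => /lP[p [q [F [G [pq dF cG GH ->]]]]].
  have mHm : measurable_fun setT (fun y => H (m, y)).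
    exact: (measurableT_comp mH (measurable_pair1 _)).
  apply: (@le_trans _ _ (\int[mu]_(y in `]p, q[) H (m, y))%E).
    by apply: (ge0_integral_ge_FTC pq dF cG) => //; exact: measurable_funS mHm.
  exact: ge0_subset_integral.
Qed.

End iterated_bound.

(** * The quotient of atan m by m *)

Section slope_function.
Context {R : realType}.

(** [m = 0] is the central vertical ray, where the quotient is extended by its limit; [start_height]
    has to be continuous there. *)
Definition atan_ratio (m : R) : R := if m == 0 then 1 else atan m / m.

Lemma atan_ratioE m : m * atan_ratio m = atan m.
Proof. by rewrite /atan_ratio; case: eqP => [->|/eqP ?]; rewrite ?mul0r ?atan0// mulrC divfK. Qed.

Lemma sin_le_id (x : R) : 0 <= x -> sin x <= x.
Proof.
move=> x0.
have [y _] := @MVT_segment R (fun t => sin t - t) (fun t => cos t - 1) 0 x x0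
  (fun t _ => ltac:(by apply: is_derive_eq))
  (continuous_subspaceT (fun t => ltac:(by apply: cvgB; [exact: continuous_sin|exact: cvg_id]))).
rewrite sin0 !subr0 => E; rewrite -subr_le0 E mulr_le0_ge0// subr_le0; exact: cos_le1.
Qed.

Lemma sin_atan (m : R) : sin (atan m) = m / Num.sqrt (1 + m ^+ 2).
Proof.
have s0 : Num.sqrt (1 + m ^+ 2) != 0 by rewrite gt_eqF// sqrtr_gt0 ltr_wpDr ?sqr_ge0.
have := atanK m; rewrite /tan cos_atan invrK => E.
by apply: (mulIf s0); rewrite E divfK.
Qed.

Lemma atan_gt0 (m : R) : 0 < m -> 0 < atan m.
Proof. by rewrite -{2}atan0; exact: lt_atan. Qed.

Lemma atan_ratioN (m : R) : atan_ratio (- m) = atan_ratio m.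
Proof. by rewrite /atan_ratio oppr_eq0 atanN invrN mulrNN. Qed.

(** Lower bound: sin x <= x at x = atan m, whose sine is m / sqrt (1 + m^2). Upper bound: the
    derivative of [atan] is at most 1. The lower one controls the ratio of heights along a ray, and
    both together give continuity at 0. *)
Lemma atan_ratio_bounds (m : R) :
  (Num.sqrt (1 + m ^+ 2))^-1 <= atan_ratio m <= 1.
Proof.
wlog m0 : m / 0 <= m => [h|].
  have [/h//|/ltW m0] := leP 0 m.
  by rewrite -atan_ratioN -sqrrN; apply: h; rewrite oppr_ge0.
have s1 : 1 <= Num.sqrt (1 + m ^+ 2).
  by rewrite -{1}sqrtr1 ler_sqrt ?lerDl ?sqr_ge0// addr_ge0 ?sqr_ge0.
have [->|mn0] := eqVneq m 0; first by rewrite /atan_ratio eqxx expr0n/= addr0 sqrtr1 invr1 lexx.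
have {mn0}m0 : 0 < m by rewrite lt_neqAle eq_sym mn0.
rewrite /atan_ratio gt_eqF//; apply/andP; split.
  rewrite ler_pdivlMr// mulrC -sin_atan; apply: sin_le_id; exact/ltW/atan_gt0.
rewrite ler_pdivrMr// mul1r.
have [y _] := @MVT_segment R atan (fun t => (1 + t ^+ 2)^-1) 0 m (ltW m0)
  (fun t _ => is_derive1_atan t) (continuous_subspaceT (fun t => @continuous_atan R t)).
rewrite atan0 !subr0 => ->; rewrite ler_piMl ?(ltW m0)// invf_le1 ?lerDl ?sqr_ge0//.
by rewrite ltr_wpDr ?sqr_ge0.
Qed.

Lemma atan_ratio_gt0 (m : R) : 0 < atan_ratio m.
Proof.
have /andP[+ _] := atan_ratio_bounds m; apply: lt_le_trans.
by rewrite invr_gt0 sqrtr_gt0 ltr_wpDr ?sqr_ge0.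
Qed.

Lemma continuous_inv_sqrt1Dsqr : continuous (fun m : R => (Num.sqrt (1 + m ^+ 2))^-1).
Proof.
apply: continuous_inv; first by move=> m; rewrite gt_eqF// sqrtr_gt0 ltr_wpDr ?sqr_ge0.
apply: continuous_compose; [exact: sqrt_continuous|cont].
Qed.

Lemma continuous_atan_ratio : continuous atan_ratio.
Proof.
move=> x; have [->|x0] := eqVneq x 0.
  rewrite /continuous_at {2}/atan_ratio eqxx.
  apply: (@squeeze_cvgr _ _ _ _ (fun m : R => (Num.sqrt (1 + m ^+ 2))^-1) (cst 1)).
  - by apply: nearW => m; exact: atan_ratio_bounds.
  - have E : (Num.sqrt (1 + (0 : R) ^+ 2))^-1 = 1 by rewrite expr0n/= addr0 sqrtr1 invr1.
    by rewrite -[X in _ --> X]E; exact: continuous_inv_sqrt1Dsqr.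
  - exact: cvg_cst.
have h : atan m / m @[m --> x] --> atan x / x.
  by apply: cvgM; [exact: continuous_atan|apply: cvgV => //; exact: cvg_id].
rewrite /continuous_at {2}/atan_ratio (negbTE x0).
apply: cvg_trans h; apply: near_eq_cvg.
have o0 : open [set y : R | 0 < `|y|] by apply: open_gt_fun; exact: norm_continuous.
have : nbhs x [set y : R | 0 < `|y|] by apply: open_nbhs_nbhs; split; rewrite //= normr_gt0.
apply: filterS => y; rewrite /= normr_gt0 => y0.
by rewrite /atan_ratio (negbTE y0).
Qed.

End slope_function.

(** * The family of curves and the regions it sweeps *)

Section flux.
Context {R : realType}.
Local Notation mu := (@lebesgue_measure R).
Variables (rho d e M : R).
Hypotheses (rho0 : 0 < rho) (d0 : 0 < d) (e0 : 0 < e) (M0 : 0 < M).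
Let r := rho / 2.
Let al := atan M.
Hypothesis Hd : d / al * Num.sqrt (1 + M ^+ 2) < r.

Let r0 : 0 < r. Proof. exact: divr_gt0. Qed.
Let al0 : 0 < al. Proof. exact: atan_gt0. Qed.
Let alpi : al < pi / 2. Proof. exact: atan_ltpi2. Qed.
Let da0 : 0 < d / al. Proof. exact: divr_gt0. Qed.

(* The curve of index [m] is vertical at [x1 = foot m] in the channel; outside, it follows the
   ray of slope [m] from [(0, +-e)], between [start_height m] and [end_height m].  [wall x] is
   the height at which the vertical at [x1 = x] meets its ray. *)
Definition foot (m : R) : R := d / al * atan m.
Definition start_height (m : R) : R := d / al * atan_ratio m.
Definition end_height (m : R) : R := r / Num.sqrt (1 + m ^+ 2).
(** Clipping keeps the argument of [tan] in [- al, al], away from its poles, so that [foot_slope]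
    and [wall] are continuous on the whole line while [foot_slope] still inverts [foot] over
    [[- d, d]]. *)
Definition clip (x : R) : R := Num.max (- d) (Num.min x d).
Definition foot_slope (x : R) : R := tan (al / d * clip x).
Definition wall (x : R) : R := start_height (foot_slope x).

Lemma footE m : m * start_height m = foot m.
Proof. by rewrite /start_height mulrCA atan_ratioE. Qed.

Lemma clip_bounds x : - d <= clip x <= d.
Proof.
by rewrite /clip le_max lexx/= ge_max ge_min lexx orbT andbT; move: (d0); lra.
Qed.

Lemma clip_id x : - d <= x <= d -> clip x = x.
Proof. by move=> /andP[h1 h2]; rewrite /clip min_l// max_r. Qed.

Lemma angle_clip x : - al <= al / d * clip x <= al.
Proof.
have /andP[h1 h2] := clip_bounds x.
have ad : 0 < al / d by exact: divr_gt0.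
have E : al / d * d = al by rewrite divfK ?gt_eqF.
have : al / d * - d <= al / d * clip x <= al / d * d by rewrite !ler_pM2l// h1.
by rewrite mulrN E.
Qed.

Lemma foot_slopeK x : - d <= x <= d -> foot (foot_slope x) = x.
Proof.
move=> xd; have := angle_clip x; rewrite /foot /foot_slope clip_id// => /andP[h1 h2].
rewrite tanK//; last by rewrite in_itv/=; apply/andP; split; move: (alpi); lra.
by rewrite mulrA -[RHS]mul1r; congr (_ * _); field; rewrite !gt_eqF.
Qed.

Lemma footK m : - M <= m <= M -> foot_slope (foot m) = m.
Proof.
move=> /andP[h1 h2].
have h : - d <= foot m <= d.
  have E : d / al * al = d by rewrite divfK ?gt_eqF.
  have : d / al * - al <= foot m <= d / al * al.
    by rewrite /foot !ler_pM2l// /al -atanN !le_atan.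
  by rewrite mulrN E.
rewrite /foot_slope clip_id// /foot mulrA.
by rewrite (_ : al / d * (d / al) = 1) ?mul1r ?atanK//; field; rewrite !gt_eqF.
Qed.

Lemma lt_foot m m' : m < m' -> foot m < foot m'.
Proof. by move=> mm'; rewrite /foot ltr_pM2l// lt_atan. Qed.

Lemma continuous_start_height : continuous start_height.
Proof. by rewrite /start_height; cont; exact: continuous_atan_ratio. Qed.

Lemma continuous_foot : continuous foot.
Proof. by rewrite /foot; cont; move=> ?; exact: continuous_atan. Qed.

Lemma continuous_end_height : continuous end_height.
Proof. by rewrite /end_height; cont; exact: continuous_inv_sqrt1Dsqr. Qed.

Lemma continuous_foot_slope : continuous foot_slope.
Proof.
move=> x; have /andP[h1 h2] := angle_clip x.
apply: (@continuous_comp _ _ _ (fun x => al / d * clip x) (@tan R)).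
  apply: cvgM; first exact: cvg_cst.
  apply: (@continuous_max _ _ (cst (- d)) (fun x => Num.min x d)); first exact: cvg_cst.
  apply: (@continuous_min _ _ id (cst d)); [exact: cvg_id|exact: cvg_cst].
apply: continuous_tan; rewrite gt_eqF// cos_gt0_pihalf//; apply/andP; split; move: (alpi); lra.
Qed.

Lemma continuous_wall : continuous wall.
Proof.
exact: (continuous_compose continuous_start_height continuous_foot_slope).
Qed.

Lemma start_height_gt0 m : 0 < start_height m.
Proof. by rewrite mulr_gt0// atan_ratio_gt0. Qed.

Lemma start_height_le m : start_height m <= d / al.
Proof. by rewrite /start_height ler_piMr ?(ltW da0)//; have /andP[] := atan_ratio_bounds m. Qed.

Lemma sqrt1D_gt0 (m : R) : 0 < Num.sqrt (1 + m ^+ 2).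
Proof. by rewrite sqrtr_gt0 ltr_wpDr ?sqr_ge0. Qed.

Lemma end_height_gt0 m : 0 < end_height m.
Proof. by rewrite divr_gt0// sqrt1D_gt0. Qed.

Lemma lt_start_end_height m : - M <= m <= M -> start_height m < end_height m.
Proof.
move=> /andP[h1 h2]; apply: le_lt_trans (start_height_le m) _.
rewrite ltr_pdivlMr ?sqrt1D_gt0//; apply: le_lt_trans Hd; rewrite ler_pM2l//.
apply: ler_wsqrtr; rewrite lerD2l -[leLHS]real_normK ?num_real// -[leRHS]real_normK ?num_real//.
by rewrite lerXn2r ?nnegrE// [leRHS]gtr0_norm// ler_norml h1.
Qed.

(** The lower half of [atan_ratio_bounds]. Being uniform in [m], it lets the single logarithm of
    [resistance] serve for all slopes. *)
Lemma end_height_ratio m : end_height m / start_height m <= al * r / d.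
Proof.
have /andP[h _] := atan_ratio_bounds m.
rewrite ler_pdivrMr ?start_height_gt0// /end_height /start_height.
have -> : al * r / d * (d / al * atan_ratio m) = r * atan_ratio m by field; rewrite !gt_eqF.
by rewrite ler_pM2l.
Qed.

(** In (d / al)^2 (1 + M^2), bounded through [Hd], the term (d M / al)^2 is at least d^2 because
    atan M <= M. Hence the rectangle holding the part of [core] beyond a mouth of the channel fits
    in the half disc. *)
Lemma sqr_d_lt : d ^+ 2 + (d / al) ^+ 2 < r ^+ 2.
Proof.
have s0 := sqrt1D_gt0 M.
have : (d / al * Num.sqrt (1 + M ^+ 2)) ^+ 2 < r ^+ 2.
  by rewrite ltrXn2r ?nnegrE// ltW// mulr_gt0.
move=> h; apply: le_lt_trans h; rewrite [leRHS]exprMn sqr_sqrtr ?addr_ge0 ?sqr_ge0// mulrDr mulr1 addrC lerD2l.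
rewrite -exprMn lerXn2r ?nnegrE ?(ltW d0)//; first by rewrite mulr_ge0 ?(ltW M0)// ltW.
rewrite mulrAC ler_pdivlMr// ler_pM2l//.
have /andP[_ h] := atan_ratio_bounds M.
by rewrite /al -atan_ratioE ler_piMr// ltW.
Qed.

(** Swept by the vertical pieces of the curves: the channel prolonged at both ends up to [wall],
    where the rays take over. *)
Definition core : set (plane R) :=
  [set x | `|x.1| < d] `&` [set x | `|x.2| - wall x.1 < e].

Lemma open_core : open core.
Proof.
apply: openI; apply: open_lt_fun; cont.
by apply: continuous_compose; [exact: continuous_wall|exact: continuous_fst].
Qed.

Lemma measurable_core : measurable core.
Proof. by apply: open_measurable_plane; exact: open_core. Qed.

Definition rays (s : R) : set (plane R) := open_half_disc rho e s `\` core.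

Lemma open_open_half_disc s : open (open_half_disc rho e s).
Proof.
have -> : open_half_disc rho e s = [set x | 0 < s * x.2 - e] `&` [set x | x.1 ^+ 2 + (s * x.2 - e) ^+ 2 < r ^+ 2].
  by apply/seteqP; split.
by apply: openI; [apply: open_gt_fun|apply: open_lt_fun]; cont.
Qed.

Lemma measurable_rays s : measurable (rays s).
Proof.
apply: measurableD; last exact: measurable_core.
apply: open_measurable_plane; exact: open_open_half_disc.
Qed.

Lemma wall_gt0 x : 0 < wall x.
Proof. exact: start_height_gt0. Qed.

Lemma core_subset : core `<=` G0 rho d e.
Proof.
rewrite /G0 -open_subsetE; last exact: open_core.
move=> [x y] [/= xd yw].
have [ye|ey] := leP `|y| e.
  apply: (closure_subset (A := T0 d e)); first by move=> z Tz; left; left.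
  move=> W /nbhs_ballP[eps /= eps0 epsW].
  (* A point with |y| = e lies on a mouth, in neither open piece; contracting its height by [k]
     brings it into [T0], at a displacement of at most (1 - k) e < eps. *)
  pose k : R := 1 - Num.min (1 / 2) (eps / (2 * e)).
  have k1 : 0 <= k < 1.
    rewrite /k subr_ge0 ge_min gtrBl lt_min !divr_gt0 ?mulr_gt0//= andbT.
    by apply/orP; left; lra.
  have /andP[k0 k1'] := k1.
  have k2 : (1 - k) * e < eps.
    have : 1 - k <= eps / (2 * e) by rewrite /k opprB addrC subrK ge_min lexx orbT.
    rewrite ler_pdivlMr ?mulr_gt0//; move: (e0) eps0; set j := (1 - k); nra.
  exists (x, k * y); split => /=.
    split => //=; rewrite normrM (ger0_norm k0).
    apply: (@le_lt_trans _ _ (k * e)); first by rewrite ler_wpM2l.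
    by rewrite gtr_pMl.
  apply: epsW; split; rewrite /ball/=; first by rewrite subrr normr0.
  have -> : y - k * y = (1 - k) * y by ring.
  rewrite normrM ger0_norm ?subr_ge0 1?ltW//; apply: le_lt_trans k2.
  by rewrite ler_wpM2l// subr_ge0 ltW.
apply: subset_closure.
have yr : `|y| - e < d / al.
  have := start_height_le (foot_slope x); rewrite -/(wall x); lra.
have sq : x ^+ 2 + (`|y| - e) ^+ 2 < r ^+ 2.
  apply: le_lt_trans sqr_d_lt; apply: lerD.
    by rewrite -[leLHS]real_normK ?num_real// lerXn2r ?nnegrE// ltW.
  by rewrite lerXn2r ?nnegrE ?(ltW da0)// ?subr_ge0 ltW.
have [y0|y0] := leP 0 y.
  left; right; rewrite B_plusE// /=.
  by move: ey sq; rewrite ger0_norm// => ey sq; split; [rewrite subr_gt0|].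
right; rewrite B_minusE//=.
by move: ey sq; rewrite ltr0_norm// => ey sq; split; [rewrite subr_gt0|].
Qed.

Lemma open_half_disc_subset s : s = 1 \/ s = -1 -> open_half_disc rho e s `<=` G0 rho d e.
Proof.
move=> sE x Bx; apply: (subset_G0 rho0).
case: sE Bx => ->; first by rewrite -B_plus_half_disc//; left; right.
by rewrite -B_minus_half_disc//; right.
Qed.

Lemma energy_split (f : plane R -> R) : continuous f -> (forall x, 0 <= f x) ->
  (\int[area R]_(x in core) (f x)%:E + \int[area R]_(x in rays 1) (f x)%:E
    + \int[area R]_(x in rays (-1)) (f x)%:E
   <= \int[area R]_(x in G0 rho d e) (f x)%:E)%E.
Proof.
move=> cf f0.
have mf : measurable_fun setT (fun x => (f x)%:E).
  apply/measurable_EFinP; exact: continuous_measurable_plane.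
have f0' x : (0 <= (f x)%:E)%E by rewrite lee_fin.
have mC := measurable_core; have mW := measurable_rays.
rewrite -(ge0_integral_plane_setU mf f0' mC (mW 1)); last by move=> x [Cx [_]].
have mCW : measurable (core `|` rays 1) by exact: measurableU.
rewrite -(ge0_integral_plane_setU mf f0' mCW (mW (-1))); last first.
  move=> x [[Cx [_] //|[[/= h1 _] _] [[/= h2 _] _]]].
  by move: (e0) h1 h2; rewrite mul1r mulN1r; lra.
apply: (ge0_subset_integral_plane mf f0').
- by apply: measurableU.
- exact: measurable_G0.
- by move=> x [[/core_subset//|[Dx _]]|[Dx _]]; apply: open_half_disc_subset Dx; [left|right].
Qed.

End flux.

(** * Energy against a prescribed flux *)

Section energy_bounds.
Context {R : realType}.
Local Notation mu := (@lebesgue_measure R).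
Variables (rho d e M : R).
Hypotheses (rho0 : 0 < rho) (d0 : 0 < d) (e0 : 0 < e) (M0 : 0 < M).
Let r := rho / 2.
Let al := atan M.
Hypothesis Hd : d / al * Num.sqrt (1 + M ^+ 2) < r.
Variable z : plane R -> R.
Hypothesis Cz : Ck 1 z.
Variable lam : R.

Let r0 : 0 < r. Proof. exact: divr_gt0. Qed.
Let al0 : 0 < al. Proof. exact: atan_gt0. Qed.
Let c0 : continuous z. Proof. by case: Cz. Qed.
Let c1 : continuous (dx1 z). Proof. by case: Cz. Qed.
Let c2 : continuous (dx2 z). Proof. by case: Cz. Qed.

Definition sqr_grad (u : plane R -> R) (x : plane R) : R := dx1 u x ^+ 2 + dx2 u x ^+ 2.

Lemma continuous_sqr_grad : continuous (sqr_grad z).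
Proof. by apply: continuous_add; apply: continuous_exprn; [exact: c1|exact: c2]. Qed.

Lemma sqr_grad_ge0 x : 0 <= sqr_grad z x.
Proof. by rewrite addr_ge0 ?sqr_ge0. Qed.

Lemma integrable_continuous (l : R -> R) (a b : R) : continuous l ->
  mu.-integrable `[a, b] (EFin \o l).
Proof.
by move=> cl; apply: continuous_compact_integrable; [exact: segment_compact|exact: continuous_subspaceT].
Qed.

Let restricted (A : set (plane R)) (x : plane R) : \bar R := ((fun x => (sqr_grad z x)%:E) \_ A) x.

Let measurable_restricted A : measurable A -> measurable_fun setT (restricted A).
Proof.
move=> mA; have mD : measurable_fun setT (fun x => (sqr_grad z x)%:E).
  by apply/measurable_EFinP; apply: continuous_measurable_plane; exact: continuous_sqr_grad.
exact: (measurable_restrictT _ mA).1 (measurable_funTS mD).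
Qed.

Let restricted_ge0 A x : (0 <= restricted A x)%E.
Proof. by rewrite /restricted patchE; case: ifP => // _; rewrite lee_fin sqr_grad_ge0. Qed.

Let restrictedE (A : set (plane R)) x : A x -> restricted A x = (sqr_grad z x)%:E.
Proof. by move=> Ax; rewrite /restricted patchE mem_set. Qed.

(** Density of a vertical flux [lam] spread evenly over the channel width. [core_fibre] integrates
    the minorant 2 m1 dx2 z - m1^2 of the squared gradient along one column. *)
Let m1 := lam / (2 * d).

Definition core_fibre (x : R) : R :=
  2 * m1 * (z (x, e + wall d M x) - z (x, - (e + wall d M x))) - m1 ^+ 2 * (2 * (e + wall d M x)).

Lemma continuous_core_fibre : continuous core_fibre.
Proof.
have cw : continuous (wall d M) by exact: continuous_wall.
rewrite /core_fibre; cont; apply: continuous_compose_pair; cont.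
Qed.

Lemma core_bound :
  (\int[mu]_(x in `[(- d)%R, d]) (core_fibre x)%:E
   <= \int[area R]_(x in core d e M) (sqr_grad z x)%:E)%E.
Proof.
rewrite [leRHS]integral_mkcond.
have mC : measurable (core d e M) by exact: measurable_core.
rewrite (ge0_integral_plane12 (measurable_restricted mC) (restricted_ge0 _)).
apply: iterated_integral_ge (measurable_restricted mC) (restricted_ge0 _) _ _.
  exact/integrable_continuous/continuous_core_fibre.
move=> x /andP[xd1 xd2].
have w0 : 0 < wall d M x by exact: wall_gt0.
exists (- (e + wall d M x)), (e + wall d M x),
  (fun y => 2 * m1 * z (x, y) - m1 ^+ 2 * y), (fun y => 2 * m1 * dx2 z (x, y) - m1 ^+ 2); split.
- by move: (e0); lra.
- move=> y _; have dz := Ck1_dx2 Cz x y.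
  by apply: is_derive_eq; rewrite /GRing.scale/= mulr1; ring.
- apply: continuous_subspaceT; cont; apply: continuous_compose_pair; cont.
- move=> y /andP[y1 y2]; rewrite restrictedE; last first.
    by split; rewrite /= ?ltr_norml ?xd1// ltrBlDr ltr_norml y1.
  rewrite lee_fin /sqr_grad.
  have := sqr_ge0 (dx2 z (x, y) - m1); have := sqr_ge0 (dx1 z (x, y)); lra.
- by rewrite /core_fibre; ring.
Qed.

(** The comparison field on the rays is radial, of total flux [lam] through the angle 2 al. At
    height [y] on the ray of slope [m] it is s * k m / y times (m, s): outward above, inward below.
    Its square times the Jacobian [y] integrates to the logarithm in [ray_fibre]. *)
Let k (m : R) := lam / (2 * al * (1 + m ^+ 2)).

Definition ray_fibre (s m : R) : R :=
  2 * k m * (s * (z (m * end_height rho m, s * (e + end_height rho m)) -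
                  z (foot d M m, s * (e + start_height d M m))))
  - k m ^+ 2 * (1 + m ^+ 2) * ln (end_height rho m / start_height d M m).

Let D1 (m : R) : 0 < 1 + m ^+ 2. Proof. by rewrite ltr_wpDr ?sqr_ge0. Qed.

Lemma continuous_ray_fibre s : continuous (ray_fibre s).
Proof.
have ch : continuous (start_height d M) by exact: continuous_start_height.
have ce : continuous (end_height rho) by exact: continuous_end_height.
have cf : continuous (foot d M) by exact: continuous_foot.
have h0 m : 0 < start_height d M m by exact: start_height_gt0.
have eh0 m : 0 < end_height rho m by exact: end_height_gt0.
have ck : continuous k.
  rewrite /k; cont; apply: continuous_inv; last by cont.
  by move=> m; rewrite !mulf_neq0 ?gt_eqF// D1.
rewrite /ray_fibre; cont.
- by apply: continuous_compose_pair; cont.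
- by apply: continuous_compose_pair; cont.
- move=> m; apply: (@continuous_comp _ _ _ (fun m => end_height rho m / start_height d M m) (@ln R)).
    by apply: cvgM; [exact: ce|apply: cvgV; [rewrite gt_eqF|exact: ch]].
  by apply: continuous_ln; rewrite divr_gt0.
Qed.

(** The real content is that a ray does not re-enter [core] beyond its starting height. Here [m'] is
    the index of the curve whose vertical part has the same abscissa as the point. *)
Lemma rays_mem s m y : s = 1 \/ s = -1 -> - M <= m <= M ->
  start_height d M m < y < end_height rho m ->
  rays rho d e M s (m * y, s * e + s * y).
Proof.
move=> sE mM /andP[y1 y2].
have h0 : 0 < start_height d M m by exact: start_height_gt0.
have y0 : 0 < y by exact: lt_trans y1.
have s2 : s ^+ 2 = 1 by case: sE => ->; rewrite ?sqrrN expr1n.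
split; [split|] => /=.
- by have -> : s * (s * e + s * y) - e = y by case: sE => ->; ring.
- have -> : s * (s * e + s * y) - e = y by case: sE => ->; ring.
  have q0 : 0 < Num.sqrt (1 + m ^+ 2) by exact: sqrt1D_gt0.
  move: y2; rewrite /end_height ltr_pdivlMr// => y2.
  have : (y * Num.sqrt (1 + m ^+ 2)) ^+ 2 < r ^+ 2 by rewrite ltrXn2r ?nnegrE// ltW// mulr_gt0.
  by rewrite [X in X < _ -> _]exprMn sqr_sqrtr ?(ltW (D1 m))// => h; apply: le_lt_trans h; rewrite le_eqVlt; apply/orP; left; apply/eqP; ring.
move=> [/=]; set m' := foot_slope d M (m * y) => myd.
have -> : `|s * e + s * y| = e + y.
  by rewrite -mulrDr normrM; case: sE => ->; rewrite ?normrN normr1 mul1r gtr0_norm// addr_gt0.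
rewrite -/m' /wall -/m' => yw.
have {yw}yw : y < start_height d M m' by lra.
have E : m' * start_height d M m' = m * y.
  by rewrite footE /m' foot_slopeK//; move: myd; rewrite ltr_norml => /andP[/ltW -> /ltW ->].
have F : m * start_height d M m = foot d M m by exact: footE.
have F' : m' * start_height d M m' = foot d M m' by exact: footE.
(* If m < m', then foot m < foot m' = m * y forces m > 0, and m * y < m' * y < foot m' = m * y is
   absurd; m' < m is symmetric. If m = m', the height [y] is above the start of its own ray. *)
have [mm|mm|mm] := ltgtP m m'.
- have := lt_foot d0 M0 mm; rewrite -F -F' E => h.
  have m0 : 0 < m by move: h; rewrite -subr_gt0 -mulrBr pmulr_lgt0 ?subr_gt0.
  have m'0 : 0 < m' by exact: lt_trans mm.
  have : m' * y < m' * start_height d M m' by rewrite ltr_pM2l.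
  have : m * y < m' * y by rewrite ltr_pM2r.
  rewrite E; lra.
- have := lt_foot d0 M0 mm; rewrite -F -F' E => h.
  have m0 : m < 0 by move: h; rewrite -subr_gt0 -mulrBr nmulr_lgt0 ?subr_lt0.
  have m'0 : m' < 0 by exact: lt_trans m0.
  have : m' * start_height d M m' < m' * y by rewrite ltr_nM2l.
  have : m' * y < m * y by rewrite ltr_pM2r.
  rewrite E; lra.
- by move: yw; rewrite -mm; lra.
Qed.

Lemma rays_bound s : s = 1 \/ s = -1 ->
  (\int[mu]_(m in `[(- M)%R, M]) (ray_fibre s m)%:E
   <= \int[area R]_(x in rays rho d e M s) (sqr_grad z x)%:E)%E.
Proof.
move=> sE; rewrite [leRHS]integral_mkcond.
have mW : measurable (rays rho d e M s) by exact: measurable_rays.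
have s2 : s ^+ 2 = 1 by case: sE => ->; rewrite ?sqrrN expr1n.
have ns : `|s| = 1 by case: sE => ->; rewrite ?normrN normr1.
rewrite (ge0_integral_slope (s * e) ns (measurable_restricted mW) (restricted_ge0 _)).
pose H (x : plane R) := (`|x.2|%:E * restricted (rays rho d e M s) (x.1 * x.2, s * e + s * x.2)%R)%E.
have mH : measurable_fun setT H.
  apply: emeasurable_funM; first by apply/measurable_EFinP; exact: measurableT_comp.
  apply: (measurableT_comp (measurable_restricted mW)); exact: measurable_affine_plane.
have H0 x : (0 <= H x)%E by rewrite mule_ge0// restricted_ge0.
apply: (iterated_integral_ge mH H0).
  exact/integrable_continuous/continuous_ray_fibre.
move=> m /andP[m1' m2'].
have mM : - M <= m <= M by rewrite !ltW.
have h0 : 0 < start_height d M m by exact: start_height_gt0.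
have eh0 : 0 < end_height rho m by exact: end_height_gt0.
have he : start_height d M m < end_height rho m by exact: lt_start_end_height.
exists (start_height d M m), (end_height rho m),
  (fun y => 2 * k m * s * z (m * y + 0, s * y + s * e) - k m ^+ 2 * (1 + m ^+ 2) * ln y),
  (fun y => 2 * k m * s * (m * dx1 z (m * y + 0, s * y + s * e) + s * dx2 z (m * y + 0, s * y + s * e))
      - k m ^+ 2 * (1 + m ^+ 2) * y^-1); split.
- exact: ltW.
- move=> y /andP[y1 _]; have y0 : 0 < y by exact: lt_le_trans y1.
  have dz := Ck1_is_derive_affine m 0 s (s * e) y Cz.
  have dl := is_derive1_ln y0.
  by apply: is_derive_eq; rewrite /GRing.scale/=; ring.
- apply: continuous_in_subspaceT => y; rewrite inE/= in_itv/= => /andP[y1 _].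
  have y0 : 0 < y by exact: lt_le_trans y1.
  apply: cvgB; last by apply: cvgM; [exact: cvg_cst|apply: cvgV; [rewrite gt_eqF|exact: cvg_id]].
  have cG : continuous (fun y : R => 2 * k m * s *
      (m * dx1 z (m * y + 0, s * y + s * e) + s * dx2 z (m * y + 0, s * y + s * e))).
    have ca : continuous (fun y : R => m * y + 0) by cont.
    have cb : continuous (fun y : R => s * y + s * e) by cont.
    have g1 := continuous_compose_pair c1 ca cb.
    have g2 := continuous_compose_pair c2 ca cb.
    apply: continuous_mul; first exact: cst_continuous.
    apply: continuous_add; apply: continuous_mul; [exact: cst_continuous|exact: g1|exact: cst_continuous|exact: g2].
  exact: cG.
- move=> y /andP[y1 y2].
  have y0 : 0 < y by exact: lt_trans y1.
  rewrite /H restrictedE /=; last first.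
    by apply: rays_mem => //; rewrite y1.
  rewrite -EFinM lee_fin gtr0_norm// addr0 [s * e + _]addrC /sqr_grad.
  set a := dx1 z _; set b := dx2 z _.
  rewrite -subr_ge0.
  (* The difference is the Jacobian [y] times the squared distance from the gradient to the
     comparison field. *)
  have -> : y * (a ^+ 2 + b ^+ 2) - (2 * k m * s * (m * a + s * b) - k m ^+ 2 * (1 + m ^+ 2) / y) =
      y * ((a - k m * s * m / y) ^+ 2 + (b - k m * s ^+ 2 / y) ^+ 2).
    by case: sE => ->; field; rewrite gt_eqF.
  by rewrite mulr_ge0 ?(ltW y0)// addr_ge0 ?sqr_ge0.
- have F : m * start_height d M m = foot d M m by exact: footE.
  rewrite /ray_fibre ln_div ?posrE// !addr0 F !mulrDr ![s * e + _]addrC.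
  by ring.
Qed.

Lemma integral_inv1Dsqr : (\int[mu]_(m in `[(- M)%R, M]) ((1 + m ^+ 2)^-1)%:E = (2 * al)%:E)%E.
Proof.
have MM : - M < M by move: (M0); lra.
have ci : continuous (fun m : R => (1 + m ^+ 2)^-1).
  by apply: continuous_inv; [move=> m; rewrite gt_eqF|cont].
rewrite (continuous_FTC2 (F := atan) MM).
- by rewrite atanN -EFinB opprK /al; congr EFin; ring.
- exact: continuous_subspaceT.
- split => [x _||]; first exact: derivable_atan.
  + exact/cvg_at_right_filter/continuous_atan.
  + exact/cvg_at_left_filter/continuous_atan.
- by move=> x _; rewrite derive1_atan.
Qed.

(** Under x1 = foot m the uniform measure of the channel width acquires the density d / al / (1 +
    m^2), so a column and the two rays of the same index can be added under one integral. *)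
Lemma core_substitution :
  (\int[mu]_(x in `[(- d)%R, d]) (core_fibre x)%:E
   = \int[mu]_(m in `[(- M)%R, M]) (core_fibre (foot d M m) * (d / al / (1 + m ^+ 2)))%:E)%E.
Proof.
have footM : foot d M M = d by rewrite /foot divfK// gt_eqF.
have footNM : foot d M (- M) = - d by rewrite /foot atanN mulrN divfK// gt_eqF.
have df (m : R) : is_derive m 1 (foot d M) (d / al / (1 + m ^+ 2)).
  by have := is_derive1_atan m => h; rewrite /foot; apply: is_derive_eq; rewrite /GRing.scale/=; ring.
have dfE : derive1 (foot d M) = fun m => d / al / (1 + m ^+ 2).
  by apply/funext => m; rewrite derive1E; apply: derive_val.
have cdf : continuous (fun m : R => d / al / (1 + m ^+ 2)).
  by cont; apply: continuous_inv; [move=> m; rewrite gt_eqF|cont].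
have cft : continuous (foot d M) by exact: continuous_foot.
rewrite -[X in `[_, X]]footM -footNM.
rewrite (@integration_by_substitution_increasing _ (foot d M) core_fibre (- M) M).
- by apply: eq_integral => m _; rewrite /= dfE.
- by move: (M0); lra.
- by move=> x y _ _; exact: lt_foot.
- by move=> x _; rewrite dfE; exact: cdf.
- by rewrite dfE; apply: (cvgP (d / al / (1 + (- M) ^+ 2))); apply: cvg_at_right_filter; exact: cdf.
- by rewrite dfE; apply: (cvgP (d / al / (1 + M ^+ 2))); apply: cvg_at_left_filter; exact: cdf.
- split => [x _||]; first by case: (df x).
  + by apply: cvg_at_right_filter; exact: cft.
  + by apply: cvg_at_left_filter; exact: cft.
- by apply: continuous_subspaceT; exact: continuous_core_fibre.
Qed.

(** Three parts in series: e / d for the channel, of length 2 e and width 2 d; ln (al r / d) / al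
    for the two cones of angle 2 al; and 1 / al for prolonging the columns by at most d / al at
    either end. *)
Definition resistance : R := e / d + al^-1 * (1 + ln (al * r / d)).

Definition ray_end (s m : R) : plane R :=
  (m * end_height rho m, s * (e + end_height rho m)).

(** The values of [z] at the two points where column and rays meet cancel. What is lost is exactly
    the slack in start_height <= d / al and in [end_height_ratio], as the identity for [X]
    displays. *)
Lemma fibre_sum m : - M <= m <= M ->
  (lam / al * (z (ray_end 1 m) - z (ray_end (-1) m)) - lam ^+ 2 * resistance / (2 * al)) / (1 + m ^+ 2)
  <= core_fibre (foot d M m) * (d / al / (1 + m ^+ 2)) + ray_fibre 1 m + ray_fibre (-1) m.
Proof.
move=> mM.
have h0 : 0 < start_height d M m by exact: start_height_gt0.
have eh0 : 0 < end_height rho m by exact: end_height_gt0.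
rewrite /core_fibre /ray_fibre /wall footK//.
set T := z (foot d M m, e + _); set B := z (foot d M m, - _).
rewrite !mul1r !mulN1r -/T -/B /ray_end mul1r mulN1r.
set A := z _; set C := z _.
set L := ln (_ / _).
have Lle : L <= ln (al * r / d).
  have Hr : end_height rho m / start_height d M m <= al * r / d by exact: end_height_ratio.
  rewrite /L ler_ln// posrE; first by rewrite divr_gt0.
  by rewrite divr_gt0// mulr_gt0.
have hle : start_height d M m <= d / al by exact: start_height_le.
rewrite -subr_ge0.
rewrite /resistance; set LL := ln (al * r / d) in Lle *; set w := start_height d M m in hle *.
have q0 := D1 m.
set X := (X in 0 <= X).
have -> : X = lam ^+ 2 / (2 * al * (1 + m ^+ 2)) * ((d / al - w) / d + (LL - L) / al).
  by rewrite /X /k /m1; field; rewrite !gt_eqF.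
rewrite mulr_ge0//; first by rewrite divr_ge0 ?sqr_ge0// ltW// !mulr_gt0.
by rewrite addr_ge0// divr_ge0 ?subr_ge0// ltW.
Qed.

Lemma continuous_ray_end s : continuous (fun m => z (ray_end s m)).
Proof.
have ce : continuous (end_height rho) by exact: continuous_end_height.
apply: (continuous_compose_pair c0); cont.
Qed.

Lemma energy_lower_bound :
  (\int[mu]_(m in `[(- M)%R, M])
    ((lam / al * (z (ray_end 1 m) - z (ray_end (-1) m)) - lam ^+ 2 * resistance / (2 * al)) / (1 + m ^+ 2))%:E
   <= \int[area R]_(x in G0 rho d e) (sqr_grad z x)%:E)%E.
Proof.
apply: le_trans (energy_split rho0 d0 e0 M0 Hd continuous_sqr_grad sqr_grad_ge0).
have cq : continuous (fun m : R => (1 + m ^+ 2)^-1).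
  by apply: continuous_inv; [move=> m; rewrite gt_eqF|cont].
have cft : continuous (foot d M) by exact: continuous_foot.
have cf : continuous (fun m => core_fibre (foot d M m) * (d / al / (1 + m ^+ 2))).
  apply: continuous_mul; first exact: (continuous_compose continuous_core_fibre).
  by apply: continuous_mul; [exact: cst_continuous|].
have c3 := @continuous_ray_fibre 1; have c4 := @continuous_ray_fibre (-1).
have i1 := integrable_continuous (- M) M cf.
have i2 := integrable_continuous (- M) M c3.
have i3 := integrable_continuous (- M) M c4.
apply: (@le_trans _ _ (\int[mu]_(m in `[(- M)%R, M])
   (core_fibre (foot d M m) * (d / al / (1 + m ^+ 2)) + ray_fibre 1 m + ray_fibre (-1) m)%:E)%E).
  apply: le_integral => //.
  - apply: integrable_continuous.
    have r1 := @continuous_ray_end 1; have r2 := @continuous_ray_end (-1).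
    by cont.
  - apply: integrable_continuous.
    by apply: continuous_add => //; exact: continuous_add.
  - by move=> m; rewrite inE/= in_itv/= => mM; rewrite lee_fin fibre_sum.
rewrite [X in (X <= _)%E](_ : _ = \int[mu]_(m in `[(- M)%R, M]) (core_fibre (foot d M m) * (d / al / (1 + m ^+ 2)))%:E + \int[mu]_(m in `[(- M)%R, M]) (ray_fibre 1 m)%:E + \int[mu]_(m in `[(- M)%R, M]) (ray_fibre (-1) m)%:E)%E; last first.
  rewrite -integralD//; rewrite -integralD//.
  exact: integrableD.
apply: leeD; last by apply: rays_bound; right.
apply: leeD; last by apply: rays_bound; left.
by rewrite -core_substitution; exact: core_bound.
Qed.

End energy_bounds.

(** * Cut-offs and gluing of class C^1 *)

Section transition.
Context {R : realType}.

(** A quadratic estimate deals with the points where two pieces of a formula meet; it is applied to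
    [half_sqr] and to [radial_log]. *)
Lemma is_derive_quadratic (f : R -> R) (x l C : R) :
  (forall y, `|f y - f x - (y - x) * l| <= C * (y - x) ^+ 2) -> is_derive x 1 f l.
Proof.
move=> fC; apply: cvg_is_derive; apply/cvgrPdist_le => /= eps eps0.
have K0 : 0 < `|C| + 1 by rewrite ltr_wpDl.
near=> t.
have t0 : t != 0 by near: t; exact: nbhs_dnbhs_neq.
have te : `|t| * (`|C| + 1) <= eps.
  rewrite -ler_pdivlMr//; apply: ltW; near: t; apply: dnbhs0_lt; exact: divr_gt0.
have := fC (t + x); rewrite addrK => h.
have -> : l - t^-1 *: (f (t + x) - f x) = - (t^-1 * (f (t + x) - f x - t * l)).
  by rewrite /GRing.scale/=; field.
rewrite normrN normrM normfV ler_pdivrMl ?normr_gt0//.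
apply: (le_trans h); rewrite -[t ^+ 2]real_normK ?num_real// expr2 mulrCA ler_wpM2l//.
apply: le_trans te; rewrite mulrC ler_wpM2l//.
by apply: (le_trans (ler_norm _)); rewrite lerDl.
Unshelve. all: by end_near.
Qed.

(** A primitive of the absolute value: combinations of its translates are C^1, with piecewise linear
    derivative. *)
Definition half_sqr (t : R) : R := t * `|t| / 2.

Lemma is_derive_half_sqr (x : R) : is_derive x 1 half_sqr `|x|.
Proof.
apply: (@is_derive_quadratic _ _ _ 1) => y; rewrite /half_sqr mul1r ler_norml.
have h1 := sqr_ge0 (y - x); have h2 := sqr_ge0 x; have h3 := sqr_ge0 y.
have [x0|/ltW x0] := ger0P x; have [y0|/ltW y0] := ger0P y.
- by apply/andP; split; lra.
- by have := mulr_ge0_le0 x0 y0 => h4; apply/andP; split; lra.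
- by have := mulr_le0_ge0 x0 y0 => h4; apply/andP; split; lra.
- by apply/andP; split; lra.
Qed.

Lemma is_derive_half_sqr_shift (c x : R) : is_derive x 1 (fun t => half_sqr (t + c)) `|x + c|.
Proof. by apply: (@is_derive1_shift _ half_sqr); exact: is_derive_half_sqr. Qed.

Variables (e w : R).
Hypotheses (w0 : 0 < w) (we : w <= e).

(** Zero outside [- e, e], with linear ramps of width [w], plateau 1 / (2 e - w) and integral 1.
    With w = e it is a triangle, enough for gluing; a small [w] brings the maximal slope of
    [transition] close to the optimal 1 / (2 e). *)
Definition trapezoid (s : R) : R :=
  (`|s + e| - `|s + (e - w)| - `|s + (w - e)| + `|s + (- e)|) / (2 * w * (2 * e - w)).

Definition transition (s : R) : R :=
  (half_sqr (s + e) - half_sqr (s + (e - w)) - half_sqr (s + (w - e)) + half_sqr (s + (- e)))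
    / (2 * w * (2 * e - w)) + 1 / 2.

Let c0 : 0 < 2 * w * (2 * e - w).
Proof. by rewrite mulr_gt0 ?mulr_gt0//; move: (w0) (we); lra. Qed.

Lemma is_derive_transition (s : R) : is_derive s 1 transition (trapezoid s).
Proof.
have h1 := is_derive_half_sqr_shift e s.
have h2 := is_derive_half_sqr_shift (e - w) s.
have h3 := is_derive_half_sqr_shift (w - e) s.
have h4 := is_derive_half_sqr_shift (- e) s.
rewrite /transition /trapezoid; apply: is_derive_eq.
by rewrite /GRing.scale/=; ring.
Qed.

Lemma continuous_trapezoid : continuous trapezoid.
Proof. by rewrite /trapezoid; cont. Qed.

Lemma continuous_transition : continuous transition.
Proof.
move=> s; apply: differentiable_continuous; apply/derivable1_diffP.
by case: (is_derive_transition s).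
Qed.

Lemma transition_eq1 s : e <= s -> transition s = 1.
Proof.
move=> es; rewrite /transition /half_sqr !ger0_norm; try by move: (w0) (we) es; lra.
by field; rewrite !gt_eqF//; move: (w0) (we); lra.
Qed.

Lemma transition_eq0 s : s <= - e -> transition s = 0.
Proof.
move=> es; rewrite /transition /half_sqr !ler0_norm; try by move: (w0) (we) es; lra.
by field; rewrite !gt_eqF//; move: (w0) (we); lra.
Qed.

Lemma trapezoid_bounds s : 0 <= trapezoid s <= (2 * e - w)^-1.
Proof.
have E : (2 * e - w)^-1 = (2 * w) / (2 * w * (2 * e - w)).
  by field; rewrite !gt_eqF//; move: (w0) (we); lra.
rewrite E /trapezoid ler_pM2r ?invr_gt0// divr_ge0 ?(ltW c0)//=; last first.
  by move: (w0) (we); case: (ger0P (s + e)); case: (ger0P (s + (e - w)));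
   case: (ger0P (s + (w - e))); case: (ger0P (s + - e)); lra.
by move: (w0) (we); case: (ger0P (s + e)); case: (ger0P (s + (e - w)));
   case: (ger0P (s + (w - e))); case: (ger0P (s + - e)); lra.
Qed.

Lemma trapezoid_eq0 s : e <= `|s| -> trapezoid s = 0.
Proof.
rewrite /trapezoid => es; apply/eqP; rewrite mulf_eq0; apply/orP; left; apply/eqP.
move: (w0) (we) es; case: (ger0P s); case: (ger0P (s + e)); case: (ger0P (s + (e - w)));
   case: (ger0P (s + (w - e))); case: (ger0P (s + - e)); lra.
Qed.

Lemma transition_bounds s : 0 <= transition s <= 1.
Proof.
have e0 : 0 < e by exact: lt_le_trans we.
have nd x y : x <= y -> transition x <= transition y.
  move=> xy; have [t _ E] := MVT_segment xy (fun t _ => is_derive_transition t)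
    (continuous_subspaceT continuous_transition).
  by rewrite -subr_ge0 E mulr_ge0 ?subr_ge0//; have /andP[] := trapezoid_bounds t.
apply/andP; split.
  have [se|se] := leP s (- e); first by rewrite transition_eq0.
  by rewrite -(transition_eq0 (lexx (- e))) nd// ltW.
have [se|se] := leP e s; first by rewrite transition_eq1.
by rewrite -(transition_eq1 (lexx e)) nd// ltW.
Qed.

End transition.

Section Ck1.
Context {R : realType}.
Implicit Types f g : plane R -> R.

Lemma Ck1_intro f f1 f2 :
  (forall x y : R, is_derive x 1 (fun t => f (t, y)) (f1 (x, y))) ->
  (forall x y : R, is_derive y 1 (fun t => f (x, t)) (f2 (x, y))) ->
  continuous f -> continuous f1 -> continuous f2 ->
  [/\ Ck 1 f, dx1 f = f1 & dx2 f = f2].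
Proof.
move=> d1 d2 cf cf1 cf2.
have E1 : dx1 f = f1.
  by apply/funext => -[x y]; rewrite /dx1; apply: derive_val; apply/is_derive_dx1P; exact: d1.
have E2 : dx2 f = f2.
  by apply/funext => -[x y]; rewrite /dx2; apply: derive_val; apply/is_derive_dx2P; exact: d2.
split => //; split; rewrite ?E1 ?E2// => -[x y]; split.
  by have /is_derive_dx1P[] := d1 x y.
by have /is_derive_dx2P[] := d2 x y.
Qed.

(** Used twice: to glue the two approximating functions of the lower bound, and to build the trial
    function of the upper bound. *)
Lemma Ck1_splice f g (chi dchi : R -> R) :
  Ck 1 f -> Ck 1 g -> (forall s : R, is_derive s 1 chi (dchi s)) -> continuous dchi ->
  let z := fun x : plane R => chi x.2 * f x + (1 - chi x.2) * g x in
  [/\ Ck 1 z,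
      dx1 z = (fun x => chi x.2 * dx1 f x + (1 - chi x.2) * dx1 g x) &
      dx2 z = (fun x => chi x.2 * dx2 f x + (1 - chi x.2) * dx2 g x + dchi x.2 * (f x - g x))].
Proof.
move=> Cf Cg dP cd z.
have cchi : continuous chi.
  by move=> s; apply: differentiable_continuous; apply/derivable1_diffP; case: (dP s).
have [cf _ cf1 cf2] := Cf; have [cg _ cg1 cg2] := Cg; rewrite /= in cf1 cf2 cg1 cg2.
have cc := continuous_compose cchi (@continuous_snd R).
have cdc := continuous_compose cd (@continuous_snd R).
have c1c : continuous (fun x : plane R => 1 - chi x.2).
  apply: (@continuous_add _ _ (cst 1) (fun x => - chi x.2)); first exact: cst_continuous.
  exact: continuous_opp.
apply: Ck1_intro.
- move=> x y; have h1 := Ck1_dx1 Cf x y; have h2 := Ck1_dx1 Cg x y.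
  by rewrite /z/=; apply: is_derive_eq; rewrite /GRing.scale/=; ring.
- move=> x y; have h1 := Ck1_dx2 Cf x y; have h2 := Ck1_dx2 Cg x y; have h3 := dP y.
  by rewrite /z/=; apply: is_derive_eq; rewrite /GRing.scale/=; ring.
- exact: (continuous_add (continuous_mul cc cf) (continuous_mul c1c cg)).
- exact: (continuous_add (continuous_mul cc cf1) (continuous_mul c1c cg1)).
- apply: continuous_add (continuous_mul cdc (continuous_add cf (continuous_opp cg))).
  exact: (continuous_add (continuous_mul cc cf2) (continuous_mul c1c cg2)).
Qed.

End Ck1.

(** * From approximate traces to the lower bound *)

Section capacity_lower.
Context {R : realType}.
Local Notation mu := (@lebesgue_measure R).

Lemma sqrD_young (a b eta : R) : 0 < eta ->
  (a + b) ^+ 2 <= (1 + eta) * a ^+ 2 + (1 + eta^-1) * b ^+ 2.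
Proof.
move=> eta0; rewrite -subr_ge0.
have -> : (1 + eta) * a ^+ 2 + (1 + eta^-1) * b ^+ 2 - (a + b) ^+ 2 = eta * (a - b / eta) ^+ 2.
  by field; rewrite gt_eqF.
by rewrite mulr_ge0 ?sqr_ge0// ltW.
Qed.

Lemma sqr_sum4_le (a b c x : R) :
  (a + b + c + x) ^+ 2 <= 4 * (a ^+ 2 + b ^+ 2 + c ^+ 2 + x ^+ 2).
Proof.
rewrite -subr_ge0; set X := (X in 0 <= X).
have -> : X = (a - b) ^+ 2 + (a - c) ^+ 2 + (a - x) ^+ 2 + (b - c) ^+ 2 + (b - x) ^+ 2 + (c - x) ^+ 2.
  by rewrite /X; ring.
by rewrite !addr_ge0 ?sqr_ge0.
Qed.

Lemma sqrM_le (k a c : R) : 0 <= k <= c -> (k * a) ^+ 2 <= c ^+ 2 * a ^+ 2.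
Proof.
move=> /andP[k0 kc]; rewrite exprMn ler_wpM2r ?sqr_ge0// lerXn2r ?nnegrE//.
exact: le_trans kc.
Qed.

Definition energy_le (G : set (plane R)) (f : plane R -> R) (a : R) : Prop :=
  [/\ measurable_fun G f, forall x, 0 <= f x & (\int[area R]_(x in G) (f x)%:E <= a%:E)%E].

Lemma energy_leD (G : set (plane R)) (f g : plane R -> R) (a b : R) : measurable G ->
  energy_le G f a -> energy_le G g b -> energy_le G (fun x => f x + g x) (a + b).
Proof.
move=> mG [mf f0 fa] [mg g0 gb]; split; first exact: measurable_funD.
  by move=> x; rewrite addr_ge0.
under eq_integral do rewrite EFinD.
rewrite ge0_integralD//.
- by rewrite EFinD leeD.
- by move=> x _; rewrite lee_fin.
- exact/measurable_EFinP.
- by move=> x _; rewrite lee_fin.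
- exact/measurable_EFinP.
Qed.

Lemma energy_leZ (G : set (plane R)) (f : plane R -> R) (a c : R) : measurable G -> 0 <= c ->
  energy_le G f a -> energy_le G (fun x => c * f x) (c * a).
Proof.
move=> mG c0 [mf f0 fa]; split; first exact: measurable_funM.
  by move=> x; rewrite mulr_ge0.
under eq_integral do rewrite EFinM.
rewrite ge0_integralZl//.
- by rewrite EFinM lee_wpmul2l// lee_fin.
- exact/measurable_EFinP.
- by move=> x _; rewrite lee_fin.
Qed.

Lemma energy_le_sub (G : set (plane R)) (f g : plane R -> R) (a : R) : measurable G ->
  measurable_fun G g -> (forall x, 0 <= g x <= f x) ->
  energy_le G f a -> energy_le G g a.
Proof.
move=> mG mg gf [mf f0 fa]; split => //.
  by move=> x; have /andP[] := gf x.
apply: le_trans fa; apply: ge0_le_integral => //.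
- by move=> x _; rewrite lee_fin; have /andP[] := gf x.
- exact/measurable_EFinP.
- exact/measurable_EFinP.
- by move=> x _; rewrite lee_fin; have /andP[] := gf x.
Qed.

Lemma cvge0_near_le (f : nat -> \bar R) (eps : R) : 0 < eps ->
  f k @[k --> \oo] --> 0%E -> \forall k \near \oo, (f k <= eps%:E)%E.
Proof.
move=> eps0 f0.
have : nbhs 0%E [set x : \bar R | (x < eps%:E)%E].
  apply: open_nbhs_nbhs; split; first exact: open_ereal_lt_ereal.
  by rewrite /= lte_fin.
move=> /f0 h; near=> k; apply: ltW; near: k; exact: h.
Unshelve. all: by end_near.
Qed.

Variables (rho d e M : R).
Hypotheses (rho0 : 0 < rho) (d0 : 0 < d) (e0 : 0 < e) (M0 : 0 < M).
Let r := rho / 2.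
Let al := atan M.
Hypothesis Hd : d / al * Num.sqrt (1 + M ^+ 2) < r.
Let G := G0 rho d e.
Let r0 : 0 < r. Proof. exact: divr_gt0. Qed.
Let al0 : 0 < al. Proof. exact: atan_gt0. Qed.

Let D1 (m : R) : 0 < 1 + m ^+ 2. Proof. by rewrite ltr_wpDr ?sqr_ge0. Qed.

Lemma integral_atan_shift (t0 : R) (g : R -> R) : continuous g ->
  (\int[mu]_(t in `[(t0 - al)%R, (t0 + al)%R]) (g t)%:E =
   \int[mu]_(m in `[(- M)%R, M]) (g (t0 + atan m) / (1 + m ^+ 2))%:E)%E.
Proof.
move=> cg.
pose F (m : R) := t0 + atan m.
have dF (m : R) : is_derive m 1 F (1 + m ^+ 2)^-1.
  by have := is_deriveD (is_derive_cst t0 m 1) (is_derive1_atan m); rewrite add0r.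
have dFE : derive1 F = fun m => (1 + m ^+ 2)^-1.
  by apply/funext => m; rewrite derive1E; apply: derive_val.
have cF : continuous F.
  by move=> m; apply: cvgD; [exact: cvg_cst|exact: continuous_atan].
have cq : continuous (fun m : R => (1 + m ^+ 2)^-1).
  by apply: continuous_inv; [move=> m; rewrite gt_eqF|cont].
rewrite -atanN.
rewrite (@integration_by_substitution_increasing _ F g (- M) M).
- by apply: eq_integral => m _; rewrite /= dFE.
- by move: (M0); lra.
- by move=> x y _ _ xy; rewrite /F ltrD2l lt_atan.
- by move=> x _; rewrite dFE; exact: cq.
- by rewrite dFE; apply: (cvgP (1 + (- M) ^+ 2)^-1); apply: cvg_at_right_filter; exact: cq.
- by rewrite dFE; apply: (cvgP (1 + M ^+ 2)^-1); apply: cvg_at_left_filter; exact: cq.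
- split => [x _||]; first by case: (dF x).
  + by apply: cvg_at_right_filter; exact: cF.
  + by apply: cvg_at_left_filter; exact: cF.
- exact: continuous_subspaceT.
Qed.

Lemma continuous_circle_pt (z : plane R -> R) (c : plane R) : continuous z ->
  continuous (fun t => z (circle_pt c r t)).
Proof.
move=> cz; rewrite /circle_pt.
have cs : continuous (@sin R) by exact: continuous_sin.
have cc : continuous (@cos R) by exact: continuous_cos.
apply: (continuous_compose_pair cz).
- apply: (@continuous_add _ _ (cst c.1)); first exact: cst_continuous.
  by apply: (@continuous_mul _ _ (cst r)) => //; exact: cst_continuous.
- apply: (@continuous_add _ _ (cst c.2)); first exact: cst_continuous.
  by apply: (@continuous_mul _ _ (cst r)) => //; exact: cst_continuous.
Qed.

(* [circle_pt] uses the polar angle, the rays are indexed by their slope. *)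
Lemma arc_integral_le (z : plane R -> R) (x0 : plane R) (S : set (plane R)) (c t0 a b : R) :
  continuous z -> angles x0 r S = `]a, b[%classic -> a < t0 - al -> t0 + al < b ->
  (r%:E * \int[mu]_(m in `[(- M)%R, M]) ((z (circle_pt x0 r (t0 + atan m)) - c) ^+ 2 / (1 + m ^+ 2))%:E
  <= normL2_arc_sq x0 r S (fun x => (z x - c)%R))%E.
Proof.
move=> cz aE at0 t0b.
have cg : continuous (fun t => (z (circle_pt x0 r t) - c) ^+ 2).
  apply: continuous_exprn; apply: (@continuous_add _ _ (fun t => z (circle_pt x0 r t)) (cst (- c))).
    exact: continuous_circle_pt.
  exact: cst_continuous.
rewrite -(integral_atan_shift t0 cg) /normL2_arc_sq aE -ge0_integralZl//; last 2 first.
- by move=> t _; rewrite lee_fin sqr_ge0.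
- by rewrite lee_fin ltW.
- apply: ge0_subset_integral => //.
  + apply: measurable_funTS; apply/measurable_EFinP; apply: continuous_measurable_fun.
    by apply: (@continuous_mul _ _ (cst r)); [exact: cst_continuous|].
  + by move=> t _; rewrite lee_fin mulr_ge0 ?sqr_ge0// ltW.
  + by move=> t /=; rewrite !in_itv/= => /andP[h1 h2]; apply/andP; split; lra.
- apply: measurable_funTS; apply/measurable_EFinP; exact: continuous_measurable_fun.
Qed.

Let alpi : al < pi / 2. Proof. exact: atan_ltpi2. Qed.

Lemma ray_end_plus_le (z : plane R -> R) (c : R) : continuous z ->
  ((r%:E * \int[mu]_(m in `[(- M)%R, M]) ((z (ray_end rho e 1 m) - c) ^+ 2 / (1 + m ^+ 2))%:E)
  <= normL2_arc_sq (ctr_plus e) r (S_plus rho e) (fun x => (z x - c)%R))%E.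
Proof.
move=> cz.
have aE : angles (ctr_plus e) r (S_plus rho e) = `]0, pi[%classic by exact: angles_S_plus.
apply: le_trans (arc_integral_le c (t0 := pi / 2) cz aE _ _); last 2 first.
- by move: (alpi); lra.
- by move: (alpi); lra.
rewrite lee_pmul2l//.
have cf : continuous (fun m => (z (ray_end rho e 1 m) - c) ^+ 2 / (1 + m ^+ 2)).
  apply: continuous_mul; last by apply: continuous_inv; [move=> m; rewrite gt_eqF|cont].
  apply: continuous_exprn; apply: (@continuous_add _ _ (fun m => z (ray_end rho e 1 m)) (cst (- c))).
    have ce : continuous (end_height rho) by exact: continuous_end_height.
    by apply: (continuous_compose_pair cz); cont.
  exact: cst_continuous.
(* The point of polar angle pi / 2 + atan m has slope - m, so the slope variable is reflected on
   this arc. On the lower arc, pi / 2 + pi + atan m already gives slope m. *)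
have NMM : - M <= M by move: (M0); lra.
have := @integration_by_substitution_oppr R _ (- M) M NMM (continuous_subspaceT cf).
rewrite opprK => ->.
rewrite le_eqVlt; apply/orP; left; apply/eqP; apply: eq_integral => m _.
rewrite /= sqrrN; congr ((z _ - c) ^+ 2 / _)%:E.
rewrite /ray_end /circle_pt /ctr_plus /= [pi / 2 + _]addrC cosDpihalf sinDpihalf sin_atan cos_atan.
by rewrite /end_height sqrrN -/r mul1r add0r; congr (_, _); field; rewrite gt_eqF// sqrt1D_gt0.
Qed.

Lemma ray_end_minus_le (z : plane R -> R) (c : R) : continuous z ->
  ((r%:E * \int[mu]_(m in `[(- M)%R, M]) ((z (ray_end rho e (-1) m) - c) ^+ 2 / (1 + m ^+ 2))%:E)
  <= normL2_arc_sq (ctr_minus e) r (S_minus rho e) (fun x => (z x - c)%R))%E.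
Proof.
move=> cz.
have aE : angles (ctr_minus e) r (S_minus rho e) = `]pi, 2 * pi[%classic by exact: angles_S_minus.
apply: le_trans (arc_integral_le c (t0 := pi / 2 + pi) cz aE _ _); last 2 first.
- by move: (alpi); lra.
- by move: (alpi); lra.
rewrite lee_pmul2l//.
rewrite le_eqVlt; apply/orP; left; apply/eqP; apply: eq_integral => m _.
rewrite /=; congr ((z _ - c) ^+ 2 / _)%:E.
have -> : pi / 2 + pi + atan m = (atan m + pi / 2) + pi :> R by ring.
rewrite /ray_end /circle_pt /ctr_minus /= cosDpi sinDpi cosDpihalf sinDpihalf sin_atan cos_atan.
by rewrite /end_height -/r mulN1r add0r; congr (_, _); field; rewrite gt_eqF// sqrt1D_gt0.
Qed.

(** The boundary values are close to 1 and 0 only in [L^2], with squared errors [dp] and [dm].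
    Young's inequality with parameter [eta] converts the linear loss into these squares, at the
    price lam * eta on each arc. *)
Lemma energy_ge (z : plane R -> R) (lam eta dp dm E : R) : Ck 1 z -> 0 < lam -> 0 < eta ->
  (\int[mu]_(m in `[(- M)%R, M]) ((z (ray_end rho e 1 m) - 1) ^+ 2 / (1 + m ^+ 2))%:E <= dp%:E)%E ->
  (\int[mu]_(m in `[(- M)%R, M]) ((z (ray_end rho e (-1) m)) ^+ 2 / (1 + m ^+ 2))%:E <= dm%:E)%E ->
  (\int[area R]_(x in G) (sqr_grad z x)%:E <= E%:E)%E ->
  2 * lam * (1 - eta) - lam ^+ 2 * resistance rho d e M - lam / (2 * al * eta) * (dp + dm) <= E.
Proof.
move=> Cz lam0 eta0 Hp Hm HE.
have c0 : continuous z by case: Cz.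
have cp : continuous (fun m => z (ray_end rho e 1 m)) by exact: continuous_ray_end.
have cm : continuous (fun m => z (ray_end rho e (-1) m)) by exact: continuous_ray_end.
have cq : continuous (fun m : R => (1 + m ^+ 2)^-1).
  by apply: continuous_inv; [move=> m; rewrite gt_eqF|cont].
pose N := resistance rho d e M.
pose A := lam / al * (1 - eta) - lam ^+ 2 * N / (2 * al).
pose B := lam / (2 * al * eta).
pose f1 (m : R) := (1 + m ^+ 2)^-1.
pose f2 m := (z (ray_end rho e 1 m) - 1) ^+ 2 / (1 + m ^+ 2).
pose f3 m := z (ray_end rho e (-1) m) ^+ 2 / (1 + m ^+ 2).
have cf2 : continuous f2.
  apply: continuous_mul cq; apply: continuous_exprn; apply: continuous_add cp _.
  exact: cst_continuous.
have cf3 : continuous f3 by apply: continuous_mul cq; exact: continuous_exprn.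
have cB (f : R -> R) : continuous f -> continuous (fun m => B * f m).
  by move=> cf; apply: continuous_mul => //; exact: cst_continuous.
have := energy_lower_bound rho0 d0 e0 M0 Hd Cz lam => /le_trans/(_ HE) h.
rewrite -lee_fin; apply: le_trans h.
have i1 : mu.-integrable `[- M, M] (fun m => (A * f1 m)%:E).
  apply: integrable_continuous; apply: continuous_mul => //; exact: cst_continuous.
have i2 : mu.-integrable `[- M, M] (fun m => (B * f2 m)%:E).
  by apply: integrable_continuous; exact: cB.
have i3 : mu.-integrable `[- M, M] (fun m => (B * f3 m)%:E).
  by apply: integrable_continuous; exact: cB.
have j2 := integrable_continuous (- M) M cf2.
have j3 := integrable_continuous (- M) M cf3.
have j1 : mu.-integrable `[- M, M] (EFin \o f1) by exact: integrable_continuous.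
apply: (@le_trans _ _ (\int[mu]_(m in `[(- M)%R, M]) (A * f1 m - B * f2 m - B * f3 m)%:E)%E).
  under eq_integral do rewrite !EFinB.
  rewrite integralB//; last by exact: integrableB.
  rewrite integralB//.
  under eq_integral do rewrite EFinM.
  rewrite integralZl// (integral_inv1Dsqr M0).
  under [X in (_ <= _ - X - _)%E]eq_integral do rewrite EFinM.
  rewrite integralZl//.
  under [X in (_ <= _ - _ - X)%E]eq_integral do rewrite EFinM.
  rewrite integralZl//.
  have f20 : (0 <= \int[mu]_(m in `[(- M)%R, M]) (f2 m)%:E)%E.
    by apply: integral_ge0 => m _; rewrite lee_fin mulr_ge0 ?sqr_ge0// invr_ge0 ltW.
  have f30 : (0 <= \int[mu]_(m in `[(- M)%R, M]) (f3 m)%:E)%E.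
    by apply: integral_ge0 => m _; rewrite lee_fin mulr_ge0 ?sqr_ge0// invr_ge0 ltW.
  move: f20 f30 Hp Hm; rewrite -/f2 -/f3.
  case: (\int[mu]_(m in `[(- M)%R, M]) (f2 m)%:E)%E => [x2| |] //.
  case: (\int[mu]_(m in `[(- M)%R, M]) (f3 m)%:E)%E => [x3| |] //.
  rewrite !lee_fin => _ _ h2 h3.
  have -> : A * (2 * atan M) = 2 * lam * (1 - eta) - lam ^+ 2 * N.
    by rewrite /A -/al; field; rewrite gt_eqF.
  have B0 : 0 < B by rewrite divr_gt0// !mulr_gt0.
  by rewrite -/B -/N -addrA -opprD lerD2l lerN2 -mulrDr ler_pM2l// lerD.
apply: le_integral.
- by [].
- exact: (integrableB _ (integrableB _ i1 i2) i3).
- apply: integrable_continuous; rewrite -/N.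
  apply: continuous_mul cq; apply: continuous_add; last exact: cst_continuous.
  apply: continuous_mul; first exact: cst_continuous.
  by apply: continuous_add cp _; exact: continuous_opp.
- move=> m _; rewrite lee_fin /f1 /f2 /f3 /A /B.
  have q0 := D1 m.
  set P := z _; set Q := z _.
  rewrite -/al -/N -subr_ge0; set X := (X in 0 <= X).
  have -> : X = lam / (2 * al * eta * (1 + m ^+ 2)) * ((P - 1 + eta) ^+ 2 + (Q - eta) ^+ 2).
    by rewrite /X; field; rewrite !gt_eqF.
  by rewrite mulr_ge0 ?addr_ge0 ?sqr_ge0// divr_ge0 ?(ltW lam0)// ltW// !mulr_gt0.
Qed.

(** The cut-off contributes dchi * (u - v), and u - v = (u - U) - (v - U) is small in [L^2]; the
    factor e^-1 from the slope of the cut-off is harmless because [eps] can be chosen after [e]. The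
    6 counts the [L^2] errors, the 4 the terms of [w2]. *)
Lemma splice_energy (u v : plane R -> R) (U g1 g2 : plane R -> R) (eta eps E : R) :
  Ck 1 u -> Ck 1 v -> in_L2 G U -> in_L2 G g1 -> in_L2 G g2 -> 0 < eta ->
  (\int[area R]_(x in G) (g1 x ^+ 2 + g2 x ^+ 2)%:E <= E%:E)%E ->
  (normL2_sq G (u \- U)%R <= eps%:E)%E -> (normL2_sq G (v \- U)%R <= eps%:E)%E ->
  (normL2_sq G (dx1 u \- g1)%R <= eps%:E)%E -> (normL2_sq G (dx1 v \- g1)%R <= eps%:E)%E ->
  (normL2_sq G (dx2 u \- g2)%R <= eps%:E)%E -> (normL2_sq G (dx2 v \- g2)%R <= eps%:E)%E ->
  exists z, [/\ Ck 1 z, forall x, e <= x.2 -> z x = u x, forall x, x.2 <= - e -> z x = v x &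
    (\int[area R]_(x in G) (sqr_grad z x)%:E <=
      ((1 + eta) * E + (1 + eta^-1) * (4 * ((1 + e^-1 ^+ 2) * (6 * eps))))%:E)%E].
Proof.
move=> Cu Cv [mU _] [mg1 _] [mg2 _] eta0 gE u0 v0 u1 v1 u2 v2.
have mG : measurable G by exact: measurable_G0.
have := Ck1_splice Cu Cv (is_derive_transition e e) (@continuous_trapezoid _ e e).
set chi := transition e e; set dchi := trapezoid e e.
set z := (fun x => _) => -[Cz z1 z2].
exists z; split => //.
- by move=> x ex; rewrite /z /chi transition_eq1// subrr mul0r addr0 mul1r.
- by move=> x ex; rewrite /z /chi transition_eq0// subr0 mul0r add0r mul1r.
have mcont (f : plane R -> R) : continuous f -> measurable_fun G f.
  by move=> cf; apply: measurable_funTS; exact: continuous_measurable_plane.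
have B (f h : plane R -> R) : continuous f -> measurable_fun G h ->
  (normL2_sq G (f \- h)%R <= eps%:E)%E -> energy_le G (fun x => (f x - h x) ^+ 2) eps.
  move=> cf mh fh; split => //; last by move=> x; exact: sqr_ge0.
  by apply: measurable_funX; apply: measurable_funB => //; exact: mcont.
have [cu _ cu1 cu2] := Cu; have [cv _ cv1 cv2] := Cv; rewrite /= in cu1 cu2 cv1 cv2.
have {}u0 := B _ _ cu mU u0; have {}v0 := B _ _ cv mU v0.
have {}u1 := B _ _ cu1 mg1 u1; have {}v1 := B _ _ cv1 mg1 v1.
have {}u2 := B _ _ cu2 mg2 u2; have {}v2 := B _ _ cv2 mg2 v2.
have gB : energy_le G (fun x => g1 x ^+ 2 + g2 x ^+ 2) E.
  split => //; last by move=> x; rewrite addr_ge0 ?sqr_ge0.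
  by apply: measurable_funD; exact: measurable_funX.
have S := energy_leD mG (energy_leD mG (energy_leD mG u0 v0) (energy_leD mG u1 v1)) (energy_leD mG u2 v2).
have s0 : 0 <= 1 + e^-1 ^+ 2 by rewrite addr_ge0 ?sqr_ge0.
have q0 : 0 <= 1 + eta^-1 by rewrite addr_ge0// invr_ge0 ltW.
have p0 : 0 <= 1 + eta by rewrite addr_ge0// ltW.
have := energy_leD mG (energy_leZ mG p0 gB) (energy_leZ mG q0 (energy_leZ mG (ler0n R 4) (energy_leZ mG s0 S))).
have -> : eps + eps + (eps + eps) + (eps + eps) = 6 * eps by ring.
set h := (fun x => _) => hB.
suff : energy_le G (sqr_grad z) ((1 + eta) * E + (1 + eta^-1) * (4 * ((1 + e^-1 ^+ 2) * (6 * eps)))).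
  by case.
apply: (energy_le_sub mG _ _ hB).
  by apply: mcont; exact: continuous_sqr_grad.
move=> x; rewrite sqr_grad_ge0/= /h /sqr_grad z1 z2.
have := transition_bounds e0 (lexx e) x.2; rewrite -/chi.
have := trapezoid_bounds e0 (lexx e) x.2; rewrite -/dchi.
have -> : 2 * e - e = e by ring.
set c := chi x.2; set c' := dchi x.2 => c'b /andP[cb0 cb1].
have cb : 0 <= c <= 1 by rewrite cb0.
have cb' : 0 <= 1 - c <= 1 by apply/andP; split; lra.
set p := u x - U x; set q := v x - U x.
set a1 := dx1 u x - g1 x; set b1 := dx1 v x - g1 x.
set a2 := dx2 u x - g2 x; set b2 := dx2 v x - g2 x.
set w1 := c * a1 + (1 - c) * b1; set w2 := c * a2 + (1 - c) * b2 + c' * p + c' * - q.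
have -> : c * dx1 u x + (1 - c) * dx1 v x = g1 x + w1 by rewrite /w1 /a1 /b1; ring.
have -> : c * dx2 u x + (1 - c) * dx2 v x + c' * (u x - v x) = g2 x + w2.
  by rewrite /w2 /a2 /b2 /p /q; ring.
have y1 := sqrD_young (g1 x) w1 eta0; have y2 := sqrD_young (g2 x) w2 eta0.
have h1 : w1 ^+ 2 <= 4 * (a1 ^+ 2 + b1 ^+ 2).
  have := sqr_sum4_le (c * a1) ((1 - c) * b1) 0 0.
  have := sqrM_le a1 cb; have := sqrM_le b1 cb'; rewrite -/w1 !addr0; lra.
have h2 : w2 ^+ 2 <= 4 * (a2 ^+ 2 + b2 ^+ 2 + e^-1 ^+ 2 * (p ^+ 2 + q ^+ 2)).
  have := sqr_sum4_le (c * a2) ((1 - c) * b2) (c' * p) (c' * - q).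
  have := sqrM_le a2 cb; have := sqrM_le b2 cb'.
  have := sqrM_le p c'b; have := sqrM_le (- q) c'b; rewrite sqrrN -/w2; lra.
have k0 : 0 <= e^-1 ^+ 2 by exact: sqr_ge0.
have hw : w1 ^+ 2 + w2 ^+ 2 <= 4 * ((1 + e^-1 ^+ 2) *
    ((p ^+ 2 + q ^+ 2) + (a1 ^+ 2 + b1 ^+ 2) + (a2 ^+ 2 + b2 ^+ 2))).
  have : 0 <= e^-1 ^+ 2 * (a1 ^+ 2 + b1 ^+ 2 + (a2 ^+ 2 + b2 ^+ 2)).
    by rewrite mulr_ge0// !addr_ge0 ?sqr_ge0.
  have := sqr_ge0 p; have := sqr_ge0 q; lra.
have := ler_wpM2l q0 hw; rewrite mulrDr; lra.
Qed.

Hypothesis N0 : 0 < resistance rho d e M.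

Lemma capacity_ge : ((resistance rho d e M)^-1%:E <= capacity rho d e)%E.
Proof.
set N := resistance rho d e M.
apply: le_ereal_inf_tmp => _ [U [g1 [g2 [[U2 g12 g22 _] [u [Cu u0 u1 u2 uS]] [v [Cv v0 v1 v2 vS]] ->]]]].
have mG : measurable G by exact: measurable_G0.
set E := (\int[area R]_(x in _) _)%E.
have Efin : (0 <= E < +oo)%E.
  rewrite integral_ge0/=; last by move=> x _; rewrite lee_fin addr_ge0 ?sqr_ge0.
  have [mg1 i1] := g12; have [mg2 i2] := g22.
  rewrite /E; under eq_integral do rewrite EFinD.
  rewrite ge0_integralD//; first by rewrite lte_add_pinfty.
  - by move=> x _; rewrite lee_fin sqr_ge0.
  - by apply/measurable_EFinP; exact: measurable_funX.
  - by move=> x _; rewrite lee_fin sqr_ge0.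
  - by apply/measurable_EFinP; exact: measurable_funX.
have EE : E = (fine E)%:E by rewrite fineK// ge0_fin_numE; case/andP: Efin.
set Er := fine E in EE.
have Er0 : 0 <= Er by rewrite -lee_fin -EE; case/andP: Efin.
rewrite EE lee_fin.
(* The maximiser of 2 lam - lam^2 N, with value 1 / N. *)
pose lam := N^-1.
have lam0 : 0 < lam by rewrite invr_gt0.
have key eta : 0 < eta -> 2 * lam * (1 - eta) - lam ^+ 2 * N - eta <= (1 + eta) * Er + eta.
  move=> eta0.
  (* This sum gathers the coefficients of [eps] from the arcs and from the gluing; with eps = eta /
     A these errors total [eta]. *)
  have A0 : 0 < lam / (2 * al * eta) * (2 / r) + (1 + eta^-1) * (4 * ((1 + e^-1 ^+ 2) * 6)).
    rewrite ltr_pwDl//; first by rewrite !mulr_gt0 ?invr_gt0 ?mulr_gt0.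
    by rewrite !mulr_ge0 ?addr_ge0 ?invr_ge0 ?sqr_ge0// ltW.
  set A := (_ + _) in A0.
  pose eps := eta / A.
  have eps0 : 0 < eps by rewrite divr_gt0.
  have [k [k1 k2 k3 k4 [k5 k6 k7 k8]]] : exists k, [/\
      (normL2_sq G (u k \- U)%R <= eps%:E)%E, (normL2_sq G (v k \- U)%R <= eps%:E)%E,
      (normL2_sq G (dx1 (u k) \- g1)%R <= eps%:E)%E, (normL2_sq G (dx1 (v k) \- g1)%R <= eps%:E)%E &
      [/\ (normL2_sq G (dx2 (u k) \- g2)%R <= eps%:E)%E, (normL2_sq G (dx2 (v k) \- g2)%R <= eps%:E)%E,
      (normL2_arc_sq (ctr_plus e) r (S_plus rho e) (fun x => (u k x - 1)%R) <= eps%:E)%E &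
      (normL2_arc_sq (ctr_minus e) r (S_minus rho e) (fun x => (v k x - 0)%R) <= eps%:E)%E]].
    have f1 := cvge0_near_le eps0 u0; have f2 := cvge0_near_le eps0 v0.
    have f3 := cvge0_near_le eps0 u1; have f4 := cvge0_near_le eps0 v1.
    have f5 := cvge0_near_le eps0 u2; have f6 := cvge0_near_le eps0 v2.
    have f7 := cvge0_near_le eps0 uS; have f8 := cvge0_near_le eps0 vS.
    have [k [h1 [h2 [h3 [h4 [h5 [h6 [h7 h8]]]]]]]] := filter_ex
      (filterI f1 (filterI f2 (filterI f3 (filterI f4 (filterI f5 (filterI f6 (filterI f7 f8))))))).
    by exists k; split; [exact: h1|exact: h2|exact: h3|exact: h4|split; [exact: h5|exact: h6|exact: h7|exact: h8]].
  have gE : (\int[area R]_(x in G) (g1 x ^+ 2 + g2 x ^+ 2)%:E <= Er%:E)%E by rewrite -EE.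
  have [z [Cz zu zv zE]] := splice_energy (Cu k) (Cv k) U2 g12 g22 eta0 gE k1 k2 k3 k4 k5 k6.
  have cu : continuous (u k) by case: (Cu k).
  have cv : continuous (v k) by case: (Cv k).
  have zp : (\int[mu]_(m in `[(- M)%R, M]) ((z (ray_end rho e 1 m) - 1) ^+ 2 / (1 + m ^+ 2))%:E <= (eps / r)%:E)%E.
    have := le_trans (ray_end_plus_le 1 cu) k7.
    rewrite -lee_pdivlMl// -EFinM mulrC; apply: le_trans.
    rewrite le_eqVlt; apply/orP; left; apply/eqP; apply: eq_integral => m _.
    by rewrite zu// /ray_end/= mul1r lerDl ltW// end_height_gt0.
  have zm : (\int[mu]_(m in `[(- M)%R, M]) ((z (ray_end rho e (-1) m)) ^+ 2 / (1 + m ^+ 2))%:E <= (eps / r)%:E)%E.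
    have := le_trans (ray_end_minus_le 0 cv) k8.
    rewrite -lee_pdivlMl// -EFinM mulrC; apply: le_trans.
    rewrite le_eqVlt; apply/orP; left; apply/eqP; apply: eq_integral => m _.
    by rewrite subr0 zv// /ray_end/= mulN1r lerN2 lerDl ltW// end_height_gt0.
  have := energy_ge Cz lam0 eta0 zp zm zE.
  have -> : lam / (2 * al * eta) * (eps / r + eps / r) = eps * (lam / (2 * al * eta) * (2 / r)) by ring.
  have -> : (1 + eta^-1) * (4 * ((1 + e^-1 ^+ 2) * (6 * eps))) = eps * ((1 + eta^-1) * (4 * ((1 + e^-1 ^+ 2) * 6))) by ring.
  have E1 : eps * A = eta by rewrite divfK// gt_eqF.
  move: E1; rewrite {1}/A mulrDr -/N => E1; lra.
have lN : lam ^+ 2 * N = lam by rewrite /lam expr2 mulrVK ?unitfE ?gt_eqF// mulVr.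
rewrite -/lam leNgt; apply/negP => Elam.
(* By [key], lam - Er <= eta * K; the choice of [eta] makes the right side half of the left one,
   which is positive. *)
pose K := 2 * lam + Er + 2.
have K0 : 0 < K by rewrite /K; move: lam0 Er0; lra.
pose eta := (lam - Er) / (2 * K).
have eta0 : 0 < eta by rewrite divr_gt0 ?subr_gt0// mulr_gt0.
have := key _ eta0; rewrite lN.
have : eta * K = (lam - Er) / 2 by rewrite /eta; field; rewrite gt_eqF.
rewrite /K; move: Elam; lra.
Qed.

End capacity_lower.

(** * Upper bound *)

Section smooth_functions.
Context {R : realType}.
Local Notation mu := (@lebesgue_measure R).
Implicit Types (f F U phi : plane R -> R) (G : set (plane R)).

Definition box (K : R) : set (plane R) := `[- K, K]%classic `*` `[- K, K]%classic.

Lemma measurable_box K : measurable (box K).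
Proof. by apply: measurableX; exact: measurable_itv. Qed.

Lemma area_rectangle (a b : R) : 0 < a -> 0 < b ->
  area R (`[- a, a]%classic `*` `[- b, b]%classic) = (2 * a * (2 * b))%:E.
Proof.
move=> a0 b0; rewrite product_measure1E//.
have muE (K : R) : 0 < K -> mu `[- K, K]%classic = (2 * K)%:E.
  move=> K0; rewrite lebesgue_measure_itv/= lte_fin ifT; last by lra.
  by rewrite -EFinB; congr EFin; ring.
by transitivity (mu `[(- a)%R, a%R]%classic * mu `[(- b)%R, b%R]%classic)%E => //; rewrite !muE.
Qed.

Lemma area_box K : 0 < K -> area R (box K) = ((2 * K) ^+ 2)%:E.
Proof. by move=> K0; rewrite area_rectangle. Qed.

Lemma integrable_bounded_set f (A : set (plane R)) K : 0 < K -> continuous f ->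
  measurable A -> A `<=` box K -> (area R).-integrable A (EFin \o f).
Proof.
move=> K0 cf mA AK; apply: measurable_bounded_integrable => //.
- apply: (@le_lt_trans _ _ (area R (box K))); last by rewrite area_box// ltry.
  by apply: le_measure; rewrite ?inE//; exact: measurable_box.
- by apply: measurable_funTS; exact: continuous_measurable_plane.
- have cK : compact (box K) by apply: compact_setX; exact: segment_compact.
  have /compact_bounded[N [_ NP]] := continuous_compact (continuous_subspaceT cf) cK.
  exists N; split; first by rewrite num_real.
  by move=> M NM x Ax; apply: (NP _ NM); exists x => //; exact: AK.
Qed.

Definition supported_in (K : R) F := forall x, F x != 0 -> `|x.1| < K /\ `|x.2| < K.

Lemma supported_eq0 K F x : supported_in K F -> K <= `|x.1| \/ K <= `|x.2| -> F x = 0.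
Proof.
move=> FK xK; apply/eqP; apply/negPn/negP => /FK[]; rewrite !ltNge.
by case: xK => ->.
Qed.

Lemma dx1_supported K F x : supported_in K F -> ~ box K x -> dx1 F x = 0.
Proof.
move=> FK; case: x => x y; rewrite /box /= !in_itv/= -!ler_norml => xK.
rewrite /dx1 (near_eq_derive (g := cst 0)) ?derive_cst//.
have [xK1|xK1] := leP `|x| K.
  have {}xK : K < `|y| by rewrite ltNge; apply/negP => yK; apply: xK.
  have : nbhs (x, y) [set z : plane R | K < `|z.2|].
    by apply: open_nbhs_nbhs; split => //; apply: open_gt_fun; cont.
  by apply: filterS => z /= zK; apply: (supported_eq0 FK); right; exact: ltW.
have : nbhs (x, y) [set z : plane R | K < `|z.1|].
  by apply: open_nbhs_nbhs; split => //; apply: open_gt_fun; cont.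
by apply: filterS => z /= zK; apply: (supported_eq0 FK); left; exact: ltW.
Qed.

Lemma dx2_supported K F x : supported_in K F -> ~ box K x -> dx2 F x = 0.
Proof.
move=> FK; case: x => x y; rewrite /box /= !in_itv/= -!ler_norml => xK.
rewrite /dx2 (near_eq_derive (g := cst 0)) ?derive_cst//.
have [xK1|xK1] := leP `|x| K.
  have {}xK : K < `|y| by rewrite ltNge; apply/negP => yK; apply: xK.
  have : nbhs (x, y) [set z : plane R | K < `|z.2|].
    by apply: open_nbhs_nbhs; split => //; apply: open_gt_fun; cont.
  by apply: filterS => z /= zK; apply: (supported_eq0 FK); right; exact: ltW.
have : nbhs (x, y) [set z : plane R | K < `|z.1|].
  by apply: open_nbhs_nbhs; split => //; apply: open_gt_fun; cont.
by apply: filterS => z /= zK; apply: (supported_eq0 FK); left; exact: ltW.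
Qed.

Lemma integrable_supported f K : 0 < K -> continuous f -> (forall x, ~ box K x -> f x = 0) ->
  (area R).-integrable setT (EFin \o f).
Proof.
move=> K0 cf fK.
have -> : EFin \o f = (EFin \o f) \_ (box K).
  by apply/funext => x; rewrite patchE; case: ifPn => //; rewrite notin_setE => /fK /= ->.
have i := integrable_bounded_set K0 cf (measurable_box K) (@subset_refl _ _).
have [+ _] := @integrable_mkcond _ _ _ (area R) (box K) (EFin \o f) (measurable_box K).
exact.
Qed.

Lemma integral_supported_derivative (h dh : R -> R) K : 0 < K ->
  (forall x : R, is_derive x 1 h (dh x)) -> continuous dh -> (forall x, K < `|x| -> dh x = 0) ->
  h K = 0 -> h (- K) = 0 -> (\int[mu]_x (dh x)%:E = 0)%E.
Proof.
move=> K0 dP cdh dh0 hK hNK.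
have -> : (fun x => (dh x)%:E) = (fun x => (dh x)%:E) \_ `[- K, K].
  apply/funext => x; rewrite patchE; case: ifPn => //.
  by rewrite notin_setE /= in_itv/= -ler_norml => /negP; rewrite -ltNge => /dh0 ->.
rewrite -integral_mkcond.
have ch : continuous h by move=> x; apply: differentiable_continuous; apply/derivable1_diffP; case: (dP x).
rewrite (continuous_FTC2 (F := h)); first by rewrite hK hNK subee.
- by lra.
- exact: continuous_subspaceT.
- split => [x _||]; first by case: (dP x).
  + exact/cvg_at_right_filter/ch.
  + exact/cvg_at_left_filter/ch.
- by move=> x _; rewrite derive1E; apply: derive_val.
Qed.

(** Fubini, and the fundamental theorem of calculus on each horizontal line. Applied to a product
    [U * phi], it is the integration by parts behind the weak gradient. *)
Lemma integral_dx1_eq0 F K : 0 < K -> Ck 1 F -> supported_in K F ->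
  (\int[area R]_x (dx1 F x)%:E = 0)%E.
Proof.
move=> K0 CF FK; have [_ _ c1 _] := CF; rewrite /= in c1.
have iF : (area R).-integrable setT (EFin \o dx1 F).
  by apply: (integrable_supported K0 c1) => x; exact: dx1_supported.
rewrite -(integral21_prod_meas1 iF) /fubini_G /=.
apply: integral0_eq => y _.
apply: (@integral_supported_derivative (fun x => F (x, y)) (fun x => dx1 F (x, y)) K K0).
- by move=> x; exact: Ck1_dx1.
- by apply: continuous_compose_pair => //; cont.
- by move=> x xK; apply: (dx1_supported FK); rewrite /box/= !in_itv/= -!ler_norml; rewrite leNgt xK => -[].
- by apply: (supported_eq0 FK); left; rewrite /= gtr0_norm ?lexx.
- by apply: (supported_eq0 FK); left; rewrite /= normrN gtr0_norm ?lexx.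
Qed.

Lemma integral_dx2_eq0 F K : 0 < K -> Ck 1 F -> supported_in K F ->
  (\int[area R]_x (dx2 F x)%:E = 0)%E.
Proof.
move=> K0 CF FK; have [_ _ _ c2] := CF; rewrite /= in c2.
have iF : (area R).-integrable setT (EFin \o dx2 F).
  by apply: (integrable_supported K0 c2) => x; exact: dx2_supported.
rewrite -(integral12_prod_meas1 iF) /fubini_F /=.
apply: integral0_eq => x _.
apply: (@integral_supported_derivative (fun y => F (x, y)) (fun y => dx2 F (x, y)) K K0).
- by move=> y; exact: Ck1_dx2.
- by apply: continuous_compose_pair => //; cont.
- by move=> y yK; apply: (dx2_supported FK); rewrite /box/= !in_itv/= -!ler_norml; rewrite [`|y| <= K]leNgt yK => -[].
- by apply: (supported_eq0 FK); right; rewrite /= gtr0_norm ?lexx.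
- by apply: (supported_eq0 FK); right; rewrite /= normrN gtr0_norm ?lexx.
Qed.

Lemma Ck1_mul f F : Ck 1 f -> Ck 1 F ->
  [/\ Ck 1 (fun x => f x * F x),
      dx1 (fun x => f x * F x) = (fun x => f x * dx1 F x + dx1 f x * F x) &
      dx2 (fun x => f x * F x) = (fun x => f x * dx2 F x + dx2 f x * F x)].
Proof.
move=> Cf CF; have [cf _ cf1 cf2] := Cf; have [cF _ cF1 cF2] := CF; rewrite /= in cf1 cf2 cF1 cF2.
apply: Ck1_intro.
- move=> x y; have h1 := Ck1_dx1 Cf x y; have h2 := Ck1_dx1 CF x y.
  by apply: is_derive_eq; rewrite /GRing.scale/=; ring.
- move=> x y; have h1 := Ck1_dx2 Cf x y; have h2 := Ck1_dx2 CF x y.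
  by apply: is_derive_eq; rewrite /GRing.scale/=; ring.
- exact: continuous_mul.
- exact: (continuous_add (continuous_mul cf cF1) (continuous_mul cf1 cF)).
- exact: (continuous_add (continuous_mul cf cF2) (continuous_mul cf2 cF)).
Qed.

Lemma test_function_supported G phi : test_function G phi ->
  exists2 K, 0 < K & supported_in K phi.
Proof.
move=> [_ /compact_bounded[N [_ NP]] _].
exists (`|N| + 1); first by rewrite ltr_pwDr.
move=> x px.
have : `|x| <= `|N| + 1 / 2.
  apply: NP; last by apply: subset_closure.
  by have := ler_norm N; lra.
rewrite prod_normE ge_max => /andP[h1 h2]; split; lra.
Qed.

Lemma test_function_Ck1 G phi : test_function G phi -> Ck 1 phi.
Proof. by move=> [/(_ 1%N)]. Qed.

Lemma test_function_out G phi x : test_function G phi -> ~ G x ->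
  [/\ phi x = 0, dx1 phi x = 0 & dx2 phi x = 0].
Proof.
move=> [_ _ sG] nGx.
have : nbhs x (~` closure [set x | phi x != 0]).
  apply: open_nbhs_nbhs; split; first by rewrite openC; exact: closed_closure.
  by move=> /sG.
move=> nx.
have p0 : \near x, phi x = 0.
  apply: filterS nx => y ny; apply/eqP; apply/negPn/negP => py; apply: ny; exact: subset_closure.
split; first exact: nbhs_singleton p0.
- by rewrite /dx1 (near_eq_derive (g := cst 0)) ?derive_cst.
- by rewrite /dx2 (near_eq_derive (g := cst 0)) ?derive_cst.
Qed.

(** The identity of [H1_grad] lives in the extended reals, where a term can be moved across only
    once both integrals are known to be finite. *)
Lemma integral_test_eq (G : set (plane R)) (f h : plane R -> R) K : 0 < K ->
  continuous f -> continuous h ->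
  (forall x, ~ box K x -> f x = 0) -> (forall x, ~ box K x -> h x = 0) ->
  (forall x, ~ G x -> f x = 0) -> (forall x, ~ G x -> h x = 0) ->
  (\int[area R]_x (f x + h x)%:E = 0)%E ->
  (\int[area R]_(x in G) (f x)%:E = - \int[area R]_(x in G) (h x)%:E)%E.
Proof.
move=> K0 cf ch fK hK fG hG fh.
have mk (g : plane R -> R) : (forall x, ~ G x -> g x = 0) ->
    (\int[area R]_(x in G) (g x)%:E = \int[area R]_x (g x)%:E)%E.
  move=> gG; rewrite integral_mkcond; apply: eq_integral => x _.
  by rewrite patchE; case: ifPn => //; rewrite notin_setE => /gG ->.
rewrite !mk//.
have i1 := integrable_supported K0 cf fK; have i2 := integrable_supported K0 ch hK.
move: fh; under eq_integral do rewrite EFinD.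
rewrite integralD//.
have := integrable_fin_num measurableT i1; have := integrable_fin_num measurableT i2.
rewrite /comp; case: (\int[area R]_x (f x)%:E)%E => // a; case: (\int[area R]_x (h x)%:E)%E => // b _ _.
by rewrite -EFinD => -[/eqP]; rewrite addr_eq0 => /eqP ->.
Qed.

(** Test functions vanish with their derivatives outside [G], so the integrals extend to the plane,
    where [U * phi] has bounded support. *)
Lemma smooth_H1 U G K : 0 < K -> measurable G -> G `<=` box K -> Ck 1 U ->
  H1_grad G U (dx1 U) (dx2 U).
Proof.
move=> K0 mG GK CU; have [cU _ cU1 cU2] := CU; rewrite /= in cU1 cU2.
have L2 f : continuous f -> in_L2 G f.
  move=> cf; split; first by apply: measurable_funTS; exact: continuous_measurable_plane.
  have := integrable_bounded_set K0 (@continuous_exprn _ _ _ 2 cf) mG GK.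
  by move=> /integrable_lty; exact.
split; [exact: (L2 _ cU)|exact: (L2 _ cU1)|exact: (L2 _ cU2)|].
move=> phi tphi; have Cp := test_function_Ck1 tphi.
have [cp _ cp1 cp2] := Cp; rewrite /= in cp1 cp2.
have [L L0 sp] := test_function_supported tphi.
have [CM M1 M2] := Ck1_mul CU Cp.
have sM : supported_in L (fun x => U x * phi x).
  by move=> x; rewrite mulf_eq0 negb_or => /andP[_]; exact: sp.
have out x := @test_function_out G phi x tphi.
have sphi x : ~ box L x -> phi x = 0.
  rewrite /box /= !in_itv/= -!ler_norml => nb; apply: (supported_eq0 sp).
  have [h|h] := leP `|x.1| L; last by left; exact: ltW.
  by right; apply: ltW; rewrite ltNge; apply/negP => h'; apply: nb.
split; apply: (integral_test_eq L0).
- exact: (continuous_mul cU cp1).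
- exact: (continuous_mul cU1 cp).
- by move=> x nb; rewrite (dx1_supported sp nb) mulr0.
- by move=> x nb; rewrite sphi// mulr0.
- by move=> x /out[_ -> _]; rewrite mulr0.
- by move=> x /out[-> _ _]; rewrite mulr0.
- by rewrite -(integral_dx1_eq0 L0 CM sM) M1.
- exact: (continuous_mul cU cp2).
- exact: (continuous_mul cU2 cp).
- by move=> x nb; rewrite (dx2_supported sp nb) mulr0.
- by move=> x nb; rewrite sphi// mulr0.
- by move=> x /out[_ _ ->]; rewrite mulr0.
- by move=> x /out[-> _ _]; rewrite mulr0.
- by rewrite -(integral_dx2_eq0 L0 CM sM) M2.
Qed.

End smooth_functions.

(** * The truncated logarithm and its energy in a half disc *)

Section radial.
Context {R : realType}.
Local Notation mu := (@lebesgue_measure R).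

Lemma ln_leB1 (x : R) : 0 < x -> ln x <= x - 1.
Proof.
by move=> x0; have := @le_ln1Dx R (x - 1); rewrite [1 + _]addrC subrK ltrBrDr addNr => /(_ x0).
Qed.

Lemma integral_inv1Dsqr_setT : (\int[mu]_m ((1 + m ^+ 2)^-1)%:E = (pi : R)%:E)%E.
Proof.
have D1 (m : R) : 0 < 1 + m ^+ 2 by rewrite ltr_wpDr ?sqr_ge0.
have ci : continuous (fun m : R => (1 + m ^+ 2)^-1).
  by apply: continuous_inv; [move=> m; rewrite gt_eqF|cont].
rewrite ge0_symfun_integralT//; first last.
- by move=> m /=; rewrite sqrrN.
- by move=> m; rewrite invr_ge0 ltW.
rewrite (_ : [set x : R | 0 <= x] = `[0, +oo[%classic); last first.
  by apply/seteqP; split => x /=; rewrite in_itv/= andbT.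
rewrite (ge0_continuous_FTC2y (F := atan) (l := pi / 2)).
- by rewrite atan0 sube0 -EFinM; congr EFin; field.
- by move=> x _; rewrite invr_ge0 ltW.
- exact: continuous_subspaceT.
- exact: cvgy_atan.
- by move=> x _; exact: derivable_atan.
- exact/cvg_at_right_filter/continuous_atan.
- by move=> x _; rewrite derive1_atan.
Qed.

Variable v0 : R.
Hypothesis v0_gt0 : 0 < v0.

(** The variable is a squared distance, which avoids a square root at the centre. The correction v0
    / v - 1 makes function and derivative vanish at [v0], giving a C^1 truncation of the
    logarithm. *)
Definition radial_log (v : R) : R := if v <= v0 then 0 else ln (v / v0) + v0 / v - 1.

Definition radial_slope (v : R) : R := Num.max (v - v0) 0 / (Num.max v v0) ^+ 2.

Lemma radial_slope_eq0 v : v <= v0 -> radial_slope v = 0.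
Proof. by move=> vv0; rewrite /radial_slope max_r ?mul0r// subr_le0. Qed.

Lemma radial_slopeE v : v0 < v -> radial_slope v = (v - v0) / v ^+ 2.
Proof. by move=> vv0; rewrite /radial_slope !max_l ?subr_ge0// ltW. Qed.

Lemma continuous_radial_slope : continuous radial_slope.
Proof.
apply: continuous_mul.
  move=> x; apply: (@continuous_max _ _ (fun v : R => v - v0) (cst 0)); last exact: cvg_cst.
  by apply: cvgB; [exact: cvg_id|exact: cvg_cst].
apply: continuous_inv.
  by move=> x; rewrite expf_neq0// gt_eqF// lt_max v0_gt0 orbT.
apply: continuous_exprn => x.
by apply: (@continuous_max _ _ id (cst v0)); [exact: cvg_id|exact: cvg_cst].
Qed.

(** Both sides are ln x <= x - 1, at y / v0 for the upper and at v0 / y for the lower. The quadratic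
    bound is what differentiability at [v0] rests on. *)
Lemma radial_log_bounds y : v0 < y -> 0 <= ln (y / v0) + v0 / y - 1 <= (y - v0) ^+ 2 / v0 ^+ 2.
Proof.
move=> v0y; have y0 : 0 < y by exact: lt_trans v0y.
have h1 : ln (y / v0) <= y / v0 - 1 by rewrite ln_leB1// divr_gt0.
have h2 : ln (v0 / y) <= v0 / y - 1 by rewrite ln_leB1// divr_gt0.
have E : ln (v0 / y) = - ln (y / v0) by rewrite -lnV ?posrE ?divr_gt0// invf_div.
apply/andP; split; first by rewrite E in h2; lra.
apply: (@le_trans _ _ ((y - v0) ^+ 2 / (y * v0))).
  have -> : (y - v0) ^+ 2 / (y * v0) = y / v0 - 1 + v0 / y - 1 by field; rewrite !gt_eqF.
  lra.
by rewrite ler_wpM2l ?sqr_ge0// lef_pV2 ?posrE ?exprn_gt0 ?mulr_gt0// expr2 ler_pM2r// ltW.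
Qed.

Lemma is_derive_radial_log (v : R) : is_derive v 1 radial_log (radial_slope v).
Proof.
have [vv0|vv0] := leP v v0.
  rewrite radial_slope_eq0//; apply: (@is_derive_quadratic _ _ _ _ (v0 ^+ 2)^-1) => y.
  rewrite mulr0 subr0 {2}/radial_log vv0 subr0 /radial_log.
  have c0 : 0 <= (v0 ^+ 2)^-1 by rewrite invr_ge0 sqr_ge0.
  case: ifPn => [_|]; first by rewrite normr0 mulr_ge0 ?sqr_ge0.
  rewrite -ltNge => yv; have /andP[h1 h2] := radial_log_bounds yv.
  rewrite ger0_norm//; apply: (le_trans h2); rewrite mulrC ler_wpM2l//.
  by rewrite lerXn2r ?nnegrE ?subr_ge0 ?lerD2l ?lerN2// ltW// (le_lt_trans vv0).
have v00 : 0 < v by exact: lt_trans vv0.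
have d1 : is_derive v 1 (fun t => ln (t / v0) + v0 / t - 1) (radial_slope v).
  have h1 : is_derive (v / v0) 1 (@ln R) (v / v0)^-1 by apply: is_derive1_ln; exact: divr_gt0.
  have h2 : is_derive v 1 (fun t : R => t / v0) v0^-1.
    by apply: is_derive_eq; rewrite /GRing.scale/= mulr1 mulr0 add0r.
  have h3 := @is_derive1_comp R (@ln R) (fun t => t / v0) v _ _ h1 h2.
  have h4 : is_derive v 1 (fun t : R => t^-1) (- v ^- 2).
    have vn0 : v != 0 by rewrite gt_eqF.
    by have := @is_deriveV R id v 1 1 vn0 (is_derive_id v 1); rewrite [_ *: _]mulr1.
  rewrite radial_slopeE//; apply: is_derive_eq; rewrite /GRing.scale/=.
  by field; rewrite !gt_eqF.
apply: near_eq_is_derive d1.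
have : nbhs v [set t | v0 < t].
  by apply: open_nbhs_nbhs; split => //; apply: open_gt_fun; cont.
by apply: filterS => t /= vt; rewrite /radial_log leNgt vt.
Qed.

Lemma continuous_radial_log : continuous radial_log.
Proof.
by move=> v; apply: differentiable_continuous; apply/derivable1_diffP; case: (is_derive_radial_log v).
Qed.

Definition sqr_dist (b : R) (x : plane R) : R := x.1 ^+ 2 + (x.2 - b) ^+ 2.

Lemma Ck1_radial (b al be : R) (f := fun x => al + be * radial_log (sqr_dist b x)) :
  [/\ Ck 1 f,
      dx1 f = (fun x => be * (radial_slope (sqr_dist b x) * (2 * x.1))) &
      dx2 f = (fun x => be * (radial_slope (sqr_dist b x) * (2 * (x.2 - b))))].
Proof.
have cs : continuous (sqr_dist b) by rewrite /sqr_dist; cont.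
have ck := continuous_compose continuous_radial_log cs.
have cd := continuous_compose continuous_radial_slope cs.
apply: Ck1_intro.
- move=> x y.
  have h1 : is_derive x 1 (fun t => sqr_dist b (t, y)) (2 * x).
    by rewrite /sqr_dist/=; apply: is_derive_eq; rewrite /GRing.scale/=; ring.
  have := @is_derive1_comp R radial_log _ x _ _ (is_derive_radial_log _) h1.
  by rewrite /f /comp /= => h2; apply: is_derive_eq; rewrite /GRing.scale/=; ring.
- move=> x y.
  have h1 : is_derive y 1 (fun t => sqr_dist b (x, t)) (2 * (y - b)).
    by rewrite /sqr_dist/=; apply: is_derive_eq; rewrite /GRing.scale/=; ring.
  have := @is_derive1_comp R radial_log _ y _ _ (is_derive_radial_log _) h1.
  by rewrite /f /comp /= => h2; apply: is_derive_eq; rewrite /GRing.scale/=; ring.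
- rewrite /f; apply: (@continuous_add _ _ (cst al)); first exact: cst_continuous.
  by apply: (@continuous_mul _ _ (cst be)); first exact: cst_continuous.
- apply: (@continuous_mul _ _ (cst be)); first exact: cst_continuous.
  by apply: continuous_mul => //; cont.
- apply: (@continuous_mul _ _ (cst be)); first exact: cst_continuous.
  by apply: continuous_mul => //; cont.
Qed.

(** The squared gradient of [radial_log] composed with [sqr_dist b], as a function of the value v of
    [sqr_dist b]. *)
Definition radial_density (v : R) : R := 4 * (v * radial_slope v ^+ 2).

Lemma radial_density_eq0 v : v <= v0 -> radial_density v = 0.
Proof. by move=> h; rewrite /radial_density radial_slope_eq0// expr0n/= !mulr0. Qed.

Lemma radial_density_le v : v0 < v -> 0 <= radial_density v <= 4 / v.
Proof.
move=> vv0; have v00 : 0 < v by exact: lt_trans vv0.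
rewrite /radial_density radial_slopeE//; apply/andP; split.
  by apply: mulr_ge0 => //; apply: mulr_ge0; [exact: ltW|exact: sqr_ge0].
rewrite ler_pM2l//.
have -> : v^-1 = v * (v / v ^+ 2) ^+ 2 by field; rewrite gt_eqF.
rewrite ler_pM2l// lerXn2r ?nnegrE ?divr_ge0 ?sqr_ge0 ?subr_ge0 ?ltW//.
by rewrite ltr_pM2r ?invr_gt0 ?exprn_gt0//; move: (v0_gt0); lra.
Qed.

Lemma continuous_radial_density : continuous radial_density.
Proof.
rewrite /radial_density; have c := continuous_radial_slope; cont.
Qed.

End radial.

Section half_disc_energy.
Context {R : realType}.
Local Notation mu := (@lebesgue_measure R).
Variables (rho e q s : R).
Let r := rho / 2.
Hypotheses (rho0 : 0 < rho) (q0 : 0 < q) (qr : q < r) (sE : s = 1 \/ s = -1).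

(** With density at most 4 / v, v = y^2 (1 + m^2) and Jacobian [y], each ray contributes at most 4
    ln (r / q) / (1 + m^2), and 1 / (1 + m^2) has integral pi over all slopes. *)
Lemma half_disc_energy :
  (\int[area R]_(x in closed_half_disc rho e s)
     (radial_density (q ^+ 2) (sqr_dist (s * e) x))%:E <= (4 * pi * ln (r / q))%:E)%E.
Proof.
have r0 : 0 < r by exact: divr_gt0.
have q20 : 0 < q ^+ 2 by exact: exprn_gt0.
have D1 (m : R) : 0 < 1 + m ^+ 2 by rewrite ltr_wpDr ?sqr_ge0.
have L0 : 0 < ln (r / q) by rewrite ln_gt0// ltr_pdivlMr// mul1r.
have rd0 v : 0 <= radial_density (q ^+ 2) v.
  have [h|h] := leP v (q ^+ 2); first by rewrite radial_density_eq0.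
  by have /andP[] := radial_density_le q20 h.
have ns : `|s| = 1 by case: sE => ->; rewrite ?normrN normr1.
have ss : s * s = 1 by case: sE => ->; rewrite ?mulrNN mulr1.
pose f (x : plane R) := radial_density (q ^+ 2) (sqr_dist (s * e) x).
have cf : continuous f.
  have cs : continuous (sqr_dist (s * e)) by rewrite /sqr_dist; cont.
  exact: (continuous_compose (continuous_radial_density q20) cs).
pose H := (fun x => (f x)%:E) \_ (closed_half_disc rho e s).
have mHD : measurable (closed_half_disc rho e s).
  by apply: closed_measurable_plane; exact: closed_closed_half_disc.
have mH : measurable_fun setT H.
  have mf : measurable_fun setT (fun x => (f x)%:E).
    by apply/measurable_EFinP; exact: continuous_measurable_plane.
  exact: (measurable_restrictT _ mHD).1 (measurable_funTS mf).
have H0 x : (0 <= H x)%E by rewrite /H patchE; case: ifP => // _; rewrite lee_fin rd0.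
rewrite integral_mkcond (ge0_integral_slope (s * e) ns mH H0).
apply: (@le_trans _ _ (\int[mu]_m ((4 * ln (r / q))%:E * ((1 + m ^+ 2)^-1)%:E))%E); last first.
  rewrite ge0_integralZl//.
  - by rewrite integral_inv1Dsqr_setT -EFinM lee_fin; lra.
  - apply/measurable_EFinP; apply: continuous_measurable_fun.
    by apply: continuous_inv; [move=> m; rewrite gt_eqF|cont].
  - by move=> m _; rewrite lee_fin invr_ge0 ltW.
  - by rewrite lee_fin mulr_ge0// ltW.
pose K (x : plane R) := (`|x.2|%:E * H (x.1 * x.2, s * e + s * x.2)%R)%E.
have mK : measurable_fun setT K.
  apply: emeasurable_funM; first by apply/measurable_EFinP; exact: measurableT_comp.
  apply: (measurableT_comp mH); exact: measurable_affine_plane.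
have K0 x : (0 <= K x)%E by rewrite mule_ge0.
have mI := measurable_fun_integral2 mK K0.
apply: ge0_le_integral => //.
- by move=> m _; apply: integral_ge0 => y _; exact: (K0 (m, y)).
- apply: emeasurable_funM => //; apply/measurable_EFinP; apply: continuous_measurable_fun.
  by apply: continuous_inv; [move=> m; rewrite gt_eqF|cont].
move=> m _.
pose S := Num.sqrt (1 + m ^+ 2).
have S0 : 0 < S by exact: sqrt1D_gt0.
have S2 : S ^+ 2 = 1 + m ^+ 2 by rewrite sqr_sqrtr// ltW.
pose c := 4 / (1 + m ^+ 2).
have c0 : 0 < c by rewrite divr_gt0.
have qS0 : 0 < q / S by exact: divr_gt0.
have qrS : q / S < r / S by rewrite ltr_pM2r ?invr_gt0.
(* On the ray of slope [m] the density lives between distances [q] and [r] from the centre, that is,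
   between heights q / S and r / S. *)
have Kle y : (K (m, y) <= ((fun y => (c * y^-1)%:E) \_ `[(q / S)%R, (r / S)%R]) y)%E.
  rewrite [leRHS]patchE; case: ifPn => [|]; rewrite ?inE ?notin_setE /= in_itv/=.
  - move=> /andP[y1 y2].
    have y0 : 0 < y by exact: lt_le_trans y1.
    rewrite /K /H /= patchE; case: ifPn => _; last by rewrite mule0 lee_fin divr_ge0// ltW.
    rewrite gtr0_norm// -EFinM lee_fin /f.
    set v := sqr_dist _ _.
    have vE : v = y ^+ 2 * (1 + m ^+ 2) by rewrite /v /sqr_dist /= [_ + s * y]addrC addrK !exprMn [s ^+ 2]expr2 ss; ring.
    have [h|h] := leP v (q ^+ 2).
      by rewrite radial_density_eq0// mulr0 divr_ge0// ltW.
    have /andP[_ h2] := radial_density_le q20 h.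
    apply: (@le_trans _ _ (y * (4 / v))); first by rewrite ler_pM2l.
    rewrite vE /c le_eqVlt; apply/orP; left; apply/eqP.
    by field; rewrite !gt_eqF.
  - move=> yn; rewrite /K /H /= patchE; case: ifPn; last by rewrite mule0.
    rewrite inE /closed_half_disc /= mulrDr !mulrA ss !mul1r [e + y]addrC addrK => -[y0 yr].
    rewrite ger0_norm// -EFinM lee_fin /f.
    set v := sqr_dist _ _.
    have vE : v = y ^+ 2 * (1 + m ^+ 2) by rewrite /v /sqr_dist /= [_ + s * y]addrC addrK !exprMn [s ^+ 2]expr2 ss; ring.
    have [h|h] := leP v (q ^+ 2); first by rewrite radial_density_eq0// mulr0.
    exfalso; apply: yn; rewrite ler_pdivrMr// ler_pdivlMr//.
    have yS0 : 0 <= y * S by rewrite mulr_ge0// ltW.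
    apply/andP; split.
      by rewrite -ler_sqr ?nnegrE// ?(ltW q0)// exprMn S2 -vE ltW.
    rewrite -ler_sqr ?nnegrE// ?(ltW r0)// exprMn S2.
    by apply: le_trans yr; rewrite le_eqVlt; apply/orP; left; apply/eqP; ring.
have cc : {within `[q / S, r / S], continuous (fun y => c * y^-1)}.
  apply: continuous_in_subspaceT => y; rewrite inE/= in_itv/= => /andP[y1 _].
  by apply: cvgM; [exact: cvg_cst|apply: cvgV; [rewrite gt_eqF// (lt_le_trans _ y1)|exact: cvg_id]].
apply: (@le_trans _ _ (\int[mu]_(y in `[(q / S)%R, (r / S)%R]) (c * y^-1)%:E)%E).
  rewrite [leRHS]integral_mkcond; apply: ge0_le_integral => //.
  - by move=> y _; exact: (K0 (m, y)).
  - have mm : measurable_fun setT (fun y : R => (m, y)) by exact: measurable_pair1.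
    exact: (measurableT_comp mK mm).
  - have mc : measurable_fun `[q / S, r / S] (fun y : R => (c * y^-1)%:E).
      by apply/measurable_EFinP; exact: subspace_continuous_measurable_fun.
    exact: (measurable_restrictT _ (measurable_itv _)).1 mc.
  - by move=> y _; exact: Kle.
have dl (y : R) : 0 < y -> is_derive y 1 (fun y => c * ln y) (c * y^-1).
  by move=> y0; have h := is_derive1_ln y0; apply: is_derive_eq; rewrite /GRing.scale/=; ring.
have cl (y : R) : 0 < y -> {for y, continuous (fun y => c * ln y)}.
  by move=> y0; apply: differentiable_continuous; apply/derivable1_diffP; case: (dl y y0).
rewrite (continuous_FTC2 (F := fun y => c * ln y) qrS cc).
- rewrite -EFinB lee_fin -mulrBr -ln_div ?posrE ?divr_gt0//.
  have -> : r / S / (q / S) = r / q by field; rewrite !gt_eqF.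
  by rewrite /c; lra.
- split => [y||].
  + rewrite in_itv/= => /andP[y1 _]; have y0 : 0 < y by exact: lt_trans y1.
    by case: (dl y y0).
  + by apply: cvg_at_right_filter; exact: cl.
  + by apply: cvg_at_left_filter; apply: cl; rewrite divr_gt0.
- move=> y; rewrite in_itv/= => /andP[y1 _]; have y0 : 0 < y by exact: lt_trans y1.
  by rewrite derive1E; have := dl y y0 => h; apply: derive_val.
Qed.

End half_disc_energy.

(** * The trial function *)

Section capacity_upper.
Context {R : realType}.

Lemma ge0_integral_plane_setU_le (f : plane R -> \bar R) (A B : set (plane R)) :
  measurable_fun setT f -> (forall x, 0 <= f x)%E -> measurable A -> measurable B ->
  (\int[area R]_(x in A `|` B) f x <=
   \int[area R]_(x in A) f x + \int[area R]_(x in B) f x)%E.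
Proof.
move=> mf f0 mA mB.
have -> : A `|` B = A `|` (B `\` A).
  apply/seteqP; split => x /= [Ax|]; [by left| |by left|by move=> [Bx _]; right].
  by move=> Bx; case: (pselect (A x)) => Ax; [left|right].
have mBA : measurable (B `\` A) by exact: measurableD.
rewrite ge0_integral_plane_setU//; last by move=> x [? []].
by rewrite leeD2l// ge0_subset_integral_plane// => x [].
Qed.

Variables (rho d e w a : R).
Hypotheses (rho0 : 0 < rho) (d0 : 0 < d) (w0 : 0 < w) (we : w <= e).
Let r := rho / 2.
Let q := d + 2 * e.
Hypothesis qr : q < r.
Let e0 : 0 < e. Proof. exact: lt_le_trans we. Qed.
Let q0 : 0 < q. Proof. by rewrite /q; move: (d0) (e0); lra. Qed.
Let q20 : 0 < q ^+ 2. Proof. exact: exprn_gt0. Qed.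
Let kr := radial_log (q ^+ 2) (r ^+ 2).

(** Each half disc takes a potential drop [a * kr] and the channel the remaining 1 - 2 * (a * kr);
    the additive constants make the values on the arcs exactly 1 and 0. *)
Definition trial_plus (x : plane R) : R :=
  (1 - a * kr) + a * radial_log (q ^+ 2) (sqr_dist e x).
Definition trial_minus (x : plane R) : R :=
  a * kr + (- a) * radial_log (q ^+ 2) (sqr_dist (- e) x).
Definition trial (x : plane R) : R :=
  transition e w x.2 * trial_plus x + (1 - transition e w x.2) * trial_minus x.

Let slope b := fun x : plane R => radial_slope (q ^+ 2) (sqr_dist b x).

Lemma trial_Ck1 :
  [/\ Ck 1 trial,
   dx1 trial = (fun x => transition e w x.2 * (a * (slope e x * (2 * x.1))) +
      (1 - transition e w x.2) * (- a * (slope (- e) x * (2 * x.1)))) &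
   dx2 trial = (fun x => transition e w x.2 * (a * (slope e x * (2 * (x.2 - e)))) +
      (1 - transition e w x.2) * (- a * (slope (- e) x * (2 * (x.2 - (- e))))) +
      trapezoid e w x.2 * (trial_plus x - trial_minus x))].
Proof.
have [Cp p1 p2] := Ck1_radial q20 e (1 - a * kr) a.
have [Cm m1 m2] := Ck1_radial q20 (- e) (a * kr) (- a).
have [Cz z1 z2] := Ck1_splice Cp Cm (is_derive_transition e w) (@continuous_trapezoid _ e w).
split; first exact: Cz.
  by apply: (etrans z1); rewrite p1 m1.
by apply: (etrans z2); rewrite p2 m2.
Qed.

Lemma sqr_grad_trial_channel x : closed_channel d e x ->
  sqr_grad trial x <= ((1 - 2 * (a * kr)) / (2 * e - w)) ^+ 2.
Proof.
case=> /= x1 x2.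
have sd b : b = e \/ b = - e -> sqr_dist b x <= q ^+ 2.
  move=> be; have {be} : `|x.2 - b| <= 2 * e.
    by move: x2; rewrite !ler_norml => /andP[h1 h2]; case: be => ->; apply/andP; split; lra.
  move=> h; rewrite /sqr_dist -[x.1 ^+ 2]real_normK ?num_real// -[(x.2 - b) ^+ 2]real_normK ?num_real//.
  have h1 : `|x.1| ^+ 2 <= d ^+ 2 by rewrite ler_sqr ?nnegrE// ltW.
  have h2 : `|x.2 - b| ^+ 2 <= (2 * e) ^+ 2 by rewrite ler_sqr ?nnegrE// mulr_ge0// ltW.
  apply: (le_trans (lerD h1 h2)); rewrite /q -subr_ge0.
  have -> : (d + 2 * e) ^+ 2 - (d ^+ 2 + (2 * e) ^+ 2) = 4 * (d * e) by ring.
  by rewrite mulr_ge0// mulr_ge0// ltW.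
have s1 := sd e (or_introl erefl); have s2 := sd (- e) (or_intror erefl).
have [_ E1 E2] := trial_Ck1.
have k1 : radial_log (q ^+ 2) (sqr_dist e x) = 0 by rewrite /radial_log s1.
have k2 : radial_log (q ^+ 2) (sqr_dist (- e) x) = 0 by rewrite /radial_log s2.
rewrite /sqr_grad E1 E2 /slope !radial_slope_eq0// /trial_plus /trial_minus k1 k2.
have /andP[t0 t1] := trapezoid_bounds w0 we x.2.
have ew : 0 < 2 * e - w by move: (e0) (we); lra.
have -> : (1 - 2 * (a * kr)) / (2 * e - w) = (2 * e - w)^-1 * (1 - 2 * (a * kr)) by rewrite mulrC.
rewrite exprMn.
have -> : forall T k : R, (T * (a * (0 * (2 * x.1))) + (1 - T) * (- a * (0 * (2 * x.1)))) ^+ 2 +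
   (T * (a * (0 * (2 * (x.2 - e)))) + (1 - T) * (- a * (0 * (2 * (x.2 - - e)))) +
    trapezoid e w x.2 * (1 - a * k + a * 0 - (a * k + - a * 0))) ^+ 2 =
   trapezoid e w x.2 ^+ 2 * (1 - 2 * (a * k)) ^+ 2 by move=> T k; ring.
by rewrite ler_wpM2r ?sqr_ge0// ler_sqr ?nnegrE// invr_ge0 ltW.
Qed.

Lemma sqr_grad_trial_half_disc s x : s = 1 \/ s = - 1 -> closed_half_disc rho e s x ->
  sqr_grad trial x = a ^+ 2 * radial_density (q ^+ 2) (sqr_dist (s * e) x).
Proof.
move=> sE [/= x2 _]; have [_ E1 E2] := trial_Ck1.
rewrite /sqr_grad E1 E2 /slope /radial_density.
case: sE x2 => -> x2.
- have ex : e <= x.2 by move: x2; lra.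
  rewrite mul1r transition_eq1// trapezoid_eq0//; last by rewrite ger0_norm// (le_trans _ ex)// ltW.
  by rewrite /sqr_dist; ring.
- have ex : x.2 <= - e by move: x2; lra.
  rewrite mulN1r transition_eq0// trapezoid_eq0//; last first.
    by rewrite ler0_norm; [move: ex; lra|move: ex (e0); lra].
  by rewrite /sqr_dist; ring.
Qed.

Lemma trial_energy :
  (\int[area R]_(x in G0 rho d e) (sqr_grad trial x)%:E <=
   (((1 - 2 * (a * kr)) / (2 * e - w)) ^+ 2 * (4 * (d * e)) + 8 * pi * ln (r / q) * a ^+ 2)%:E)%E.
Proof.
have [Cz _ _] := trial_Ck1.
have mf : measurable_fun setT (fun x => (sqr_grad trial x)%:E).
  by apply/measurable_EFinP; apply: continuous_measurable_plane; exact: continuous_sqr_grad.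
have f0 x : (0 <= (sqr_grad trial x)%:E)%E by rewrite lee_fin sqr_grad_ge0.
have mC : measurable (closed_channel d e).
  by apply: closed_measurable_plane; exact: closed_closed_channel.
have mD s : measurable (closed_half_disc rho e s).
  by apply: closed_measurable_plane; exact: closed_closed_half_disc.
have mU := measurableU _ _ mC (mD 1).
apply: (le_trans (ge0_subset_integral_plane mf f0 (measurable_G0 _ _ _) (measurableU _ _ mU (mD (-1))) _)).
  exact: G0_subset.
apply: (le_trans (ge0_integral_plane_setU_le mf f0 mU (mD (-1)))).
apply: (le_trans (leeD2r _ (ge0_integral_plane_setU_le mf f0 mC (mD 1)))).
have hch := sqr_grad_trial_channel.
set c := _ ^+ 2 in hch *; have c0 : 0 <= c by exact: sqr_ge0.
clearbody c.
have hC : (\int[area R]_(x in closed_channel d e) (sqr_grad trial x)%:E <=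
   (c * (4 * (d * e)))%:E)%E.
  apply: (@le_trans _ _ (\int[area R]_(x in closed_channel d e)
      c%:E)%E).
    by apply: ge0_le_integral => //; exact: measurable_funTS.
  rewrite integral_cst// EFinM lee_wpmul2l ?lee_fin//.
  have -> : closed_channel d e = `[- d, d]%classic `*` `[- e, e]%classic.
    by apply/seteqP; split => x /=; rewrite /closed_channel /= !in_itv/= -!ler_norml.
  rewrite [leLHS](area_rectangle d0 e0) lee_fin; lra.
have hD s : s = 1 \/ s = -1 -> (\int[area R]_(x in closed_half_disc rho e s) (sqr_grad trial x)%:E <=
   (a ^+ 2 * (4 * pi * ln (r / q)))%:E)%E.
  move=> sE; have cs : continuous (sqr_dist (s * e)) by rewrite /sqr_dist; cont.
  have cd := continuous_compose (continuous_radial_density q20) cs.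
  have rd0 v : 0 <= radial_density (q ^+ 2) v.
    have [h|h] := leP v (q ^+ 2); first by rewrite radial_density_eq0.
    by have /andP[] := radial_density_le q20 h.
  apply: (@le_trans _ _ (\int[area R]_(x in closed_half_disc rho e s)
      ((a ^+ 2)%:E * (radial_density (q ^+ 2) (sqr_dist (s * e) x))%:E))%E).
    rewrite le_eqVlt; apply/orP; left; apply/eqP; apply: eq_integral => x.
    by rewrite inE => xD; rewrite (sqr_grad_trial_half_disc sE xD) EFinM.
  rewrite ge0_integralZl//.
  - by rewrite [leRHS]EFinM lee_wpmul2l ?lee_fin ?sqr_ge0//; exact: half_disc_energy.
  - exact: mD.
  - by apply: measurable_funTS; apply/measurable_EFinP; exact: continuous_measurable_plane.
  - by move=> x _; rewrite lee_fin.
  - by rewrite lee_fin sqr_ge0.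
apply: (le_trans (leeD (leeD hC (hD 1 (or_introl erefl))) (hD (-1) (or_intror erefl)))).
by rewrite -!EFinD lee_fin; lra.
Qed.

Lemma trace_on_arc_Ck1 (G S : set (plane R)) (U b : plane R -> R) (c : plane R) (t : R) :
  Ck 1 U -> (forall s, angles c t S s -> U (circle_pt c t s) = b (circle_pt c t s)) ->
  trace_on_arc G U (dx1 U) (dx2 U) c t S b.
Proof.
move=> CU Ub.
have n0 (f : plane R -> R) : normL2_sq G (f \- f)%R = 0%E.
  by apply: integral0_eq => x _; rewrite /= subrr expr0n.
exists (fun=> U); split => //; rewrite ?n0; try exact: cvg_cst.
rewrite (_ : normL2_arc_sq _ _ _ _ = 0%E); first exact: cvg_cst.
by apply: integral0_eq => s sS; rewrite /= Ub// subrr expr0n/= mulr0.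
Qed.

Lemma trial_trace (G := G0 rho d e) :
  trace_on_arc G trial (dx1 trial) (dx2 trial) (ctr_plus e) r (S_plus rho e) (cst 1) /\
  trace_on_arc G trial (dx1 trial) (dx2 trial) (ctr_minus e) r (S_minus rho e) (cst 0).
Proof.
have [Cz _ _] := trial_Ck1.
have r0 : 0 < r by exact: divr_gt0.
have sd c t : sqr_dist c (circle_pt (0, c) r t) = r ^+ 2.
  rewrite /sqr_dist /circle_pt /= add0r [c + _]addrC addrK !exprMn -mulrDr.
  by rewrite cos2Dsin2 mulr1.
split; apply: trace_on_arc_Ck1 => // t.
- rewrite angles_S_plus//= in_itv/= => /andP[t0 tpi].
  rewrite /trial transition_eq1//; last first.
    by rewrite /circle_pt/= lerDl mulr_ge0 ?(ltW r0)// ltW// sin_gt0_pi// t0.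
  by rewrite /trial_plus sd -/kr; ring.
- rewrite angles_S_minus//= in_itv/= => /andP[t0 tpi].
  rewrite /trial transition_eq0//; last first.
    rewrite /circle_pt/= gerDl mulr_ge0_le0 ?(ltW r0)//.
    have -> : t = (t - pi) + pi by rewrite subrK.
    by rewrite sinDpi oppr_le0 ltW// sin_gt0_pi//; move: t0 tpi; lra.
  by rewrite /trial_minus sd -/kr; ring.
Qed.

Lemma capacity_le_trial :
  (capacity rho d e <=
   (((1 - 2 * (a * kr)) / (2 * e - w)) ^+ 2 * (4 * (d * e)) + 8 * pi * ln (r / q) * a ^+ 2)%:E)%E.
Proof.
apply: le_trans trial_energy; apply: ereal_inf_lbound.
have [Cz _ _] := trial_Ck1; have [tp tm] := trial_trace.
exists trial, (dx1 trial), (dx2 trial); split => //.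
have K0 : 0 < d + e + rho by move: (d0) (e0) (rho0); lra.
apply: (smooth_H1 K0) => //; first exact: measurable_G0.
apply: subset_trans; first exact: G0_subset.
have sq (u v : R) : u ^+ 2 + v ^+ 2 <= (rho / 2) ^+ 2 -> `|u| <= rho /\ `|v| <= rho.
  move=> h; have h1 := sqr_ge0 u; have h2 := sqr_ge0 v.
  have rr : (rho / 2) ^+ 2 <= rho ^+ 2.
    by rewrite ler_sqr ?nnegrE ?divr_ge0 ?(ltW rho0)//; move: (rho0); lra.
  split; rewrite -ler_sqr ?nnegrE ?(ltW rho0)// real_normK ?num_real//; lra.
rewrite /box; move=> x [[|]|] /=; rewrite !in_itv/= -!ler_norml.
- by move=> [/= h1 h2]; move: (d0) (e0) (rho0) h1 h2; split; lra.
- move=> [/= h1 /sq[h2 h3]]; move: h1 h2 h3 (d0) (e0) (rho0).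
  by rewrite !ler_norml => h1 /andP[h2 h3] /andP[h4 h5]; split; apply/andP; split; lra.
- move=> [/= h1 /sq[h2 h3]]; move: h1 h2 h3 (d0) (e0) (rho0).
  by rewrite !ler_norml => h1 /andP[h2 h3] /andP[h4 h5]; split; apply/andP; split; lra.
Qed.

End capacity_upper.

(** * Optimal share of the potential drop *)

Section capacity_upper_bound.
Context {R : realType}.

Lemma capacity_le (rho d e w : R) (L := ln (rho / 2 / (d + 2 * e))) :
  0 < rho -> 0 < d -> 0 < w -> w <= e -> d + 2 * e < rho / 2 -> 1 < L ->
  (capacity rho d e <=
   (((2 * e - w) ^+ 2 / (4 * (d * e)) + 2 / pi * (L - 1))^-1)%:E)%E.
Proof.
move=> rho0 d0 w0 we qr L1.
(* [t], the drop in each half disc, minimises the left side; the minimum is the conductance of the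
   resistances 1 / g and P in series. *)
have alg (g P : R) : 0 < g -> 0 < P -> let t := g * P / (2 * (1 + g * P)) in
    g * (1 - 2 * t) ^+ 2 + 4 / P * t ^+ 2 = (g^-1 + P)^-1.
  move=> g0 P0; have gP : 0 < 1 + g * P by rewrite addr_gt0// mulr_gt0.
  by rewrite /=; field; rewrite !gt_eqF// mulrC.
have e0 : 0 < e by exact: lt_le_trans we.
have q0 : 0 < d + 2 * e by lra.
have r0 : 0 < rho / 2 by exact: divr_gt0.
have pi0 := pi_gt0 R.
have L0 : 0 < L by exact: lt_trans L1.
set q := d + 2 * e in qr L L1 L0 q0 *; set r := rho / 2 in qr L L1 L0 r0 *.
(* [radial_log] takes squared distances, hence 2 * L; the truncation costs at most 1. Then k^2 >= (2
   L - 1)^2 > 4 L (L - 1), the origin of L - 1 in the bound. *)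
have krE : radial_log (q ^+ 2) (r ^+ 2) = 2 * L + (q / r) ^+ 2 - 1.
  rewrite /radial_log ifF; last by apply/negbTE; rewrite -ltNge ltr_sqr ?nnegrE ?ltW.
  by rewrite -!expr_div_n lnXn ?divr_gt0// mulr_natl.
set k := radial_log _ _ in krE.
have k1 : 2 * L - 1 <= k by have := sqr_ge0 (q / r); rewrite krE; lra.
have k0 : 0 < k by lra.
have h0 : 0 < 2 * e - w by lra.
set h := 2 * e - w in h0 *.
pose g := 4 * (d * e) / h ^+ 2.
have g0 : 0 < g by rewrite divr_gt0 ?mulr_gt0 ?exprn_gt0.
pose P := k ^+ 2 / (2 * pi * L).
have P0 : 0 < P by rewrite divr_gt0 ?mulr_gt0 ?exprn_gt0.
have gP : 0 < 1 + g * P by rewrite addr_gt0// mulr_gt0.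
pose a := g * P / (2 * (1 + g * P)) / k.
have := @capacity_le_trial R rho d e w a rho0 d0 w0 we qr.
rewrite -/q -/r -/k -/L -/h => /le_trans; apply.
rewrite lee_fin.
have -> : h ^+ 2 / (4 * (d * e)) = g^-1 by rewrite /g invf_div.
have -> : ((1 - 2 * (a * k)) / h) ^+ 2 * (4 * (d * e)) + 8 * pi * L * a ^+ 2 = (g^-1 + P)^-1.
  have -> : ((1 - 2 * (a * k)) / h) ^+ 2 * (4 * (d * e)) = g * (1 - 2 * (a * k)) ^+ 2.
    by rewrite /g; field; rewrite gt_eqF.
  have ak : a * k = g * P / (2 * (1 + g * P)) by rewrite /a divfK// gt_eqF.
  have -> : 8 * pi * L * a ^+ 2 = 4 / P * (a * k) ^+ 2.
    by rewrite /P; move: (pi : R) pi0 => Pi Pi0; field; rewrite !gt_eqF.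
  by rewrite ak alg.
rewrite lef_pV2 ?posrE ?addr_gt0 ?invr_gt0//; last by rewrite mulr_gt0 ?divr_gt0// subr_gt0.
rewrite lerD2l /P.
have -> : 2 / pi * (L - 1) = (4 * L * (L - 1)) / (2 * pi * L).
  by move: (pi : R) pi0 => Pi Pi0; field; rewrite !gt_eqF.
rewrite ler_pM2r ?invr_gt0 ?mulr_gt0//.
apply: (@le_trans _ _ ((2 * L - 1) ^+ 2)); last by rewrite ler_sqr ?nnegrE//; lra.
have -> : (2 * L - 1) ^+ 2 = 4 * L * (L - 1) + 1 by ring.
lra.
Qed.

End capacity_upper_bound.

(** * Asymptotics *)

Section asymptotics.
Context {R : realType}.

(** atan x^-1 is pi / 2 - atan x, and atan x <= x. At x = rho it bounds the angle lost by
    restricting the slopes to 1 / rho. *)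
Lemma atan_inv_ge (x : R) : 0 < x -> pi / 2 - x <= atan x^-1.
Proof.
move=> x0; have b0 := atan_gt0 x0; have b1 := atan_ltpi2 x.
have -> : atan x^-1 = pi / 2 - atan x.
  rewrite -[RHS]tanK; last by rewrite in_itv/=; apply/andP; split; lra.
  rewrite /tan [pi / 2 - _]addrC sinDpihalf cosDpihalf sinN opprK cosN.
  by rewrite -[in LHS](atanK x) /tan invf_div.
rewrite lerD2l lerN2 -atan_ratioE ger_pMr//.
by have /andP[] := atan_ratio_bounds x.
Qed.

Lemma inv_dist (x y : R) : 0 < y -> `|x - y| <= y / 2 ->
  0 < x /\ `|x^-1 - y^-1| <= 2 / y ^+ 2 * `|x - y|.
Proof.
move=> y0 xy; have xy2 : y / 2 <= x by move: xy; rewrite ler_norml => /andP[h _]; lra.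
have x0 : 0 < x by apply: lt_le_trans xy2; exact: divr_gt0.
split=> //; have -> : x^-1 - y^-1 = - ((x - y) / (x * y)) by field; rewrite !gt_eqF.
rewrite normrN normrM mulrC ler_wpM2r// gtr0_norm ?invr_gt0 ?mulr_gt0//.
have -> : 2 / y ^+ 2 = (y / 2 * y)^-1 by field; rewrite gt_eqF.
by rewrite lef_pV2 ?posrE ?mulr_gt0 ?invr_gt0// ler_pM2r.
Qed.

Variables (rho d e p qinv : R).
Hypotheses (rho0 : 0 < rho) (d0 : 0 < d) (e0 : 0 < e) (p0 : 0 < p) (qinv0 : 0 <= qinv).
Hypothesis lnrho : ln rho <= - 1.
Hypothesis drho : d < rho / 2.
Let P := p_eps rho d.
Let Q := (q_eps rho d e)^-1.
Definition error_scale : R := rho * `|ln rho| + `|Q - qinv| + `|P - p|.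
(** 4 qinv + 9 + 4 / p suffices in front of rho |ln rho| in all the estimates below, and 2 / p^2 is
    the constant of [inv_dist] for passing from 1 / P to 1 / p. *)
Definition error_factor : R := 4 * qinv + 9 + 4 / p + 2 / p ^+ 2.
Let E := error_scale.
Let C := error_factor.
Let T := qinv + 2 / (pi * p).
Hypotheses (Pp : `|P - p| <= p / 2) (Qq : `|Q - qinv| <= 1).
Hypothesis Cp : C * E < (2 * p)^-1.

Let X := rho * `|ln rho|.

Let rho_half : rho <= 1 / 2.
Proof.
have h : rho <= expR (- 1) by rewrite -(@lnK R rho) ?posrE// ler_expR.
apply: (le_trans h); rewrite expRN div1r lef_pV2 ?posrE ?expR_gt0//.
by have := @expR_ge1Dx R 1; lra.
Qed.

(** Since |ln rho| >= 1, every error of order rho is absorbed in [X], hence in [error_scale]. *)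
Let rho_le_X : rho <= X.
Proof. by rewrite /X ler_peMr ?(ltW rho0)// ler0_norm; move: (lnrho); lra. Qed.

Let X_le_E : X + `|Q - qinv| + `|P - p| = E. Proof. by []. Qed.

Let P_inv : 0 < P /\ `|P^-1 - p^-1| <= 2 / p ^+ 2 * `|P - p|.
Proof. exact: inv_dist. Qed.

Let P0 : 0 < P. Proof. by case: P_inv. Qed.

Let ln_d : ln d = - (P^-1 / rho).
Proof.
have d1 : d < 1 by move: (drho) rho_half; lra.
have ld : ln d < 0 by apply: ln_lt0; rewrite d0.
rewrite /P /p_eps invfM !invrK ltr0_norm//.
by field; rewrite gt_eqF.
Qed.

Let Q_def : Q = e / d * rho.
Proof. by rewrite /Q /q_eps; field; rewrite !gt_eqF. Qed.

Let Q0 : 0 < Q. Proof. by rewrite Q_def mulr_gt0 ?divr_gt0. Qed.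

Let pi2 : 2 / pi <= 1 :> R.
Proof. by rewrite ler_pdivrMr ?pi_gt0// mul1r; exact: pi_ge2. Qed.

Let X0 : 0 <= X. Proof. by rewrite mulr_ge0// ltW. Qed.

Let CE_ge : X * (4 * qinv + 9 + 4 / p) + `|Q - qinv| + 2 / p ^+ 2 * `|P - p| <= C * E.
Proof.
have u0 : 0 < 4 / p by exact: divr_gt0.
have v0 : 0 < 2 / p ^+ 2 by rewrite divr_gt0 ?exprn_gt0.
have a0 := normr_ge0 (Q - qinv); have b0 := normr_ge0 (P - p).
rewrite -subr_ge0 /C /error_factor -X_le_E.
set u := 4 / p in u0 *; set v := 2 / p ^+ 2 in v0 *.
have -> : (4 * qinv + 9 + u + v) * (X + `|Q - qinv| + `|P - p|)
    - (X * (4 * qinv + 9 + u) + `|Q - qinv| + v * `|P - p|) =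
  X * v + `|Q - qinv| * (4 * qinv + 8 + u + v) + `|P - p| * (4 * qinv + 9 + u) by ring.
have h1 := mulr_ge0 X0 (ltW v0).
have h2 : 0 <= `|Q - qinv| * (4 * qinv + 8 + u + v).
  by apply: mulr_ge0 => //; move: (qinv0) u0 v0; lra.
have h3 : 0 <= `|P - p| * (4 * qinv + 9 + u).
  by apply: mulr_ge0 => //; move: (qinv0) u0; lra.
exact: addr_ge0 (addr_ge0 h1 h2) h3.
Qed.

Let CE_P : C * E < P^-1.
Proof.
apply: (lt_le_trans Cp); rewrite lef_pV2 ?posrE//; last exact: mulr_gt0.
by move: (Pp); rewrite ler_norml => /andP[_]; move: (p0); lra.
Qed.

(** As 1 / P = rho |ln d|, this says that |ln d| exceeds (4 qinv + 9) |ln rho|, so [d] is smaller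
    than a high power of rho. *)
Let X_P : X * (4 * qinv + 9) < P^-1.
Proof.
apply: le_lt_trans CE_P; apply: le_trans CE_ge.
have u0 : 0 <= X * (4 / p) by rewrite mulr_ge0// divr_ge0// ltW.
have v0 : 0 <= 2 / p ^+ 2 * `|P - p| by rewrite mulr_ge0// divr_ge0// sqr_ge0.
rewrite mulrDr; have := normr_ge0 (Q - qinv); lra.
Qed.

Let X_ln : X = - (rho * ln rho).
Proof. by rewrite /X ler0_norm ?mulrN//; move: (lnrho); lra. Qed.

Let Xq0 : 0 <= X * qinv. Proof. exact: mulr_ge0. Qed.

Let Pinv_rho : rho * (P^-1 / rho) = P^-1.
Proof. by rewrite mulrC divfK// gt_eqF. Qed.

(** Taking logarithms and multiplying by rho, the claim is 2 X + rho ln 8 < 1 / P. With ln 8 <= 7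
    and rho <= X the left side is at most 9 X, whence the 9 of [X_P]. *)
Lemma width_small : d < rho ^+ 2 / 8.
Proof.
rewrite -ltr_ln ?posrE ?divr_gt0 ?exprn_gt0// ln_div ?posrE ?exprn_gt0// lnXn// ln_d.
rewrite -(ltr_pM2l rho0) mulrN Pinv_rho.
have h8 : ln 8 <= 8 - 1 :> R by exact: ln_leB1.
have := ler_wpM2l (ltW rho0) h8.
rewrite mulrBr -mulr_natl mulrCA; move: X_ln rho_le_X X_P Xq0 X0; lra.
Qed.

Let al := atan rho^-1.

Let al_ge : pi / 2 - rho <= al. Proof. exact: atan_inv_ge. Qed.

Let al_half : 1 / 2 <= al.
Proof. by have := @pihalf_ge1 R; move: al_ge rho_half; lra. Qed.

Let al0 : 0 < al. Proof. by move: al_half; lra. Qed.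

Let al_le2 : al <= 2.
Proof. by have h := @pihalf_lt2 R; apply: ltW; apply: lt_trans h; exact: atan_ltpi2. Qed.

(** As al >= 1 / 2, the left side is at most 4 d / rho, which is below rho / 2 exactly when d <
    rho^2 / 8. *)
Lemma slope_range_ok : d / atan rho^-1 * Num.sqrt (1 + rho^-1 ^+ 2) < rho / 2.
Proof.
have h1 : d / al <= 2 * d by rewrite ler_pdivrMr//; have := ler_pM2l d0 (1 / 2) al; rewrite al_half; lra.
have h2 : Num.sqrt (1 + rho^-1 ^+ 2) <= 2 / rho.
  rewrite -[leRHS]ger0_norm ?divr_ge0 ?(ltW rho0)// -sqrtr_sqr ler_wsqrtr// expr_div_n exprVn.
  have : 1 <= (rho ^+ 2)^-1 by rewrite invf_ge1 ?exprn_gt0// expr_le1// ?(ltW rho0)//; move: rho_half; lra.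
  lra.
apply: (@le_lt_trans _ _ (2 * d * (2 / rho))).
  by apply: ler_pM => //; rewrite ?sqrtr_ge0// divr_ge0// ltW.
have -> : 2 * d * (2 / rho) = 4 * d / rho by field; rewrite gt_eqF.
by rewrite ltr_pdivrMr//; have := width_small; rewrite expr2; lra.
Qed.

Let N := resistance rho d e rho^-1.

Let al_arg : 1 <= al * (rho / 2) / d.
Proof.
rewrite ler_pdivlMr// mul1r.
have h := ler_pM2r (divr_gt0 rho0 (ltr0n _ 2)) (1 / 2) al; rewrite al_half in h.
have h2 := width_small.
have h3 : rho * rho <= 1 / 2 * rho by rewrite ler_pM2r.
move: h2 h; rewrite expr2; move: rho0; lra.
Qed.

Lemma resistance_gt0 : 0 < N.
Proof.
rewrite /N /resistance -/al ltr_pwDl ?divr_gt0// mulr_ge0 ?invr_ge0 ?(ltW al0)//.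
by rewrite addr_ge0// ln_ge0.
Qed.

Let Pinv_le : P^-1 <= p^-1 + 2 / p ^+ 2 * `|P - p|.
Proof. by have [_] := P_inv; rewrite ler_norml => /andP[_]; lra. Qed.

Let Pinv_ge : p^-1 - 2 / p ^+ 2 * `|P - p| <= P^-1.
Proof. by have [_] := P_inv; rewrite ler_norml => /andP[]; lra. Qed.

Let Pinv_le2 : P^-1 <= 2 / p.
Proof.
apply: (le_trans Pinv_le).
have : 2 / p ^+ 2 * `|P - p| <= 2 / p ^+ 2 * (p / 2).
  by rewrite ler_wpM2l// divr_ge0// sqr_ge0.
have -> : 2 / p ^+ 2 * (p / 2) = p^-1 by field; rewrite gt_eqF.
lra.
Qed.

Let T_E : T = qinv + 2 / pi * p^-1.
Proof. by rewrite /T invfM mulrA. Qed.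

(** rho N is Q + al^-1 (rho S). Replacing 1 / al by 2 / pi costs at most 2 rho, and rho S by 1 / P
    at most rho; then 1 / P and Q are compared with 1 / p and [qinv]. *)
Lemma resistance_le : rho * N <= T + C * E.
Proof.
have pi0 := pi_gt0 R.
pose S := 1 + ln (al * (rho / 2) / d).
have S0 : 0 <= S by rewrite addr_ge0// ln_ge0.
have S1 : rho * S <= P^-1 + rho.
  rewrite /S ln_div ?posrE ?mulr_gt0 ?divr_gt0// lnM ?posrE ?divr_gt0// ln_div ?posrE// ln_d.
  rewrite opprK !mulrDr Pinv_rho mulr1.
  have h1 : rho * ln al <= rho * ln 2 by rewrite ler_pM2l// ler_ln ?posrE.
  rewrite mulrN; move: X_ln X0; lra.
have a1 : al^-1 <= 2 / pi + 2 * rho.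
  rewrite -div1r ler_pdivrMr//.
  have h1 : rho * (2 * al) >= rho * 1 by rewrite ler_pM2l//; move: al_half; lra.
  have h2 : 2 / pi * (pi / 2 - rho) <= 2 / pi * al by rewrite ler_wpM2l// divr_ge0// ltW.
  have h3 : 2 / pi * rho <= 1 * rho by rewrite ler_pM2r.
  have h4 : 2 / pi * (pi / 2) = 1 :> R by move: (pi : R) pi0 => Pi Pi0; field; rewrite gt_eqF.
  move: h2; rewrite mulrBr h4; lra.
have -> : rho * N = Q + al^-1 * (rho * S).
  by rewrite /N /resistance -/al -/S Q_def; ring.
have h5 : al^-1 * (rho * S) <= (2 / pi + 2 * rho) * (P^-1 + rho).
  by apply: ler_pM => //; [rewrite invr_ge0 ltW|rewrite mulr_ge0// ltW].
have D0 : 0 <= 2 / p ^+ 2 * `|P - p| by rewrite mulr_ge0// divr_ge0// sqr_ge0.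
have hP := Pinv_le; set D := 2 / p ^+ 2 * `|P - p| in D0 hP *.
have c0 : 0 <= 2 / pi :> R by rewrite divr_ge0// ltW.
have h6 : 2 / pi * P^-1 <= 2 / pi * p^-1 + D.
  have := ler_wpM2l c0 hP; rewrite mulrDr.
  by have := ler_wpM2r D0 pi2; lra.
have h7 : 2 / pi * rho <= rho by rewrite ler_piMl// ltW.
have h8 : rho * P^-1 <= rho * (2 / p) by rewrite ler_pM2l.
have h9 : rho * (2 / p) <= X * (2 / p) by rewrite ler_wpM2r// divr_ge0// ltW.
have h10 : rho * rho <= rho * (1 / 2) by rewrite ler_pM2l.
have h11 := CE_ge; rewrite -/D in h11.
have h12 : Q <= qinv + `|Q - qinv| by have := ler_norm (Q - qinv); lra.
move: h5 h11; rewrite T_E.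
move: h6 h7 h8 h9 h10 h12 Xq0 rho_le_X X0; lra.
Qed.

Let L := ln (rho / 2 / (d + 2 * e)).

(** Since e = Q d / rho, the argument of the logarithm is rho^2 / (2 (rho + 2 Q)) divided by [d];
    the square of rho contributes 2 ln rho, the source of the error rho |ln rho|. *)
Let rhoL : P^-1 - X * (5 + 2 * qinv) <= rho * L.
Proof.
have q1 : Q <= qinv + 1 by move: (Qq); rewrite ler_norml => /andP[_]; lra.
have rQ0 : 0 < rho + 2 * Q by rewrite addr_gt0// mulr_gt0.
have -> : L = 2 * ln rho - ln 2 - ln (rho + 2 * Q) + P^-1 / rho.
  have -> : L = ln (rho ^+ 2 / (2 * (rho + 2 * Q)) / d).
    rewrite /L Q_def; congr ln; field; rewrite !gt_eqF//=.
      by rewrite addr_gt0// mulr_gt0.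
    by rewrite addr_gt0 ?mulr_gt0.
  rewrite ln_div ?posrE ?divr_gt0 ?exprn_gt0 ?mulr_gt0// ln_d opprK.
  rewrite ln_div ?posrE ?exprn_gt0 ?mulr_gt0// lnM ?posrE// lnXn// -[_ *+ 2]mulr_natl; lra.
have h2 : rho * ln 2 <= rho * 1 by rewrite ler_pM2l//; have := @ln_leB1 R 2; lra.
have h3 : rho * ln (rho + 2 * Q) <= rho * (2 * qinv + 2).
  by rewrite ler_pM2l//; have := ln_leB1 rQ0; move: rho_half; lra.
have h4 : rho * (2 * qinv) <= X * (2 * qinv) by rewrite ler_wpM2r// mulr_ge0.
move: X_ln rho_le_X X0 h2 h3 h4 Pinv_rho; lra.
Qed.

Lemma log_ratio_gt1 : 1 < L.
Proof.
rewrite -(ltr_pM2l rho0) mulr1; move: rhoL X_P Xq0 rho_le_X X0; rewrite !mulrDr; lra.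
Qed.

Lemma width_length_small : d + 2 * e < rho / 2.
Proof.
have q0 : 0 < d + 2 * e by move: (d0) (e0); lra.
rewrite -[ltLHS]mul1r -ltr_pdivlMr//.
have h : 0 < rho / 2 / (d + 2 * e) by rewrite !divr_gt0.
by rewrite -ltr_ln ?posrE// ln1; apply: lt_trans log_ratio_gt1.
Qed.

(** As 2 e - w = 2 e (1 - rho), smoothing multiplies the channel resistance by (1 - rho)^2 only. *)
Let w := 2 * e * rho.
Let D := (2 * e - w) ^+ 2 / (4 * (d * e)) + 2 / pi * (L - 1).

Lemma conductance_le : T - C * E <= rho * D.
Proof.
have pi0 := pi_gt0 R.
have -> : rho * D = Q * (1 - rho) ^+ 2 + 2 / pi * (rho * L - rho).
  by rewrite /D /w Q_def; move: (pi : R) pi0 => Pi Pi0; field; rewrite !gt_eqF.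
have q1 : Q <= qinv + 1 by move: (Qq); rewrite ler_norml => /andP[_]; lra.
have h1 : Q - 2 * X * (qinv + 1) <= Q * (1 - rho) ^+ 2.
  have h2 : 0 <= Q * rho ^+ 2 by rewrite mulr_ge0 ?sqr_ge0// ltW.
  have h3 : Q * rho <= (qinv + 1) * X by apply: ler_pM => //; exact: ltW.
  move: h2 h3; rewrite expr2; lra.
have c0 : 0 <= 2 / pi :> R by rewrite divr_ge0// ltW.
have D0 : 0 <= 2 / p ^+ 2 * `|P - p| by rewrite mulr_ge0// divr_ge0// sqr_ge0.
have h11 := CE_ge; have hP := Pinv_ge.
set D' := 2 / p ^+ 2 * `|P - p| in D0 hP h11 *.
have h4 : p^-1 - (D' + X * (6 + 2 * qinv)) <= rho * L - rho.
  move: rhoL hP rho_le_X; rewrite !mulrDr; lra.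
have h5 := ler_wpM2l c0 h4.
have h6 : 2 / pi * (D' + X * (6 + 2 * qinv)) <= D' + X * (6 + 2 * qinv).
  by rewrite ler_piMl// addr_ge0// mulr_ge0//; move: (qinv0); lra.
have h12 : qinv - `|Q - qinv| <= Q by have := ler_norm (- (Q - qinv)); rewrite normrN; lra.
have u0 : 0 <= X * (4 / p) by rewrite mulr_ge0// divr_ge0// ltW.
move: h5 h6 h1 h11; rewrite T_E mulrBr; rewrite !mulrDr; move: Xq0 X0 h12 u0; lra.
Qed.

Hypothesis CT : C * E <= T / 2.

(** The reciprocals of rho N and rho D enclose the capacity divided by rho, and C E <= T / 2 keeps T
    / (T - C E) within 2 C E / T of 1. *)
Lemma capacity_asymptotics :
  capacity rho d e = (fine (capacity rho d e))%:E /\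
  `|T * fine (capacity rho d e) / rho - 1| <= 2 * C / T * E.
Proof.
have T0 : 0 < T.
  by rewrite T_E ltr_wpDl// mulr_gt0 ?invr_gt0// divr_gt0// pi_gt0.
have hl := capacity_ge rho0 d0 e0 (_ : 0 < rho^-1) slope_range_ok resistance_gt0.
have {}hl : ((N^-1)%:E <= capacity rho d e)%E by apply: hl; rewrite invr_gt0.
have w0 : 0 < w by rewrite mulr_gt0// mulr_gt0.
have we : w <= e by rewrite /w mulrAC ger_pMl//; move: rho_half; lra.
have hu := capacity_le rho0 d0 w0 we width_length_small log_ratio_gt1.
rewrite -/L -/D in hu.
have fin : capacity rho d e = (fine (capacity rho d e))%:E.
  rewrite fineK// fin_numElt (lt_le_trans _ hl) ?ltNyr// (le_lt_trans hu)// ltry//.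
split => //; move: hl hu; rewrite fin !lee_fin /=; set c := fine _ => hl hu.
have CE0 : 0 <= C * E.
  rewrite mulr_ge0 ?addr_ge0 ?mulr_ge0 ?invr_ge0 ?sqr_ge0//; exact: ltW.
have N0 := resistance_gt0; have hN := resistance_le; have hD := conductance_le.
have D0 : 0 < D by rewrite -(pmulr_rgt0 _ rho0); apply: lt_le_trans hD; move: (CT) T0; lra.
have rN0 : 0 < rho * N by exact: mulr_gt0.
have rD0 : 0 < rho * D by exact: mulr_gt0.
have l1 : T / (T + C * E) <= T * c / rho.
  have -> : T * c / rho = T * (c / rho) by rewrite mulrA.
  rewrite ler_pM2l//; apply: (@le_trans _ _ (rho * N)^-1).
    by rewrite lef_pV2 ?posrE// ltr_wpDr.
  by rewrite invfM mulrC ler_pM2r ?invr_gt0.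
have l2 : T * c / rho <= T / (T - C * E).
  have -> : T * c / rho = T * (c / rho) by rewrite mulrA.
  rewrite ler_pM2l//; apply: (@le_trans _ _ (rho * D)^-1).
    by rewrite invfM mulrC ler_pM2l ?invr_gt0.
  by rewrite lef_pV2 ?posrE//; move: (CT) T0; lra.
have E2 : 2 * C / T * E = 2 * (C * E) / T by rewrite -!mulrA [T^-1 * E]mulrC.
have TE0 : 0 < T - C * E by move: (CT) T0; lra.
have l3 : T / (T - C * E) - 1 <= 2 * (C * E) / T.
  have -> : T / (T - C * E) - 1 = C * E / (T - C * E) by field; rewrite gt_eqF.
  rewrite ler_pdivrMr// mulrAC ler_pdivlMr//.
  have := ler_wpM2l CE0 (CT); set z := C * E; lra.
have l4 : - (2 * (C * E) / T) <= T / (T + C * E) - 1.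
  have TE1 : 0 < T + C * E by rewrite ltr_wpDr.
  have -> : T / (T + C * E) - 1 = - (C * E / (T + C * E)) by field; rewrite gt_eqF.
  rewrite lerN2 ler_pdivrMr// mulrAC ler_pdivlMr//.
  have := mulr_ge0 CE0 CE0; have := mulr_ge0 CE0 (ltW T0); set z := C * E; lra.
rewrite E2 ler_norml; apply/andP; split; lra.
Qed.

End asymptotics.

(** * Limits as the parameter tends to 0 *)

Section limits.
Context {R : realType}.

Lemma cvg_inv_ereal {T : Type} {F : set_system T} {FF : Filter F} (f : T -> R) (q : \bar R) :
  (0 < q)%E -> (f x)%:E @[x --> F] --> q -> (f x)^-1 @[x --> F] --> fine (q^-1)%E.
Proof.
case: q => [a| |//]; rewrite ?lte_fin => a0 fa.
  rewrite inver gt_eqF//=; apply: cvgV; first by rewrite gt_eqF.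
  exact: (fine_cvg fa).
rewrite invey/=; apply/cvgrPdist_le => /= eps eps0.
apply: filterS (cvgey_gt fa eps^-1) => x.
rewrite lte_fin => h; have fx0 : 0 < f x by apply: lt_trans h; rewrite invr_gt0.
rewrite sub0r normrN gtr0_norm ?invr_gt0//.
by rewrite -[leRHS]invrK lef_pV2 ?posrE ?invr_gt0// ltW.
Qed.

(** ln y <= y at y = 1 / sqrt x, applied to ln x = 2 ln (sqrt x); one square root remains as a
    vanishing factor. *)
Lemma normr_xln_le (x : R) : 0 < x -> x <= 1 -> x * `|ln x| <= 2 * Num.sqrt x.
Proof.
move=> x0 x1.
have s0 : 0 < Num.sqrt x by rewrite sqrtr_gt0.
have sE : x = Num.sqrt x * Num.sqrt x by rewrite -expr2 sqr_sqrtr// ltW.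
have h : ln (Num.sqrt x)^-1 <= (Num.sqrt x)^-1.
  by apply: (le_trans (ln_leB1 _)); rewrite ?invr_gt0// gerBl.
rewrite ler0_norm; last exact: ln_le0.
rewrite {1 2}sE lnM ?posrE//; move: h; rewrite lnV ?posrE// => h.
have := ler_wpM2l (mulr_ge0 (ltW s0) (ltW s0)) h.
rewrite mulfK ?gt_eqF//; lra.
Qed.

Lemma cvg_xln {T : Type} {F : set_system T} {FF : Filter F} (f : T -> R) :
  (\forall x \near F, 0 < f x) -> f x @[x --> F] --> 0 ->
  f x * `|ln (f x)| @[x --> F] --> 0.
Proof.
move=> f0 fF.
have s0 : 2 * Num.sqrt (f x) @[x --> F] --> 0.
  rewrite -[X in _ --> X](mulr0 2); apply: cvgM; first exact: cvg_cst.
  rewrite -[X in _ --> X](@sqrtr0 R).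
  exact: (cvg_comp _ _ fF (@sqrt_continuous R 0)).
apply: (squeeze_cvgr _ (cvg_cst 0) s0).
apply: filterS (filterI f0 (cvgr_le 0 fF _ ltr01)) => x [h0 h1].
by rewrite normr_xln_le// mulr_ge0// ltW.
Qed.

End limits.

Theorem lemma7p3 (R : realType) (rho d : R -> R) (p : R) (q : \bar R)
    (Hpos : \forall e \near 0^'+,
       [/\ 0 < rho e, 0 < d e & d e < rho e / 2])
    (Hrho : rho e @[e --> 0^'+] --> 0)
    (p_gt0 : 0 < p) (q_gt0 : (0 < q)%E)
    (Hp : p_eps (rho e) (d e) @[e --> 0^'+] --> p)
    (Hq : (q_eps (rho e) (d e) e)%:E @[e --> 0^'+] --> q) :
  let qinv := fine (q^-1)%E in
  exists h : R -> R,
    h =O_ (0^'+ : set_system R)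
      (fun e => rho e * `|ln (rho e)|
                + `|(q_eps (rho e) (d e) e)^-1 - qinv|
                + `|p_eps (rho e) (d e) - p|) /\
    \forall e \near 0^'+,
      capacity (rho e) (d e) e
      = (pi * p / (2 + pi * p * qinv) * rho e * (1 + h e))%:E.
Proof.
move=> qinv.
have qinv0 : 0 <= qinv by rewrite fine_ge0// inve_ge0 ltW.
have rho0 : \forall e \near 0^'+, 0 < rho e by apply: filterS Hpos => e [].
have Q_cvg : (q_eps (rho e) (d e) e)^-1 @[e --> 0^'+] --> qinv by exact: cvg_inv_ereal.
have X_cvg : rho e * `|ln (rho e)| @[e --> 0^'+] --> 0 by exact: cvg_xln.
have dist_cvg (f : R -> R) (a : R) : f e @[e --> 0^'+] --> a -> `|f e - a| @[e --> 0^'+] --> 0.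
  by move=> fa; have := cvg_norm (cvgB fa (cvg_cst a)); rewrite subrr normr0; apply.
have P_dist := dist_cvg _ _ Hp; have Q_dist := dist_cvg _ _ Q_cvg.
pose E e := error_scale (rho e) (d e) e p qinv.
have E_cvg : error_factor p qinv * E e @[e --> 0^'+] --> 0.
  rewrite -[X in _ --> X](mulr0 (error_factor p qinv)); apply: cvgM; first exact: cvg_cst.
  have := cvgD (cvgD X_cvg Q_dist) P_dist; rewrite !addr0; exact.
have pi0 := pi_gt0 R.
pose T := qinv + 2 / (pi * p).
have T0 : 0 < T by rewrite ltr_wpDl// divr_gt0// mulr_gt0.
have C0 : 0 < error_factor p qinv.
  have u0 : 0 < 4 / p by exact: divr_gt0.
  have v0 : 0 < 2 / p ^+ 2 by rewrite divr_gt0// exprn_gt0.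
  by rewrite /error_factor; move: qinv0 u0 v0; lra.
(* The exact relative error, 1 / T being the limit of the capacity divided by rho; the equality
   asked for is then algebra, and only the bound on [h] needs the estimates. *)
pose h e := T * fine (capacity (rho e) (d e) e) / rho e - 1.
have main : \forall e \near 0^'+, [/\ 0 < rho e, 0 <= E e,
    capacity (rho e) (d e) e = (fine (capacity (rho e) (d e) e))%:E &
    `|h e| <= 2 * error_factor p qinv / T * E e].
  have p2 : 0 < p / 2 by exact: divr_gt0.
  have p3 : 0 < (2 * p)^-1 by rewrite invr_gt0 mulr_gt0.
  have T2 : 0 < T / 2 by exact: divr_gt0.
  near=> e.
  have [r0 d0 dr] : [/\ 0 < rho e, 0 < d e & d e < rho e / 2] by near: e.
  have e0 : 0 < e by [].
  have h1 : rho e <= expR (- 1) by near: e; exact: (cvgr_le 0 Hrho _ (expR_gt0 (- 1))).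
  have h2 : `|p_eps (rho e) (d e) - p| <= p / 2 by near: e; exact: (cvgr_le 0 P_dist _ p2).
  have h3 : `|(q_eps (rho e) (d e) e)^-1 - qinv| <= 1.
    by near: e; exact: (cvgr_le 0 Q_dist _ ltr01).
  have h4 : error_factor p qinv * E e < (2 * p)^-1 by near: e; exact: (cvgr_lt 0 E_cvg _ p3).
  have h5 : error_factor p qinv * E e <= T / 2 by near: e; exact: (cvgr_le 0 E_cvg _ T2).
  have ln1 : ln (rho e) <= - 1 by rewrite -(@expRK R (- 1)) ler_ln ?posrE ?expR_gt0.
  have [c1 c2] := capacity_asymptotics r0 d0 e0 p_gt0 qinv0 ln1 dr h2 h3 h4 h5.
  by split => //; rewrite /E /error_scale !addr_ge0// mulr_ge0// ltW.
exists h; split.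
  apply/eqO_exP; exists (2 * error_factor p qinv / T).
    by rewrite divr_gt0// mulr_gt0.
  apply: filterS main => e [_ E0 _ he].
  by rewrite [X in _ * X]ger0_norm.
apply: filterS main => e [r0 _ {1}-> _]; congr EFin.
rewrite /h [1 + _]addrC subrK /T; set c := fine _.
have TE : 2 + pi * p * qinv = pi * p * T.
  rewrite /T mulrDr [pi * p * (2 / _)]mulrC divfK ?gt_eqF ?mulr_gt0//; lra.
have pip : pi * p != 0 by rewrite gt_eqF// mulr_gt0.
rewrite TE -/T; move: (pi * p) pip => k k0.
by field; rewrite k0 !gt_eqF.
Unshelve. all: by end_near.
Qed.
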